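(* Let $\rho>1/2$, and let $\Lambda$ be a $\rho$-regular set. Put $$A_\Lambda:=\frac12\max_{\theta\in[0,2\pi]}\left(h_\Lambda(\theta)+h_\Lambda\left(\theta+\frac\pi\rho\right)\right).$$ Then $$\sigma_U(\Lambda)\ge A_\Lambda.$$ In addition, for a real number $C$, $$\sigma_U(\Lambda)\ge C$$ provided that the set $\{t:\ \widehat h_\Lambda(t)\ge C\}$ is locally $\rho$-balanced.
   Context: For $\sigma\ge 0$, $\mathcal E_{\rho,\sigma}$ is the class of entire functions of order $\rho$ and of type not exceeding $\sigma$, meaning: for each $\varepsilon>0$ there is $C_\varepsilon$ with $|f(z)|\le C_\varepsilon e^{(\sigma+\varepsilon)|z|^\rho}$ for all $z\in\mathbb C$. $\Lambda\subset\mathbb C$ is a discrete set (no finite accumulation points), whose points may carry multiplicities; all counts and sums take multiplicities into account. $f|_\Lambda=0$ means that $f$ vanishes at each point of $\Lambda$ with at least its multiplicity. $\Lambda$ is a uniqueness set for a class $\mathcal A$ of entire functions if $f\in\mathcal A$, $f|_\Lambda=0$ imply $f\equiv0$. Put $$\sigma_U(\Lambda)=\sup\{\sigma:\Lambda\text{ is a uniqueness set for }\mathcal E_{\rho,\sigma}\}=\inf\{\sigma:\exists f\in\mathcal E_{\rho,\sigma}\setminus\{0\}:\ f|_\Lambda=0\}$$ ($\sigma$ ranging over $[0,\infty)$, and the supremum of the empty set being $0$). $\Lambda$ has an angular density (with respect to the order $\rho$) if for all $\alpha<\beta$ (angles mod $2\pi$), except maybe countably many values of the angles, the limit $\Delta_\Lambda(\alpha,\beta)=\lim_{R\to\infty}n_\Lambda(R;\alpha,\beta)/R^\rho$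 exists, where $n_\Lambda(R;\alpha,\beta)=\#\{\lambda\in\Lambda:|\lambda|<R,\ \arg\lambda\in(\alpha,\beta)\}$. It is regarded as a finite non-negative measure $\Delta_\Lambda$ on the circle $[0,2\pi)\cong\mathbb R/2\pi\mathbb Z$, called the angular density of $\Lambda$. $\Lambda$ is $\rho$-regular if it has an angular density with respect to the order $\rho$ and, when $\rho$ is an integer, in addition the Lindelöf condition holds: $\lim_{R\to\infty}\sum_{0<|\lambda|\le R}\lambda^{-\rho}$ (sum over $\lambda\in\Lambda$) exists and is finite. (For integer $\rho$ this implies $\int_0^{2\pi}e^{i\rho\theta}\,d\Delta_\Lambda(\theta)=0$.) With $\Delta=\Delta_\Lambda$ (extended $2\pi$-periodically), $h_\Lambda=h_\Delta$ is the $2\pi$-periodic function $h_\Delta(\theta)=\frac{\pi}{\sin\pi\rho}\int_{(\theta-2\pi,\theta]}\cos\rho(\theta-\varphi-\pi)\,d\Delta(\varphi)$ if $\rho\notin\mathbb N$, and $h_\Delta(\theta)=-\int_{(\theta-2\pi,\theta]}(\varphi-\theta)\sin\rho(\varphi-\theta)\,d\Delta(\varphi)$ if $\rho\in\mathbb N$; it satisfies $h_\Delta''+\rho^2h_\Delta=2\pi\rho\Delta$ in the sense of distributions. $TC_\rho$ is the class of $2\pi$-periodic functions $h:\mathbb R\to\mathbb R$ that are $\rho$-trigonometrically convex: $h(\theta)\le\frac{h(\theta_1)\sin\rho(\theta_2-\theta)+h(\theta_2)\sin\rho(\theta-\theta_1)}{\sin\rho(\theta_2-\theta_1)}$ whenever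 $\theta_1\le\theta\le\theta_2$, $0<\theta_2-\theta_1<\pi/\rho$. For integer $\rho$, $h\in TC_\rho$ is called $\rho$-balanced if $0\in\mathrm{conv}\{e^{it\rho}:t\in M_h\}$, where $M_h=\{\theta:\ h(\theta)=\max_{t\in[0,2\pi]}h(t)\}$; for each $h\in TC_\rho$ there is a (unique) $\rho$-balanced function of the form $h(\theta)+A\cos\rho\theta+B\sin\rho\theta$, $A,B\in\mathbb R$, called the $\rho$-balanced modification of $h$. Define $\widehat h=h$ if $\rho\notin\mathbb N$ and $\widehat h=$ the $\rho$-balanced modification of $h$ if $\rho\in\mathbb N$; $\widehat h_\Lambda=\widehat{h_\Lambda}$. A set $M\subset[0,2\pi]$, regarded as a subset of $\mathbb R/2\pi\mathbb Z$ and thus identified with a $2\pi$-periodic subset of $\mathbb R$, is locally $\rho$-balanced if there exists $\theta^*\in[0,2\pi]$ such that $0\in\mathrm{conv}\{e^{it\rho}:\ t\in M\cap[\theta^*,\theta^*+2\pi/\rho]\}$ (conv = convex hull in $\mathbb C$; $M$ is taken as its $2\pi$-periodic extension to $\mathbb R$). *)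

(* Defs.v *)
From HB Require Import structures.
From mathcomp Require Import all_boot all_order all_algebra.
From mathcomp Require Import archimedean complex.
From mathcomp Require Import all_classical all_reals all_analysis.

Set Implicit Arguments.
Unset Strict Implicit.
Unset Printing Implicit Defensive.

Import Order.TTheory GRing.Theory Num.Theory.
Import numFieldNormedType.Exports.

Local Open Scope classical_set_scope.
Local Open Scope ring_scope.

(* The complex numbers over R, packaged as a [numFieldType] so that the
   library's topology and normed-module structure on numeric fields apply; in
   particular [derivable f z 1] is complex differentiability. *)
Definition Cplx (R : realType) : numFieldType := R[i].

Definition cabs (R : realType) (z : Cplx R) : R := ComplexField.Normc.normc z.

Definition ofR (R : realType) (x : R) : Cplx R := x%:C%C.

Definition expi (R : realType) (t : R) : Cplx R := (cos t +i* sin t)%C.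

Definition convex_hullC (R : realType) (S : set (Cplx R)) : set (Cplx R) :=
  [set z | exists (n : nat) (w : 'I_n -> R) (p : 'I_n -> Cplx R),
    [/\ forall i, 0 <= w i, \sum_i w i = 1, forall i, S (p i) &
        z = \sum_i ofR (w i) * p i]].

Definition entire (R : realType) (f : Cplx R -> Cplx R) : Prop :=
  forall z, derivable f z 1.

Definition exp_class (R : realType) (rho sigma : R) :
    set (Cplx R -> Cplx R) :=
  [set f | entire f /\
    forall eps : R, 0 < eps -> exists K : R, forall z,
      cabs (f z) <= K * expR ((sigma + eps) * cabs z `^ rho)].

(* A discrete set whose points carry multiplicities is given by its
   multiplicity function; the points of the set are those of nonzero
   multiplicity. *)
Definition discrete (R : realType) (L : Cplx R -> nat) : Prop :=
  forall r : R, finite_set [set z | (0 < L z)%N /\ cabs z <= r].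

Definition vanishes_on (R : realType) (L : Cplx R -> nat)
    (f : Cplx R -> Cplx R) : Prop :=
  forall z (k : nat), (k < L z)%N -> derive1n k f z = 0.

Definition uniqueness_set (R : realType) (L : Cplx R -> nat)
    (A : set (Cplx R -> Cplx R)) : Prop :=
  forall f, A f -> vanishes_on L f -> forall z, f z = 0.

(* The maximum with 0 implements the convention that the supremum of the
   empty set of nonnegative types is 0. *)
Definition sigma_U (R : realType) (rho : R) (L : Cplx R -> nat) : \bar R :=
  Order.max 0%E (ereal_sup [set s%:E | s in
    [set s : R | 0 <= s /\ uniqueness_set L (exp_class rho s)]]).

(* The angles of z are all the reals t with z = |z| e^{it}, so the intervals
   (a, b) below are understood modulo 2 pi. *)
Definition sector (R : realType) (a b : R) : set (Cplx R) :=
  [set z | z != 0 /\ exists t : R, a < t < b /\ z = ofR (cabs z) * expi t].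

Definition count_sector (R : realType) (L : Cplx R -> nat) (r a b : R) : R :=
  \sum_(z \in [set z | cabs z < r] `&` sector a b) ((L z)%:R : R).

Definition has_angular_density (R : realType) (rho : R) (L : Cplx R -> nat) :
    Prop :=
  exists E : set R, countable E /\
    forall a b : R, a < b <= a + pi *+ 2 -> ~ E a -> ~ E b ->
      cvg ((fun r : R => count_sector L r a b / r `^ rho) @ +oo).

Definition lindelof (R : realType) (n : nat) (L : Cplx R -> nat) : Prop :=
  cvg ((fun r : R =>
    \sum_(z \in [set z : Cplx R | 0 < cabs z <= r]) (L z)%:R * z ^- n) @ +oo).

Definition regular_set (R : realType) (rho : R) (L : Cplx R -> nat) : Prop :=
  has_angular_density rho L /\
  forall n : nat, rho = n%:R -> lindelof n L.

(* A finite measure on R / 2 pi Z, encoded by its 2 pi-periodic extension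
   to R. *)
Definition circle_measure (R : realType) (D : {measure set (measurableTypeR R) -> \bar R}) : Prop :=
  (forall A : set (measurableTypeR R), measurable A ->
     D [set x + pi *+ 2 | x in A] = D A) /\
  (D `[0%R, (pi *+ 2)%R[%classic < +oo)%E.

Definition is_angular_density (R : realType) (rho : R) (L : Cplx R -> nat)
    (D : {measure set (measurableTypeR R) -> \bar R}) : Prop :=
  circle_measure D /\
  exists E : set R, countable E /\
    forall a b : R, a < b <= a + pi *+ 2 -> ~ E a -> ~ E b ->
      (fun r : R => count_sector L r a b / r `^ rho) @ +oo -->
        fine (D `]a, b[%classic).

(* On Borel sets the density is uniquely determined by [L]; it exists as soon as
   [has_angular_density rho L] holds. *)
Definition angular_density (R : realType) (rho : R) (L : Cplx R -> nat) :
    {measure set (measurableTypeR R) -> \bar R} :=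
  xget (mzero : {classic {measure set (measurableTypeR R) -> \bar R}})
    [set D : {classic {measure set (measurableTypeR R) -> \bar R}} | is_angular_density rho L D].

Definition h_measure (R : realType) (rho : R) (D : {measure set (measurableTypeR R) -> \bar R})
    (theta : R) : R :=
  if rho \is a Num.nat then
    - \int[D]_(phi in `]theta - pi *+ 2, theta])
        ((phi - theta) * sin (rho * (phi - theta)))
  else
    pi / sin (pi * rho) *
    \int[D]_(phi in `]theta - pi *+ 2, theta])
        cos (rho * (theta - phi - pi)).

Definition h_set (R : realType) (rho : R) (L : Cplx R -> nat) : R -> R :=
  h_measure rho (angular_density rho L).

Definition trig_convex (R : realType) (rho : R) (h : R -> R) : Prop :=
  periodic h (pi *+ 2) /\
  forall t1 t t2 : R, t1 <= t <= t2 -> 0 < t2 - t1 < pi / rho ->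
    h t <= (h t1 * sin (rho * (t2 - t)) + h t2 * sin (rho * (t - t1)))
             / sin (rho * (t2 - t1)).

(* Only applied to continuous functions, for which the supremum is attained. *)
Definition circle_max (R : realType) (h : R -> R) : R :=
  sup [set h t | t in `[0, pi *+ 2]].

Definition max_set (R : realType) (h : R -> R) : set R :=
  [set t | h t = circle_max h].

Definition balanced (R : realType) (rho : R) (h : R -> R) : Prop :=
  trig_convex rho h /\
  convex_hullC [set expi (t * rho) | t in max_set h] 0.

Definition balanced_modification (R : realType) (rho : R) (h : R -> R) :
    R -> R :=
  xget h [set g : R -> R | balanced rho g /\
    exists A B : R,
      forall t, g t = h t + A * cos (rho * t) + B * sin (rho * t)].

Definition hat (R : realType) (rho : R) (h : R -> R) : R -> R :=
  if rho \is a Num.nat then balanced_modification rho h else h.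

(* [M] is a 2 pi-periodic subset of R. *)
Definition locally_balanced (R : realType) (rho : R) (M : set R) : Prop :=
  exists t0 : R, 0 <= t0 <= pi *+ 2 /\
    convex_hullC [set expi (t * rho) | t in M `&` `[t0, t0 + pi *+ 2 / rho]] 0.

Definition A_set (R : realType) (rho : R) (L : Cplx R -> nat) : R :=
  2^-1 * circle_max (fun t => h_set rho L t + h_set rho L (t + pi / rho)).

(* Main.v *)
(** Let [f <> 0] be of type at most [s] and vanish on [L], and let [w_i >= 0] and
    angles [t_i] in an interval of length [2 pi / rho] satisfy [sum w_i = 1] and
    [sum w_i e^(i rho t_i) = 0].  Then [phi(y) = sum w_i sin(rho (t_i - y)^+)] is
    nonnegative, has support in that interval, and
    [phi'' + rho^2 phi = rho sum w_i delta_(t_i)].  Testing [log |f|] against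
    [kap(log |z|) phi(arg z)] with [kap'' = rho^2 kap] and [kap ~ e^(- rho s)] makes
    the interior terms concentrate on the rays of angle [t_i], so that Green's
    formula on the Riemann surface of the logarithm gives
    [2 pi sum_a kap(log |a|) phi(arg a) <= rho s S + O(1)] for the zeros with
    [log |a| < S].  By the angular density the sum grows like
    [rho S int phi dD], hence [2 pi int phi dD <= s].  On the other hand the
    explicit form of [h] gives [sum w_i h(t_i) = 2 pi int phi dD]; for integer [rho]
    the two sides differ by the integral of a sinusoid of frequency [rho], which
    vanishes by the Lindelof condition.  Thus [sum w_i h(t_i) <= s], and both claims
    are instances of this inequality: the weights [1/2, 1/2] at [t, t + pi / rho],
    and weights that witness the local balance. *)

Require Import Defs.
From mathcomp Require Import all_boot all_order all_algebra.
From mathcomp Require Import complex.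
From mathcomp Require Import all_classical all_reals all_analysis.
From mathcomp Require Import ring lra measurable_realfun.

Set Implicit Arguments.
Unset Strict Implicit.
Unset Printing Implicit Defensive.

Import Order.TTheory GRing.Theory Num.Theory.
Import numFieldNormedType.Exports.
Local Open Scope classical_set_scope.
Local Open Scope ring_scope.

(** * Integrals of continuous functions and Goursat's theorem *)

Section Integral.
Context {R : realType}.
Implicit Types (f g F G : R -> R) (a b c x : R).

(** Green's formula is never applied to [log |f|] itself. Its input is one factor [log |z - a|] at a
    time, for which everything is explicit; [f] is first traded, on a large disc, for a polynomial
    that keeps the prescribed zeros. Roots that this adds do no harm, since [kap] and [phi] are
    nonnegative. In the coordinates [s + i t = log z], both Cauchy's theorem and Green's formula say
    that a pointwise closed form [P ds + Q dt] has zero circulation around a rectangle, so that one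
    Goursat bisection serves both and no double integral occurs. The logarithmic pole is the
    obstacle: rectangles stay between two consecutive lifts of it, and the passage over a lift is
    replaced by a jump of the angular derivative of the potential, found as the limit of an
    arctangent. The bound [rho > 1/2] enters as [2 pi / rho < 4 pi]: the support of [phi] fits, with
    room for a small rotation, into two turns, so that each zero is met on at most three sheets. *)

Lemma primitive_unique F G f a b : a <= b ->
  (forall x, a <= x <= b -> is_derive x 1 F (f x)) ->
  (forall x, a <= x <= b -> is_derive x 1 G (f x)) ->
  F b - F a = G b - G a.
Proof.
move=> ab dF dG.
have dFG x : a <= x <= b -> is_derive x 1 (F \- G) 0.
  move=> xab; have dFx := dF _ xab; have dGx := dG _ xab.
  by rewrite -(subrr (f x)); exact: is_deriveB.
have [| |c _] := @MVT_segment R (F \- G) (fun=> 0) a b ab.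
- by move=> x; rewrite in_itv/= => /andP[ax xb]; apply: dFG; rewrite !ltW.
- apply: derivable_within_continuous => x.
  by rewrite in_itv/= => xab; have [] := dFG x xab.
- by rewrite mul0r /= => /eqP; lra.
Qed.

Lemma primitive_exists_on f a b : continuous f -> a < b ->
  exists F, forall x, a < x < b -> is_derive x 1 F (f x).
Proof.
move=> cf ab.
exists (fun y => \int[lebesgue_measure]_(t in [set` `[a, y]]) (f t)) => x /andP[ax xb].
have [] := @continuous_FTC1_closed R f a x b xb _ ax (cf x).
  apply: continuous_compact_integrable; first exact: segment_compact.
  exact: continuous_subspaceT.
by move=> d <-; apply: DeriveDef; [exact: d|rewrite derive1E].
Qed.

(** The fundamental theorem of calculus gives primitives on the bounded intervals [(-n-1, n+1)]
    only. Normalised to vanish at 0 they agree where they overlap, so [Fn (N x) x - Fn (N x) 0] is a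
    global primitive. *)
Lemma primitive_exists f : continuous f ->
  exists F, forall x, is_derive x 1 F (f x).
Proof.
move=> cf.
have P n : exists F, forall x, - n.+1%:R < x < n.+1%:R -> is_derive x 1 F (f x).
  by apply: primitive_exists_on => //; have := ltr0Sn R n; lra.
pose Fn n := projT1 (cid (P n)).
have dFn n x : - n.+1%:R < x < n.+1%:R -> is_derive x 1 (Fn n) (f x).
  by rewrite /Fn; case: cid => /= G; apply.
have agree n m x : (n <= m)%N -> - n.+1%:R < x < n.+1%:R ->
    Fn n x - Fn n 0 = Fn m x - Fn m 0.
  move=> nm /andP[nx xn].
  have nm' : (n.+1%:R : R) <= m.+1%:R by rewrite ler_nat.
  have n0 : 0 < (n.+1%:R : R) by rewrite ltr0Sn.
  have [x0|x0] := leP 0 x.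
    apply: primitive_unique => // y /andP[y0 yx]; apply: dFn; apply/andP; split; lra.
  suff : Fn n 0 - Fn n x = Fn m 0 - Fn m x by lra.
  by apply: (@primitive_unique _ _ f); [lra| |] => y /andP[y0 yx]; apply: dFn; apply/andP; split; lra.
pose N x := Num.trunc `|x|.
have NP x : `|x| < (N x).+1%:R by have /andP[] := @Num.Theory.trunc_itv R `|x| (normr_ge0 x).
exists (fun x => Fn (N x) x - Fn (N x) 0) => x.
have NPx := NP x; rewrite ltr_norml in NPx.
have dx : is_derive x 1 (fun y => Fn (N x) y - Fn (N x) 0) (f x).
  rewrite -[f x]subr0; have := dFn _ _ NPx => ?; exact: is_deriveB.
apply: near_eq_is_derive dx.
have : \forall y \near x, - (N x).+1%:R < y < (N x).+1%:R.
  by have := @near_in_itvoo R (- (N x).+1%:R) (N x).+1%:R x; apply; rewrite in_itv.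
apply: filterS => y yN.
have [h|h] := leqP (N x) (N y); first by rewrite (agree _ _ _ h).
by rewrite (agree _ _ _ (ltnW h)) // -ltr_norml NP.
Qed.

(* [Int] is only meaningful for continuous integrands: if [f] has no primitive,
   [primitive f] is the junk value [0]. *)
Definition primitive f : R -> R :=
  xget (fun=> 0) [set F | forall x, is_derive x 1 F (f x)].

Definition Int a b f : R := primitive f b - primitive f a.

Lemma is_derive_primitive f : continuous f ->
  forall x, is_derive x 1 (primitive f) (f x).
Proof.
by move=> /primitive_exists[F dF]; rewrite /primitive; case: xgetP => [G _ //|/(_ F)/(_ dF)].
Qed.

(** Once some primitive is known to exist, [xget] picks a genuine one, and two primitives differ by
    a constant. *)
Lemma IntE F f a b : (forall x, is_derive x 1 F (f x)) -> Int a b f = F b - F a.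
Proof.
move=> dF.
have dP : forall x, is_derive x 1 (primitive f) (f x).
  by rewrite /primitive; case: xgetP => [G _ //|/(_ F)/(_ dF)].
have dD x : is_derive x 1 (primitive f \- F) 0.
  have dPx := dP x; have dFx := dF x.
  by rewrite -(subrr (f x)); exact: is_deriveB.
have := is_derive_0_is_cst a b dD; rewrite /Int /=; lra.
Qed.

Lemma Int_cat b a c f : Int a c f = Int a b f + Int b c f.
Proof. by rewrite /Int; lra. Qed.

Lemma Int_sym a b f : Int b a f = - Int a b f.
Proof. by rewrite /Int; lra. Qed.

Lemma IntD a b f g : continuous f -> continuous g ->
  Int a b (fun x => f x + g x) = Int a b f + Int a b g.
Proof.
move=> /is_derive_primitive cf /is_derive_primitive cg.
have /IntE -> : forall x, is_derive x 1 (primitive f \+ primitive g) (f x + g x).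
  by move=> x; exact: is_deriveD.
by rewrite /Int /=; lra.
Qed.

Lemma IntZ k a b f : continuous f -> Int a b (fun x => k * f x) = k * Int a b f.
Proof.
move=> /is_derive_primitive cf.
have /IntE -> : forall x, is_derive x 1 (k \*: primitive f) (k * f x).
  by move=> x; exact: is_deriveZ.
by rewrite /Int /= /GRing.scale/=; lra.
Qed.

Lemma IntB a b f g : continuous f -> continuous g ->
  Int a b (fun x => f x - g x) = Int a b f - Int a b g.
Proof.
move=> /is_derive_primitive cf /is_derive_primitive cg.
have /IntE -> : forall x, is_derive x 1 (primitive f \- primitive g) (f x - g x).
  by move=> x; exact: is_deriveB.
by rewrite /Int /=; lra.
Qed.

Lemma Int_cst a b k : Int a b (fun=> k) = k * (b - a).
Proof.
have /IntE -> : forall x, is_derive x 1 (k \*: (@id R)) k.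
  by move=> x; rewrite -[X in is_derive _ _ _ X]mulr1; exact: is_deriveZ.
by rewrite /= /GRing.scale/=; lra.
Qed.

Lemma Int_shift s a b f : continuous f ->
  Int (a + s) (b + s) f = Int a b (fun x => f (x + s)).
Proof.
move=> /is_derive_primitive cf.
have /IntE -> : forall x, is_derive x 1 (primitive f \o (fun x => x + s)) (f (x + s)) => //.
move=> x; rewrite -[f _]mulr1; apply: is_derive1_comp.
by rewrite -[X in is_derive _ _ _ X](addr0 1); exact: is_deriveD.
Qed.

Lemma Int_opp a b f : continuous f -> Int (- b) (- a) f = Int a b (fun x => f (- x)).
Proof.
move=> /is_derive_primitive cf.
have /IntE -> : forall x, is_derive x 1 (fun x => - primitive f (- x)) (f (- x)).
  move=> x; rewrite -[f _]opprK; apply: is_deriveN.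
  by rewrite -mulrN1; apply: is_derive1_comp.
by rewrite /Int; lra.
Qed.

Lemma Int_le a b f g : a <= b -> continuous f -> continuous g ->
  (forall x, a <= x <= b -> f x <= g x) -> Int a b f <= Int a b g.
Proof.
move=> ab cf cg fg; rewrite -subr_ge0 -IntB //.
have cgf : continuous (fun x => g x - f x) by move=> x; apply: cvgB; [exact: cg|exact: cf].
have dP := is_derive_primitive cgf.
have [|c] := @MVT_segment R (primitive (fun x => g x - f x)) _ a b ab (fun x _ => dP x).
  by apply: derivable_within_continuous => x _; have [] := dP x.
by rewrite in_itv /= /Int => /fg h ->; rewrite mulr_ge0 ?subr_ge0.
Qed.

Lemma eq_Int a b f g : a <= b -> continuous f -> continuous g ->
  (forall x, a <= x <= b -> f x = g x) -> Int a b f = Int a b g.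
Proof. by move=> ab cf cg fg; apply/le_anti; rewrite !Int_le // => x /fg ->. Qed.

Lemma Int_norm_le a b f M : a <= b -> continuous f ->
  (forall x, a <= x <= b -> `|f x| <= M) -> `|Int a b f| <= M * (b - a).
Proof.
move=> ab cf fM; rewrite ler_norml -mulNr -!Int_cst.
by apply/andP; split; apply: Int_le => //; try exact: cst_continuous;
  move=> x /fM; rewrite ler_norml => /andP[].
Qed.

Lemma continuous_sum (I : Type) (r : seq I) (f : I -> R -> R) :
  (forall i, continuous (f i)) -> continuous (fun x => \sum_(i <- r) f i x).
Proof.
move=> cf; elim: r => [|i r IH].
  by under eq_fun do rewrite big_nil; exact: cst_continuous.
under eq_fun do rewrite big_cons.
by move=> x; apply: cvgD; [exact: cf|exact: IH].
Qed.

Lemma Int_sum (I : Type) (r : seq I) a b (f : I -> R -> R) :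
  (forall i, continuous (f i)) ->
  Int a b (fun x => \sum_(i <- r) f i x) = \sum_(i <- r) Int a b (f i).
Proof.
move=> cf; elim: r => [|i r IH].
  by under eq_fun do rewrite big_nil; rewrite Int_cst mul0r big_nil.
under eq_fun do rewrite big_cons.
by rewrite big_cons -IH IntD //; exact: continuous_sum.
Qed.

End Integral.

(** * Goursat's theorem on rectangles, by bisection *)

Section Goursat.
Context {R : realType}.
Implicit Types (P Q F G : R * R -> R) (p q : R * R).

(* Differentiability in Caratheodory's form, which makes sums, products and
   compositions purely algebraic. *)
Definition has_grad F p (a b : R) := exists phi psi : R * R -> R,
  [/\ phi q @[q --> p] --> a, psi q @[q --> p] --> b &
      forall q, F q - F p = phi q * (q.1 - p.1) + psi q * (q.2 - p.2)].

(** The line integral of [P dx + Q dy] along the boundary of the rectangle, counterclockwise. *)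
Definition circulation P Q (x1 x2 y1 y2 : R) : R :=
  Int x1 x2 (fun x => P (x, y1)) - Int x1 x2 (fun x => P (x, y2)) +
  Int y1 y2 (fun y => Q (x2, y)) - Int y1 y2 (fun y => Q (x1, y)).

(** The shared [b] is the condition [dP/dy = dQ/dx], imposed pointwise and without continuity of the
    partial derivatives. *)
Definition closed_on P Q (x1 x2 y1 y2 : R) :=
  forall p, x1 <= p.1 <= x2 -> y1 <= p.2 <= y2 ->
    exists a b c, has_grad P p a b /\ has_grad Q p b c.

(** First-order expansions tested at points of the rectangle only: after clamping, the functions
    need not be differentiable across its boundary. *)
Definition rel_closed_on P Q (x1 x2 y1 y2 : R) :=
  forall p, x1 <= p.1 <= x2 -> y1 <= p.2 <= y2 -> exists a b c : R,
    forall e, 0 < e -> exists2 d, 0 < d & forall q,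
    x1 <= q.1 <= x2 -> y1 <= q.2 <= y2 -> `|q.1 - p.1| < d -> `|q.2 - p.2| < d ->
    `|P q - P p - a * (q.1 - p.1) - b * (q.2 - p.2)| <= e * (`|q.1 - p.1| + `|q.2 - p.2|) /\
    `|Q q - Q p - b * (q.1 - p.1) - c * (q.2 - p.2)| <= e * (`|q.1 - p.1| + `|q.2 - p.2|).

Lemma circulation_cat P Q x1 x2 y1 y2 x y :
  circulation P Q x1 x2 y1 y2 =
  circulation P Q x1 x y1 y + circulation P Q x x2 y1 y +
  (circulation P Q x1 x y y2 + circulation P Q x x2 y y2).
Proof.
rewrite /circulation.
rewrite (Int_cat x x1 x2 (fun x => P (x, y1))) (Int_cat x x1 x2 (fun x => P (x, y2))).
rewrite (Int_cat y y1 y2 (fun y => Q (x2, y))) (Int_cat y y1 y2 (fun y => Q (x1, y))).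
lra.
Qed.

Lemma Int_near_cst a b (f : R -> R) k M : a <= b -> continuous f ->
  (forall x, a <= x <= b -> `|f x - k| <= M) -> `|Int a b f - k * (b - a)| <= M * (b - a).
Proof.
move=> ab cf fM; rewrite -Int_cst -IntB //; last exact: cst_continuous.
by apply: Int_norm_le => // x; apply: cvgB; [exact: cf|exact: cvg_cst].
Qed.

Section continuous_sections.
Variables (P Q : R * R -> R) (x1 x2 y1 y2 : R).
Hypotheses (cP : forall y, continuous (fun x => P (x, y)))
           (cQ : forall x, continuous (fun y => Q (x, y))).

Let lx := x2 - x1.
Let ly := y2 - y1.

(** Under the first-order expansions [B1] becomes [- b] times the area and [B2] becomes [b] times
    the area, and these cancel. What remains is the error [e] times the size of the rectangle times
    its perimeter. *)
Lemma circulation_small u v (n : nat) (a b c e p1 p2 : R) (r := 2^-1 ^+ n) :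
  0 <= lx -> 0 <= ly -> 0 <= e ->
  u <= p1 <= u + lx * r -> v <= p2 <= v + ly * r ->
  (forall q, u <= q.1 <= u + lx * r -> v <= q.2 <= v + ly * r ->
    `|P q - P (p1, p2) - a * (q.1 - p1) - b * (q.2 - p2)| <= e * (`|q.1 - p1| + `|q.2 - p2|) /\
    `|Q q - Q (p1, p2) - b * (q.1 - p1) - c * (q.2 - p2)| <= e * (`|q.1 - p1| + `|q.2 - p2|)) ->
  `|circulation P Q u (u + lx * r) v (v + ly * r)| <= 2 * e * (lx + ly) ^+ 2 * r ^+ 2.
Proof.
move=> lx0 ly0 e0 up vp H.
have r0 : 0 <= r by rewrite exprn_ge0 // invr_ge0.
have lxr : 0 <= lx * r by exact: mulr_ge0.
have lyr : 0 <= ly * r by exact: mulr_ge0.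
have H' q : u <= q.1 <= u + lx * r -> v <= q.2 <= v + ly * r ->
    `|P q - P (p1, p2) - a * (q.1 - p1) - b * (q.2 - p2)| <= e * ((lx + ly) * r) /\
    `|Q q - Q (p1, p2) - b * (q.1 - p1) - c * (q.2 - p2)| <= e * ((lx + ly) * r).
  move=> h1 h2; have [h3 h4] := H q h1 h2.
  suff h : `|q.1 - p1| + `|q.2 - p2| <= (lx + ly) * r.
    by split; [apply: le_trans h3 _|apply: le_trans h4 _]; apply: ler_wpM2l.
  rewrite mulrDl; apply: lerD; rewrite ler_norml; apply/andP; split; lra.
set K := e * ((lx + ly) * r).
set B1 := Int u (u + lx * r) (fun x => P (x, v) - P (x, v + ly * r)).
set B2 := Int v (v + ly * r) (fun y => Q (u + lx * r, y) - Q (u, y)).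
have -> : circulation P Q u (u + lx * r) v (v + ly * r) = B1 + B2.
  by rewrite /B1 /B2 !IntB // /circulation; lra.
have h1 : `|B1 - (- b * (ly * r)) * (u + lx * r - u)| <= (2 * K) * (u + lx * r - u).
  apply: Int_near_cst; [lra| |].
    by move=> x; apply: cvgB; exact: cP.
  move=> x ux.
  have [k1 _] := H' (x, v) ux ltac:(rewrite /=; apply/andP; split; lra).
  have [k2 _] := H' (x, v + ly * r) ux ltac:(rewrite /=; apply/andP; split; lra).
  move: k1 k2; rewrite -/K /= !ler_norml => /andP[? ?] /andP[? ?].
  apply/andP; split; lra.
have h2 : `|B2 - (b * (lx * r)) * (v + ly * r - v)| <= (2 * K) * (v + ly * r - v).
  apply: Int_near_cst; [lra| |].
    by move=> x; apply: cvgB; exact: cQ.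
  move=> y vy.
  have [_ k1] := H' (u, y) ltac:(rewrite /=; apply/andP; split; lra) vy.
  have [_ k2] := H' (u + lx * r, y) ltac:(rewrite /=; apply/andP; split; lra) vy.
  move: k1 k2; rewrite -/K /= !ler_norml => /andP[? ?] /andP[? ?].
  apply/andP; split; lra.
have -> : 2 * e * (lx + ly) ^+ 2 * r ^+ 2 = 2 * K * (lx * r) + 2 * K * (ly * r) by rewrite /K; ring.
have -> : B1 + B2 = (B1 - (- b * (ly * r)) * (u + lx * r - u)) + (B2 - (b * (lx * r)) * (v + ly * r - v)) by ring.
apply: le_trans (ler_normD _ _) _; apply: lerD.
  by apply: le_trans h1 _; rewrite addrAC subrr add0r.
by apply: le_trans h2 _; rewrite addrAC subrr add0r.
Qed.

(** Stated as a [sig] type, so that the recursion [bisect] can extract the chosen quarter with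
    [sval]. *)
Lemma circulation_quarter u v l m :
  {w : R * R | [/\ w.1 = u \/ w.1 = u + l * 2^-1, w.2 = v \/ w.2 = v + m * 2^-1 &
    `|circulation P Q u (u + l) v (v + m)| <=
    4 * `|circulation P Q w.1 (w.1 + l * 2^-1) w.2 (w.2 + m * 2^-1)|]}.
Proof.
apply: cid.
have e1 : u + l = u + l * 2^-1 + l * 2^-1 by lra.
have e2 : v + m = v + m * 2^-1 + m * 2^-1 by lra.
have : circulation P Q u (u + l) v (v + m) =
    circulation P Q u (u + l * 2^-1) v (v + m * 2^-1) +
    circulation P Q (u + l * 2^-1) (u + l * 2^-1 + l * 2^-1) v (v + m * 2^-1) +
   (circulation P Q u (u + l * 2^-1) (v + m * 2^-1) (v + m * 2^-1 + m * 2^-1) +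
    circulation P Q (u + l * 2^-1) (u + l * 2^-1 + l * 2^-1) (v + m * 2^-1) (v + m * 2^-1 + m * 2^-1)).
  by rewrite -e1 -e2; exact: circulation_cat.
set A := circulation P Q u (u + l) v (v + m).
set a1 := circulation _ _ u _ v _; set a2 := circulation _ _ _ _ v _.
set a3 := circulation _ _ u _ _ _; set a4 := circulation _ _ _ _ _ _ => E.
have [k1|k1] := leP `|A| (4 * `|a1|); first by exists (u, v); split; [left|left|].
have [k2|k2] := leP `|A| (4 * `|a2|); first by exists (u + l * 2^-1, v); split; [right|left|].
have [k3|k3] := leP `|A| (4 * `|a3|); first by exists (u, v + m * 2^-1); split; [left|right|].
exists (u + l * 2^-1, v + m * 2^-1); split; [by right|by right|rewrite /= -/a4].
have := ler_normD (a1 + a2) (a3 + a4); have := ler_normD a1 a2; have := ler_normD a3 a4.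
rewrite -E; lra.
Qed.

Fixpoint bisect (n : nat) : R * R :=
  if n is k.+1 then
    sval (circulation_quarter (bisect k).1 (bisect k).2 (lx * 2^-1 ^+ k) (ly * 2^-1 ^+ k))
  else (x1, y1).

Hypotheses (x12 : x1 <= x2) (y12 : y1 <= y2).

Let lx0 : 0 <= lx. Proof. by rewrite /lx subr_ge0. Qed.
Let ly0 : 0 <= ly. Proof. by rewrite /ly subr_ge0. Qed.

Lemma bisectP n : [/\
  (bisect n).1 <= (bisect n.+1).1 <= (bisect n).1 + lx * 2^-1 ^+ n.+1,
  (bisect n).2 <= (bisect n.+1).2 <= (bisect n).2 + ly * 2^-1 ^+ n.+1 &
  `|circulation P Q x1 x2 y1 y2| * (4^-1) ^+ n <=
  `|circulation P Q (bisect n).1 ((bisect n).1 + lx * 2^-1 ^+ n)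
                    (bisect n).2 ((bisect n).2 + ly * 2^-1 ^+ n)|].
Proof.
have K k : [/\ (bisect k.+1).1 = (bisect k).1 \/ (bisect k.+1).1 = (bisect k).1 + lx * 2^-1 ^+ k.+1,
   (bisect k.+1).2 = (bisect k).2 \/ (bisect k.+1).2 = (bisect k).2 + ly * 2^-1 ^+ k.+1 &
   `|circulation P Q (bisect k).1 ((bisect k).1 + lx * 2^-1 ^+ k)
                    (bisect k).2 ((bisect k).2 + ly * 2^-1 ^+ k)| <= 4 * 
  `|circulation P Q (bisect k.+1).1 ((bisect k.+1).1 + lx * 2^-1 ^+ k.+1)
                    (bisect k.+1).2 ((bisect k.+1).2 + ly * 2^-1 ^+ k.+1)|].
  by rewrite /=; case: circulation_quarter => w /=; rewrite -!mulrA -exprSr.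
have [K1 K2 _] := K n.
have px : 0 <= lx * 2^-1 ^+ n.+1 by rewrite mulr_ge0 // exprn_ge0 // invr_ge0.
have py : 0 <= ly * 2^-1 ^+ n.+1 by rewrite mulr_ge0 // exprn_ge0 // invr_ge0.
split.
- by case: K1 => ->; apply/andP; split; lra.
- by case: K2 => ->; apply/andP; split; lra.
elim: {K1 K2 px py} n => [|n IH].
  by rewrite !expr0 !mulr1 /lx /ly /= !(addrC _ (_ - _)) !subrK.
have [_ _ K3] := K n.
have := le_trans IH K3; rewrite [4^-1 ^+ n.+1]exprSr mulrA.
set U := `|_| * _; set V := `|circulation P Q _ _ _ _|; lra.
Qed.

(** In each coordinate the lower ends increase and the upper ends decrease; the supremum of the
    lower ends lies in all the intervals. *)
Lemma bisect_limit : exists p : R * R, forall n,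
  (bisect n).1 <= p.1 <= (bisect n).1 + lx * 2^-1 ^+ n /\
  (bisect n).2 <= p.2 <= (bisect n).2 + ly * 2^-1 ^+ n.
Proof.
suff H (u : nat -> R) l : (forall n, u n <= u n.+1 <= u n + l * 2^-1 ^+ n.+1) ->
    exists s, forall n, u n <= s <= u n + l * 2^-1 ^+ n.
  have [s Hs] := H (fun n => (bisect n).1) lx (fun n => let: And3 a _ _ := bisectP n in a).
  have [t Ht] := H (fun n => (bisect n).2) ly (fun n => let: And3 _ a _ := bisectP n in a).
  by exists (s, t) => n; split; [exact: Hs|exact: Ht].
move=> Hu.
have incr n k : u n <= u (n + k)%N.
  elim: k => [|k IH]; first by rewrite addn0.
  by rewrite addnS; apply: le_trans IH _; have /andP[] := Hu (n + k)%N.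
have decr n k : u (n + k)%N + l * 2^-1 ^+ (n + k) <= u n + l * 2^-1 ^+ n.
  elim: k => [|k IH]; first by rewrite addn0.
  apply: le_trans IH; rewrite addnS; have /andP[_] := Hu (n + k)%N.
  rewrite exprSr mulrA; lra.
have pos n : 0 <= l * 2^-1 ^+ n.
  have /andP[a b] := Hu 0%N; rewrite mulr_ge0 ?exprn_ge0 ?invr_ge0 //.
  by have := le_trans a b; rewrite expr1; lra.
have ub n m : u m <= u n + l * 2^-1 ^+ n.
  have [/subnKC <-|/ltnW/subnKC <-] := leqP n m.
    by apply: le_trans (decr n (m - n)%N); rewrite lerDl pos.
  by apply: le_trans (incr m (n - m)%N) _; rewrite lerDl pos.
have hs : has_sup (range u).
  by split; [exists (u 0%N), 0%N|exists (u 0%N + l * 2^-1 ^+ 0) => _ [m _ <-]].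
exists (sup (range u)) => n; apply/andP; split.
  by apply: ub_le_sup; [case: hs|exists n].
by apply: ge_sup; [case: hs|move=> _ [m _ <-]].
Qed.

Lemma goursat_continuous : rel_closed_on P Q x1 x2 y1 y2 -> circulation P Q x1 x2 y1 y2 = 0.
Proof.
move=> cl; apply/eqP/negPn/negP => c0.
have [[p1 p2] /= Hp] := bisect_limit.
have [p1x p2y] := Hp 0%N; rewrite /= !expr0 !mulr1 in p1x p2y.
have p1x' : x1 <= p1 <= x2 by move: p1x; rewrite /lx; lra.
have p2y' : y1 <= p2 <= y2 by move: p2y; rewrite /ly; lra.
have [a [b [c H]]] := cl (p1, p2) p1x' p2y'.
set C := `|circulation P Q x1 x2 y1 y2|.
have C0 : 0 < C by rewrite normr_gt0.
(* With [e = C / (4 K)] the bound of [circulation_small] is at most [C / 2] times [4^-n], below the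
   lower bound [C 4^-n] of [bisectP]; the [+ 1] keeps [K] positive for a degenerate rectangle. *)
pose K := (lx + ly) ^+ 2 + 1.
have K0 : 0 < K by rewrite /K ltr_pwDr // sqr_ge0.
have e0 : 0 < C / (4 * K) by rewrite divr_gt0 // mulr_gt0.
have [d d0 Hd] := H _ e0.
have [n nd] : exists n, (lx + ly) * 2^-1 ^+ n < d.
  have cv : (lx + ly) * 2^-1 ^+ n @[n --> \oo] --> (lx + ly) * 0.
    by apply: cvgMr; apply: cvg_expr; rewrite ger0_norm ?invr_ge0 //; lra.
  rewrite mulr0 in cv.
  have [N _ /(_ N)] := @cvgr_lt R _ _ _ _ 0 cv d d0.
  by move=> /(_ (leqnn _)) h; exists N.
have [h1 h2] := Hp n.
have [_ _ low] := bisectP n.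
have in_x (k : nat) x : (bisect k).1 <= x <= (bisect k).1 + lx * 2^-1 ^+ k -> x1 <= x <= x2.
  elim: k x => [|k IH] x; first by rewrite expr0 mulr1 /lx /=; lra.
  move=> xk; apply: IH; have [k1 _ _] := bisectP k.
  by rewrite exprSr mulrA in k1 xk; lra.
have in_y (k : nat) x : (bisect k).2 <= x <= (bisect k).2 + ly * 2^-1 ^+ k -> y1 <= x <= y2.
  elim: k x => [|k IH] x; first by rewrite expr0 mulr1 /ly /=; lra.
  move=> xk; apply: IH; have [_ k1 _] := bisectP k.
  by rewrite exprSr mulrA in k1 xk; lra.
have r0 : 0 <= (2^-1 : R) ^+ n by rewrite exprn_ge0 // invr_ge0.
have kx : 0 <= lx * 2^-1 ^+ n by rewrite mulr_ge0.
have ky : 0 <= ly * 2^-1 ^+ n by rewrite mulr_ge0.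
have Q1 q : (bisect n).1 <= q.1 <= (bisect n).1 + lx * 2^-1 ^+ n -> (bisect n).2 <= q.2 <= (bisect n).2 + ly * 2^-1 ^+ n ->
  `|P q - P (p1, p2) - a * (q.1 - p1) - b * (q.2 - p2)| <= C / (4 * K) * (`|q.1 - p1| + `|q.2 - p2|) /\
  `|Q q - Q (p1, p2) - b * (q.1 - p1) - c * (q.2 - p2)| <= C / (4 * K) * (`|q.1 - p1| + `|q.2 - p2|).
  move=> qx qy.
  apply: (Hd q); [exact: in_x qx|exact: in_y qy| |].
    by rewrite mulrDl in nd; rewrite ltr_norml /=; lra.
  by rewrite mulrDl in nd; rewrite ltr_norml /=; lra.
have := le_trans low (@circulation_small (bisect n).1 (bisect n).2 n a b c (C / (4 * K)) p1 p2 lx0 ly0 (ltW e0) h1 h2 Q1).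
rewrite -exprM mulnC exprM.
have -> : (2^-1 : R) ^+ 2 = 4^-1 by rewrite expr2; lra.
rewrite ler_pM2r ?exprn_gt0 ?invr_gt0 //.
have -> : 2 * (C / (4 * K)) * (lx + ly) ^+ 2 = C / 2 * ((lx + ly) ^+ 2 / K) by field; rewrite gt_eqF.
have : (lx + ly) ^+ 2 / K <= 1 by rewrite ler_pdivrMr // mul1r lerDl.
rewrite -/C; nra.
Qed.

End continuous_sections.
End Goursat.

(** * Calculus of gradients, and Goursat's theorem for closed forms *)

Section Gradients.
Context {R : realType}.
Implicit Types (P Q F G : R * R -> R) (p q : R * R).

Lemma caratheodory (f : R -> R) (x d : R) : is_derive x 1 f d ->
  exists2 g : R -> R, g y @[y --> x] --> d & forall y, f y - f x = g y * (y - x).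
Proof.
by move=> /is_derive1_caratheodory[g [H1 H2 <-]]; exists g => //; exact: H2.
Qed.

Lemma cvg_diff1 p : q.1 - p.1 @[q --> p] --> (0 : R).
Proof. by rewrite -(subrr p.1); apply: cvgB; [exact: cvg_fst|exact: cvg_cst]. Qed.

Lemma cvg_diff2 p : q.2 - p.2 @[q --> p] --> (0 : R).
Proof. by rewrite -(subrr p.2); apply: cvgB; [exact: cvg_snd|exact: cvg_cst]. Qed.

Lemma has_grad_cvg F p a b : has_grad F p a b -> F q @[q --> p] --> F p.
Proof.
move=> [phi [psi [c1 c2 E]]].
have H : F p + (phi q * (q.1 - p.1) + psi q * (q.2 - p.2)) @[q --> p] --> F p.
  rewrite -[X in _ --> X]addr0 -[X in _ --> _ + X](addr0 0).
  rewrite -[X in _ --> _ + (X + _)](mulr0 a) -[X in _ --> _ + (_ + X)](mulr0 b).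
  apply: cvgD; first exact: cvg_cst.
  by apply: cvgD; apply: cvgM => //; [exact: cvg_diff1|exact: cvg_diff2].
apply: cvg_trans H; apply: near_eq_cvg; apply: nearW => q.
by rewrite -E addrC subrK.
Qed.

Lemma has_grad_cst k p : has_grad (fun=> k) p 0 0.
Proof.
by exists (fun=> 0), (fun=> 0); split; [exact: cvg_cst|exact: cvg_cst|move=> q; ring].
Qed.

Lemma has_grad_fst (f : R -> R) p (d : R) : is_derive p.1 1 f d -> has_grad (fun q => f q.1) p d 0.
Proof.
move=> /caratheodory[g cg E]; exists (fun q => g q.1), (fun=> 0).
split; [|exact: cvg_cst|by move=> q; rewrite E; ring].
exact: (cvg_comp _ _ (@cvg_fst _ _ _ _ _) cg).
Qed.

Lemma has_grad_snd (f : R -> R) p (d : R) : is_derive p.2 1 f d -> has_grad (fun q => f q.2) p 0 d.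
Proof.
move=> /caratheodory[g cg E]; exists (fun=> 0), (fun q => g q.2).
split; [exact: cvg_cst| |by move=> q; rewrite E; ring].
exact: (cvg_comp _ _ (@cvg_snd _ _ _ _ _) cg).
Qed.

Lemma has_gradD F G p a b c d : has_grad F p a b -> has_grad G p c d ->
  has_grad (fun q => F q + G q) p (a + c) (b + d).
Proof.
move=> [f1 [f2 [c1 c2 E1]]] [g1 [g2 [c3 c4 E2]]].
exists (fun q => f1 q + g1 q), (fun q => f2 q + g2 q); split; [exact: cvgD|exact: cvgD|].
by move=> q; have := E1 q; have := E2 q; lra.
Qed.

Lemma has_gradM F G p a b c d : has_grad F p a b -> has_grad G p c d ->
  has_grad (fun q => F q * G q) p (a * G p + F p * c) (b * G p + F p * d).
Proof.
move=> hF hG; have cG := has_grad_cvg hG.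
move: hF hG => [f1 [f2 [c1 c2 E1]]] [g1 [g2 [c3 c4 E2]]].
exists (fun q => f1 q * G q + F p * g1 q), (fun q => f2 q * G q + F p * g2 q); split.
- by apply: cvgD; apply: cvgM => //; exact: cvg_cst.
- by apply: cvgD; apply: cvgM => //; exact: cvg_cst.
move=> q; rewrite [LHS](_ : _ = (F q - F p) * G q + F p * (G q - G p)); last by ring.
by rewrite E1 E2; ring.
Qed.

Lemma has_gradZ k F p a b : has_grad F p a b -> has_grad (fun q => k * F q) p (k * a) (k * b).
Proof.
move=> hF; have := has_gradM (has_grad_cst k p) hF.
by rewrite !mul0r !add0r.
Qed.

Lemma has_gradN F p a b : has_grad F p a b -> has_grad (fun q => - F q) p (- a) (- b).
Proof.
move=> /(has_gradZ (-1)); rewrite !mulN1r.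
by under eq_fun do rewrite mulN1r.
Qed.

Lemma has_gradB F G p a b c d : has_grad F p a b -> has_grad G p c d ->
  has_grad (fun q => F q - G q) p (a - c) (b - d).
Proof. by move=> hF hG; exact: has_gradD hF (has_gradN hG). Qed.

Lemma has_grad_comp (g : R -> R) F p (a b d : R) : has_grad F p a b ->
  is_derive (F p) 1 g d -> has_grad (fun q => g (F q)) p (d * a) (d * b).
Proof.
move=> hF /caratheodory[h ch E]; have cF := has_grad_cvg hF.
move: hF => [f1 [f2 [c1 c2 E1]]].
have chF : h (F q) @[q --> p] --> d := cvg_comp _ _ cF ch.
exists (fun q => h (F q) * f1 q), (fun q => h (F q) * f2 q); split; [exact: cvgM|exact: cvgM|].
by move=> q; rewrite E E1; ring.
Qed.

Lemma has_grad_eps F p a b : has_grad F p a b -> forall e, 0 < e ->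
  exists2 d, 0 < d & forall q, `|q.1 - p.1| < d -> `|q.2 - p.2| < d ->
    `|F q - F p - a * (q.1 - p.1) - b * (q.2 - p.2)| <= e * (`|q.1 - p.1| + `|q.2 - p.2|).
Proof.
move=> [phi [psi [c1 c2 E]]] e e0.
have /cvgrPdist_le/(_ e e0) n1 := c1; have /cvgrPdist_le/(_ e e0) n2 := c2.
have [d /= d0 dH] := (@nbhs_ballP R _ p _).1 (filterI n1 n2).
exists d => // q q1 q2.
have [|h1 h2] := dH q; first by split; rewrite /ball /= distrC.
rewrite E (_ : _ - _ = (phi q - a) * (q.1 - p.1) + (psi q - b) * (q.2 - p.2)); last by ring.
apply: le_trans (ler_normD _ _) _; rewrite !normrM mulrDr.
by apply: lerD; apply: ler_wpM2r => //; rewrite distrC.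
Qed.

(** Composition with the projection onto the rectangle turns a form that is regular there into one
    whose sections are continuous on the whole line, as [Int] requires. *)
Definition clamp (a b x : R) := Num.max a (Num.min x b).

Lemma clamp_id a b x : a <= x <= b -> clamp a b x = x.
Proof. by move=> /andP[ax xb]; rewrite /clamp (min_idPl xb) (max_idPr ax). Qed.

Lemma clamp_in a b x : a <= b -> a <= clamp a b x <= b.
Proof. by move=> ab; rewrite /clamp le_max lexx /= ge_max ab ge_min lexx orbT. Qed.

Lemma lipschitz_continuous (f : R -> R) k :
  (forall x y, `|f x - f y| <= k * `|x - y|) -> continuous f.
Proof.
move=> lf x; apply/cvgrPdist_le => e e0.
have k0 : 0 < `|k| + 1 by rewrite ltr_wpDl.
near=> y; apply: le_trans (lf x y) _.
have h : `|x - y| <= e / (`|k| + 1).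
  by near: y; apply: cvgr_dist_le; [exact: cvg_id|exact: divr_gt0].
apply: (@le_trans _ _ ((`|k| + 1) * `|x - y|)).
  by apply: ler_wpM2r => //; have := ler_norm k; lra.
by rewrite mulrC -ler_pdivlMr.
Unshelve. all: by end_near. Qed.

Lemma continuous_clamp a b : continuous (clamp a b).
Proof.
apply: (@lipschitz_continuous _ 1) => x y; rewrite mul1r /clamp.
wlog xy : x y / x <= y.
  by move=> H; case: (leP x y) => [/H//|/ltW/H]; rewrite distrC (distrC y).
rewrite [X in _ <= X]ler0_norm ?subr_le0 // ler_norml !maxEle !minEle.
by case: (leP x b) => ? /=; case: (leP y b) => ? /=; case: ifPn; rewrite -?ltNge => ?;
  try case: ifPn; rewrite -?ltNge => *; apply/andP; split; lra.
Qed.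

(** [goursat_continuous] applies to the clamped form; the four continuity hypotheses let [eq_Int]
    identify its boundary integrals with the original ones. *)
Theorem goursat P Q x1 x2 y1 y2 : x1 <= x2 -> y1 <= y2 -> closed_on P Q x1 x2 y1 y2 ->
  continuous (fun x => P (x, y1)) -> continuous (fun x => P (x, y2)) ->
  continuous (fun y => Q (x1, y)) -> continuous (fun y => Q (x2, y)) ->
  circulation P Q x1 x2 y1 y2 = 0.
Proof.
move=> x12 y12 cl cP1 cP2 cQ1 cQ2.
pose cp q := (clamp x1 x2 q.1, clamp y1 y2 q.2).
have cont F : (forall p, x1 <= p.1 <= x2 -> y1 <= p.2 <= y2 -> F q @[q --> p] --> F p) ->
    (forall y, continuous (fun x => F (cp (x, y)))) /\ (forall x, continuous (fun y => F (cp (x, y)))).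
  move=> H; split=> [y x|x y].
    apply: (@cvg_comp _ _ _ (fun x => cp (x, y)) F _ (nbhs (cp (x, y))));
      last by apply: H; exact: clamp_in.
    exact: cvg_pair (@continuous_clamp x1 x2 x) (cvg_cst (clamp y1 y2 y)).
  apply: (@cvg_comp _ _ _ (fun y => cp (x, y)) F _ (nbhs (cp (x, y))));
    last by apply: H; exact: clamp_in.
  exact: cvg_pair (cvg_cst (clamp x1 x2 x)) (@continuous_clamp y1 y2 y).
have [cPx _] := cont P (fun p h1 h2 => let: ex_intro _ (ex_intro _ (ex_intro _ (conj h _))) := cl p h1 h2 in has_grad_cvg h).
have [_ cQy] := cont Q (fun p h1 h2 => let: ex_intro _ (ex_intro _ (ex_intro _ (conj _ h))) := cl p h1 h2 in has_grad_cvg h).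
have := @goursat_continuous R (P \o cp) (Q \o cp) x1 x2 y1 y2 cPx cQy x12 y12.
have cpid q : x1 <= q.1 <= x2 -> y1 <= q.2 <= y2 -> cp q = q.
  by case: q => q1 q2 /= h1 h2; rewrite /cp !clamp_id.
have clr : rel_closed_on (P \o cp) (Q \o cp) x1 x2 y1 y2.
  move=> p p1 p2.
  have [a [b [c [hP hQ]]]] := cl p p1 p2; exists a, b, c => e e0.
  have [d1 d10 H1] := has_grad_eps hP e0; have [d2 d20 H2] := has_grad_eps hQ e0.
  exists (Num.min d1 d2); first by rewrite lt_min d10.
  move=> q q1 q2; rewrite !lt_min => /andP[? ?] /andP[? ?].
  by rewrite /= !cpid //; split; [exact: H1|exact: H2].
move=> /(_ clr); rewrite /circulation => <-; congr (_ - _ + _ - _); apply: eq_Int => //.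
all: try exact: cPx.
all: try exact: cQy.
all: by move=> x hx; rewrite /= cpid //= ?lexx ?x12 ?y12.
Qed.
End Gradients.

(** * Entire functions *)

Section Complex.
Context {R : realType}.
Local Notation C := (Cplx R).
Implicit Types (z w : C) (x y t : R).

Lemma cabsE z : cabs z = Num.sqrt (complex.Re z ^+ 2 + complex.Im z ^+ 2).
Proof. by case: z. Qed.

Lemma cabs_normE z : `|z| = ofR (cabs z) :> C.
Proof. by rewrite cabsE; exact: normc_def. Qed.

Lemma cabs_ge0 z : 0 <= cabs z. Proof. by rewrite cabsE sqrtr_ge0. Qed.
Lemma cabs0 : cabs (0 : C) = 0. Proof. exact: ComplexField.Normc.normc0. Qed.
Lemma cabs1 : cabs (1 : C) = 1. Proof. exact: ComplexField.Normc.normc1. Qed.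
Lemma cabs0_eq0 z : cabs z = 0 -> z = 0. Proof. exact: ComplexField.Normc.eq0_normc. Qed.
Lemma cabs_eq0 z : (cabs z == 0) = (z == 0).
Proof. by apply/eqP/eqP => [/cabs0_eq0//|->]; exact: cabs0. Qed.
Lemma cabs_gt0 z : (0 < cabs z) = (z != 0).
Proof. by rewrite lt_neqAle cabs_ge0 andbT eq_sym cabs_eq0. Qed.
Lemma cabsM z w : cabs (z * w) = cabs z * cabs w. Proof. exact: ComplexField.Normc.normcM. Qed.
Lemma cabsV z : cabs z^-1 = (cabs z)^-1. Proof. exact: ComplexField.Normc.normcV. Qed.
Lemma cabsN z : cabs (- z) = cabs z. Proof. by rewrite !cabsE; case: z => a b /=; rewrite !sqrrN. Qed.
Lemma cabsD z w : cabs (z + w) <= cabs z + cabs w. 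
Proof. by have := ler_normD z w; rewrite !cabs_normE -(rmorphD (real_complex R)) lecR. Qed.
Lemma cabsB z w : cabs (z - w) <= cabs z + cabs w.
Proof. by rewrite -(cabsN w); exact: cabsD. Qed.
Lemma cabsC z w : cabs (z - w) = cabs (w - z).
Proof. by rewrite -cabsN opprB. Qed.
Lemma cabsX z n : cabs (z ^+ n) = cabs z ^+ n.
Proof. by elim: n => [|n IH]; rewrite ?expr0 ?cabs1 // !exprS cabsM IH. Qed.
Lemma cabs_lbD z w : cabs z - cabs w <= cabs (z + w).
Proof. by have := cabsD (z + w) (- w); rewrite addrK cabsN; lra. Qed.

Lemma ofRM x y : ofR (x * y) = ofR x * ofR y :> C. Proof. exact: (rmorphM (real_complex R)). Qed.
Lemma ofR0 : ofR 0 = 0 :> C. Proof. by []. Qed.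
Lemma ofR1 : ofR 1 = 1 :> C. Proof. by []. Qed.
Lemma ofR_eq0 x : (ofR x == 0 :> C) = (x == 0).
Proof. exact: (fmorph_eq0 (real_complex R)). Qed.
Lemma cabs_ofR x : cabs (ofR x) = `|x|.
Proof. by rewrite cabsE /= expr0n addr0 sqrtr_sqr. Qed.
Lemma reD z w : complex.Re (z + w) = complex.Re z + complex.Re w. Proof. by case: z; case: w. Qed.
Lemma imD z w : complex.Im (z + w) = complex.Im z + complex.Im w. Proof. by case: z; case: w. Qed.
Lemma reN z : complex.Re (- z) = - complex.Re z. Proof. by case: z. Qed.
Lemma imN z : complex.Im (- z) = - complex.Im z. Proof. by case: z. Qed.
Lemma reM z w : complex.Re (z * w) = complex.Re z * complex.Re w - complex.Im z * complex.Im w.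
Proof. by case: z; case: w. Qed.
Lemma imM z w : complex.Im (z * w) = complex.Re z * complex.Im w + complex.Im z * complex.Re w.
Proof. by case: z; case: w. Qed.
Lemma complex_ext z w : complex.Re z = complex.Re w -> complex.Im z = complex.Im w -> z = w.
Proof. by case: z; case: w => a b c d /= -> ->. Qed.
Lemma Re_le_cabs z : `|complex.Re z| <= cabs z.
Proof. by rewrite cabsE -sqrtr_sqr ler_sqrt ?addr_ge0 ?sqr_ge0 // lerDl sqr_ge0. Qed.
Lemma Im_le_cabs z : `|complex.Im z| <= cabs z.
Proof. by rewrite cabsE -sqrtr_sqr ler_sqrt ?addr_ge0 ?sqr_ge0 // lerDr sqr_ge0. Qed.
Lemma cabs_le_ReIm z : cabs z <= `|complex.Re z| + `|complex.Im z|.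
Proof.
have {1}-> : z = ofR (complex.Re z) + (0 +i* complex.Im z)%C.
  by apply: complex_ext; rewrite ?reD ?imD /= ?addr0 ?add0r.
apply: le_trans (cabsD _ _) _; rewrite cabs_ofR lerD2l.
by rewrite cabsE /= expr0n add0r sqrtr_sqr.
Qed.

Lemma expi0 : expi 0 = 1 :> C.
Proof. by rewrite /expi cos0 sin0. Qed.
Lemma expiD x y : expi (x + y) = expi x * expi y :> C.
Proof. by rewrite /expi sinD cosD; apply: complex_ext; rewrite ?reM ?imM /=; ring. Qed.
Lemma cabs_expi x : cabs (expi x : C) = 1.
Proof. by rewrite cabsE /= cos2Dsin2 sqrtr1. Qed.
Lemma expi_neq0 x : expi x != 0 :> C.
Proof. by rewrite -cabs_gt0 cabs_expi. Qed.
Lemma expiN x : expi (- x) = (expi x)^-1 :> C.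
Proof. by apply: (mulfI (expi_neq0 x)); rewrite -expiD subrr expi0 divff // expi_neq0. Qed.
Lemma expi2pi : expi (pi *+ 2) = 1 :> C.
Proof. by rewrite /expi cos2pi sin2pi. Qed.
Lemma expiX x n : expi x ^+ n = expi (n%:R * x) :> C.
Proof.
elim: n => [|n IH]; first by rewrite expr0 mul0r expi0.
by rewrite exprS IH -expiD; congr expi; rewrite -(natr1 n); ring.
Qed.
Lemma expi_periodic x (n : nat) : expi (x + (pi *+ 2) * n%:R) = expi x :> C.
Proof. by rewrite expiD [_ * n%:R]mulrC -expiX expi2pi expr1n mulr1. Qed.

Lemma polar z : exists2 t, - pi <= t <= pi & z = ofR (cabs z) * expi t.
Proof.
have [->|z0] := eqVneq z 0; first by exists 0; rewrite ?cabs0 ?mul0r // oppr_le0 pi_ge0.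
have r0 : cabs z != 0 by rewrite cabs_eq0.
set r := cabs z; pose a := complex.Re z / r; pose b := complex.Im z / r.
have ab : a ^+ 2 + b ^+ 2 = 1.
  have : r ^+ 2 = complex.Re z ^+ 2 + complex.Im z ^+ 2.
    by rewrite /r cabsE sqr_sqrtr // addr_ge0 ?sqr_ge0.
  rewrite /a /b !expr_div_n -mulrDl => <-; rewrite divff // expf_neq0 //.
have a1 : -1 <= a <= 1.
  have b2 := sqr_ge0 b; apply/andP; split; nra.
have sb : sin (acos a) = `|b|.
  by rewrite sin_acos // -ab addrAC subrr add0r sqrtr_sqr.
have zE t : cos t = a -> sin t = b -> z = ofR r * expi t.
  by move=> ct st; apply: complex_ext; rewrite ?reM ?imM /= ct st /a /b mul0r ?subr0 ?addr0 mulrCA divff // mulr1.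
have [b0|b0] := leP 0 b.
  exists (acos a); last by apply: zE; [exact: acosK|rewrite sb ger0_norm].
  by have := acos_ge0 a1; have := acos_lepi a1; have := @pi_ge0 R; lra.
exists (- acos a); last by apply: zE; rewrite ?cosN ?acosK // sinN sb ltr0_norm // opprK.
by have := acos_ge0 a1; have := acos_lepi a1; have := @pi_ge0 R; lra.
Qed.

(** [e^(s + i t)], the chart in which circles and rays are coordinate lines. *)
Definition expw (s t : R) : C := ofR (expR s) * expi t.

Lemma cabs_expw s t : cabs (expw s t) = expR s.
Proof. by rewrite cabsM cabs_expi mulr1 cabs_ofR ger0_norm // expR_ge0. Qed.

Lemma expw_neq0 s t : expw s t != 0.
Proof. by rewrite -cabs_gt0 cabs_expw expR_gt0. Qed.

Lemma expw_2pi s t : expw s (t + pi *+ 2) = expw s t.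
Proof. by rewrite /expw expiD expi2pi mulr1. Qed.

Lemma polar_expw z : z != 0 -> exists t, z = expw (ln (cabs z)) t.
Proof.
move=> z0; have [t _ zE] := polar z; exists t.
by rewrite /expw lnK ?posrE ?cabs_gt0.
Qed.

Lemma cgt0P (e : C) : 0 < e -> exists2 x, 0 < x & e = ofR x.
Proof.
move=> e0; exists (complex.Re e); first by move: e0; rewrite ltcE => /andP[].
by apply/esym/RRe_real/gtr0_real.
Qed.

Lemma ofR_le x y : (ofR x <= ofR y :> C) = (x <= y). Proof. exact: lecR. Qed.
Lemma ofR_lt x y : (ofR x < ofR y :> C) = (x < y). Proof. exact: ltcR. Qed.

(** Complex differentiability with real epsilon and delta, to be handled by estimates of [cabs]; the
    two lemmas below show that it amounts to [is_derive z 1 f d]. *)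
Definition cdiff (f : C -> C) z d := forall e, 0 < e -> exists2 dl, 0 < dl &
  forall h, cabs h < dl -> cabs (f (z + h) - f z - d * h) <= e * cabs h.

Lemma is_derive_cdiff (f : C -> C) z d : is_derive z 1 f d -> cdiff f z d.
Proof.
move=> [df dE] e e0.
have e0' : 0 < ofR e :> C by rewrite -ofR0 ofR_lt.
move: df; rewrite /derivable => /cvgrPdist_le/(_ _ e0').
rewrite -[lim _]/('D_1 f z) dE.
rewrite /dnbhs; rewrite near_withinE => /nbhs_ballP[dl /= dl0 H].
have [dr dr0 E] := cgt0P dl0.
exists dr => // h hd.
have [->|h0] := eqVneq h 0; first by rewrite addr0 subrr mulr0 subrr cabs0 mulr0.
have := H h; rewrite /ball /= sub0r normrN cabs_normE E ofR_lt => /(_ hd h0).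
rewrite cabs_normE ofR_le => H1.
rewrite (_ : _ - d * h = - h * (d - h^-1 *: (f (h *: 1 + z) - f z))); last first.
  by rewrite /GRing.scale /= mulr1 (addrC h); field.
by rewrite cabsM cabsN mulrC; apply: ler_wpM2r => //; exact: cabs_ge0.
Qed.

Lemma cdiff_is_derive (f : C -> C) z d : cdiff f z d -> is_derive z 1 f d.
Proof.
move=> H.
have L : h^-1 *: ((f \o shift z) (h *: 1) - f z) @[h --> 0^'] --> d.
  apply/cvgrPdist_le => e e0; have [er er0 ->] := cgt0P e0.
  have [dl dl0 Hd] := H _ er0.
  rewrite /dnbhs near_withinE; apply/nbhs_ballP; exists (ofR dl).
    by rewrite /= -ofR0 ofR_lt.
  move=> h; rewrite /ball /= sub0r normrN cabs_normE ofR_lt => hd h0.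
  rewrite cabs_normE ofR_le.
  have hp : 0 < cabs h by rewrite cabs_gt0.
  rewrite -(ler_pM2r hp); apply: le_trans (Hd _ hd).
  rewrite -cabsM -cabsN le_eqVlt; apply/orP; left; apply/eqP; congr cabs.
  by rewrite /GRing.scale /= mulr1 (addrC h); field.
by apply: DeriveDef; [apply/cvg_ex; exists d|apply/cvg_lim].
Qed.

End Complex.

(** * Circle means in logarithmic coordinates *)

Section CircleMeans.
Context {R : realType}.
Local Notation C := (Cplx R).
Implicit Types (z w a d : C) (q f g : C -> C) (e s t r : R) (p : R * R).
Local Notation re := complex.Re.
Local Notation im := complex.Im.

Definition ccont q z := forall e, 0 < e -> exists2 dl, 0 < dl &
  forall w, cabs (w - z) < dl -> cabs (q w - q z) <= e.

Lemma cdiff_ccont q z d : cdiff q z d -> ccont q z.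
Proof.
move=> H e e0; have [dl dl0 Hd] := H 1 ltr01.
have k0 : 0 < 1 + cabs d by rewrite ltr_pwDl // cabs_ge0.
exists (Num.min dl (e / (1 + cabs d))); first by rewrite lt_min dl0 divr_gt0.
move=> w; rewrite lt_min => /andP[w1 w2].
have := Hd _ w1; rewrite (addrC z) subrK mul1r => H1.
have -> : q w - q z = (q w - q z - d * (w - z)) + d * (w - z) by rewrite subrK.
apply: le_trans (cabsD _ _) _; rewrite cabsM.
move: w2; rewrite ltr_pdivlMr //; nra.
Qed.

Lemma cabs_near_Re (T : Type) (F : set_system T) {FF : Filter F} (g : T -> C) (l : C) :
  (forall e, 0 < e -> \forall x \near F, cabs (g x - l) <= e) ->
  re (g x) @[x --> F] --> re l /\ im (g x) @[x --> F] --> im l.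
Proof.
move=> H; split; apply/cvgrPdist_le => e /H; apply: filterS => x; apply: le_trans.
  by rewrite -reN -reD -cabsN opprB addrC; exact: Re_le_cabs.
by rewrite -imN -imD -cabsN opprB addrC; exact: Im_le_cabs.
Qed.

Lemma cabs_near (T : Type) (F : set_system T) {FF : Filter F} (g : T -> C) (l : C) :
  re (g x) @[x --> F] --> re l -> im (g x) @[x --> F] --> im l ->
  forall e, 0 < e -> \forall x \near F, cabs (g x - l) <= e.
Proof.
move=> /cvgrPdist_le h1 /cvgrPdist_le h2 e e0.
have e20 : 0 < e / 2 by rewrite divr_gt0.
apply: filterS2 (h1 _ e20) (h2 _ e20) => x k1 k2.
apply: le_trans (cabs_le_ReIm _) _; rewrite reD imD reN imN distrC (distrC (im _)).
by rewrite [e]splitr lerD.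
Qed.

Lemma re_expw s t : re (expw s t) = expR s * cos t.
Proof. by rewrite reM /=; ring. Qed.
Lemma im_expw s t : im (expw s t) = expR s * sin t.
Proof. by rewrite imM /=; ring. Qed.

Lemma has_grad_re_expw p : has_grad (fun x : R * R => re (expw x.1 x.2)) p (re (expw p.1 p.2)) (- im (expw p.1 p.2)).
Proof.
have := has_gradM (has_grad_fst (is_derive_expR p.1)) (has_grad_snd (is_derive_cos p.2)).
rewrite re_expw im_expw mul0r mulr0 addr0 add0r mulrN.
by under eq_fun do rewrite -re_expw.
Qed.

Lemma has_grad_im_expw p : has_grad (fun x : R * R => im (expw x.1 x.2)) p (im (expw p.1 p.2)) (re (expw p.1 p.2)).
Proof.
have := has_gradM (has_grad_fst (is_derive_expR p.1)) (has_grad_snd (is_derive_sin p.2)).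
rewrite re_expw im_expw mul0r mulr0 addr0 add0r.
by under eq_fun do rewrite -im_expw.
Qed.

Lemma expw_near p e : 0 < e -> \forall x \near p, cabs (expw x.1 x.2 - expw p.1 p.2) <= e.
Proof.
apply: (@cabs_near _ (nbhs p)).
  exact: has_grad_cvg (has_grad_re_expw p).
exact: has_grad_cvg (has_grad_im_expw p).
Qed.

Lemma ccont_expw q p : ccont q (expw p.1 p.2) -> forall e, 0 < e ->
  \forall x \near p, cabs (q (expw x.1 x.2) - q (expw p.1 p.2)) <= e.
Proof.
move=> H e /H[dl dl0 Hd].
have d2 : 0 < dl / 2 by rewrite divr_gt0.
apply: filterS (expw_near p d2) => x hx; apply: Hd; apply: le_lt_trans hx _; lra.
Qed.

(** The Cauchy-Riemann equations in logarithmic coordinates: with [D = z q'(z)] the derivatives of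
    [q (e^(s + i t))] are [D] in [s] and [i D] in [t]. *)
Lemma has_grad_expw q p d (D := d * expw p.1 p.2) : cdiff q (expw p.1 p.2) d ->
  has_grad (fun x => re (q (expw x.1 x.2))) p (re D) (- im D) /\
  has_grad (fun x => im (q (expw x.1 x.2))) p (im D) (re D).
Proof.
move=> H; set z0 := expw p.1 p.2.
(* The difference quotient, completed by [d] at [z0], is continuous there; its products with the
   Caratheodory factors of [expw] are those of the composite. *)
pose g z := if z == z0 then d else (q z - q z0) / (z - z0).
have gE z : q z - q z0 = g z * (z - z0).
  by rewrite /g; case: eqVneq => [->|zz]; rewrite ?subrr ?mulr0 // divfK // subr_eq0.
have g0 : g z0 = d by rewrite /g eqxx.
have cg : ccont g z0.
  move=> e e0; have [dl dl0 Hd] := H e e0; exists dl => // w wd; rewrite g0 /g.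
  case: eqVneq => [_|ww]; first by rewrite subrr cabs0 ltW.
  have w0 : 0 < cabs (w - z0) by rewrite cabs_gt0 subr_eq0.
  rewrite -(ler_pM2r w0) -cabsM mulrBl divfK ?subr_eq0 //.
  by have := Hd _ wd; rewrite -/z0 [z0 + _]addrC subrK.
have [cr ci] := cabs_near_Re (ccont_expw cg).
move: cr ci; rewrite -/z0 g0 => cr ci.
have [f1 [f2 [c1 c2 E1]]] := has_grad_re_expw p.
have [f3 [f4 [c3 c4 E2]]] := has_grad_im_expw p.
rewrite -/z0 in c1 c2 c3 c4 E1 E2; split.
  exists (fun x => re (g (expw x.1 x.2)) * f1 x - im (g (expw x.1 x.2)) * f3 x),
         (fun x => re (g (expw x.1 x.2)) * f2 x - im (g (expw x.1 x.2)) * f4 x); split.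
  - by rewrite /D -/z0 reM; apply: cvgB; exact: cvgM.
  - rewrite /D -/z0 imM opprD -mulrN; apply: cvgB; exact: cvgM.
  move=> x; rewrite -reN -reD gE reM !reD !imD !reN !imN E1 E2; ring.
exists (fun x => re (g (expw x.1 x.2)) * f3 x + im (g (expw x.1 x.2)) * f1 x),
       (fun x => re (g (expw x.1 x.2)) * f4 x + im (g (expw x.1 x.2)) * f2 x); split.
- by rewrite /D -/z0 imM; apply: cvgD; exact: cvgM.
- by rewrite /D -/z0 reM -mulrN; apply: cvgD; exact: cvgM.
move=> x; rewrite -imN -imD gE imM !reD !imD !reN !imN E1 E2; ring.
Qed.

Definition ccontR (g : R -> C) := continuous (fun t => re (g t)) /\ continuous (fun t => im (g t)).

Definition CInt (g : R -> C) : C :=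
  (Int 0 (pi *+ 2) (fun t => re (g t)) +i* Int 0 (pi *+ 2) (fun t => im (g t)))%C.

Lemma CIntD (g h : R -> C) : ccontR g -> ccontR h -> CInt (fun t => g t + h t) = CInt g + CInt h.
Proof.
move=> [g1 g2] [h1 h2]; apply: complex_ext; rewrite ?reD ?imD /= -IntD //.
  by under eq_fun do rewrite reD.
by under eq_fun do rewrite imD.
Qed.

Lemma ccontRD (g h : R -> C) : ccontR g -> ccontR h -> ccontR (fun t => g t + h t).
Proof.
move=> [g1 g2] [h1 h2]; split=> x.
  by under eq_fun do rewrite reD; apply: cvgD; [exact: g1|exact: h1].
by under eq_fun do rewrite imD; apply: cvgD; [exact: g2|exact: h2].
Qed.

Lemma ccontRM (g h : R -> C) : ccontR g -> ccontR h -> ccontR (fun t => g t * h t).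
Proof.
move=> [g1 g2] [h1 h2]; split=> x.
  under eq_fun do rewrite reM.
  by apply: cvgB; apply: cvgM; [exact: g1|exact: h1|exact: g2|exact: h2].
under eq_fun do rewrite imM.
by apply: cvgD; apply: cvgM; [exact: g1|exact: h2|exact: g2|exact: h1].
Qed.

Lemma ccontR_cst (c : C) : ccontR (fun=> c).
Proof. by split; exact: cst_continuous. Qed.

Lemma CIntZ (c : C) (g : R -> C) : ccontR g -> CInt (fun t => c * g t) = c * CInt g.
Proof.
move=> [g1 g2].
have zc (k : R) (h : R -> R) : continuous h -> continuous (fun x => k * h x).
  by move=> ch x; apply: cvgM; [exact: cvg_cst|exact: ch].
apply: complex_ext; rewrite ?reM ?imM /CInt /=.
  rewrite -(IntZ _ _ _ g1) -(IntZ _ _ _ g2) -(IntB _ _ (zc _ _ g1) (zc _ _ g2)).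
  by under eq_fun do rewrite reM.
rewrite -(IntZ _ _ _ g1) -(IntZ _ _ _ g2) -(IntD _ _ (zc _ _ g2) (zc _ _ g1)).
by under eq_fun do rewrite imM.
Qed.

Lemma CInt_sum (I : Type) (r : seq I) (g : I -> R -> C) : (forall i, ccontR (g i)) ->
  CInt (fun t => \sum_(i <- r) g i t) = \sum_(i <- r) CInt (g i) /\
  ccontR (fun t => \sum_(i <- r) g i t).
Proof.
move=> cg; elim: r => [|i r [IH1 IH2]].
  under eq_fun do rewrite big_nil.
  by rewrite big_nil; split; [apply: complex_ext; rewrite /= Int_cst mul0r|exact: ccontR_cst].
under eq_fun do rewrite big_cons.
by rewrite big_cons -IH1 CIntD //; split => //; exact: ccontRD.
Qed.

(** The constant is [4 pi] instead of [2 pi] because the real and imaginary parts are bounded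
    separately. *)
Lemma CInt_le (g : R -> C) M : ccontR g -> (forall t, 0 <= t <= pi *+ 2 -> cabs (g t) <= M) ->
  cabs (CInt g) <= 4 * pi * M.
Proof.
move=> [g1 g2] gM; apply: le_trans (cabs_le_ReIm _) _ => /=.
have pi0 : 0 <= (pi : R) *+ 2 by rewrite mulrn_wge0 // pi_ge0.
have h1 : `|Int 0 (pi *+ 2) (fun t => re (g t))| <= M * (pi *+ 2 - 0).
  by apply: Int_norm_le => // x hx; apply: le_trans (Re_le_cabs _) (gM _ hx).
have h2 : `|Int 0 (pi *+ 2) (fun t => im (g t))| <= M * (pi *+ 2 - 0).
  by apply: Int_norm_le => // x hx; apply: le_trans (Im_le_cabs _) (gM _ hx).
by move: h1 h2; rewrite subr0 -mulr_natr; lra.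
Qed.

Lemma ccontR_expw q s : (forall z, ccont q z) -> ccontR (fun t => q (expw s t)).
Proof.
move=> cq; suff H t : forall e, 0 < e -> \forall x \near t, cabs (q (expw s x) - q (expw s t)) <= e.
  by split => t; have [] := cabs_near_Re (H t).
move=> e e0; have := ccont_expw (p := (s, t)) (cq _) e0.
move=> [[A B] /= [/nbhs_singleton sA tB] AB].
by apply: filterS tB => x Bx; have := AB (s, x); apply.
Qed.

Lemma ccont_expw1 q t : (forall z, ccont q z) ->
  continuous (fun s => re (q (expw s t))) /\ continuous (fun s => im (q (expw s t))).
Proof.
move=> cq; suff H s : forall e, 0 < e -> \forall x \near s, cabs (q (expw x t) - q (expw s t)) <= e.
  by split => s; have [] := cabs_near_Re (H s).
move=> e e0; have := ccont_expw (p := (s, t)) (cq _) e0.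
move=> [[A B] /= [sA /nbhs_singleton tB] AB].
by apply: filterS sA => x Bx; have := AB (x, t); apply.
Qed.

(** [im q ds + re q dt] and [- re q ds + im q dt], the real and imaginary parts of [q dz / (i z)],
    are closed by the Cauchy-Riemann equations. The sides [t = 0] and [t = 2 pi] cancel by
    periodicity and leave the difference of the two circle means. *)
Lemma mean_const q s1 s2 : s1 <= s2 -> (forall z, ccont q z) ->
  (forall z, expR s1 <= cabs z <= expR s2 -> exists d, cdiff q z d) ->
  CInt (fun t => q (expw s1 t)) = CInt (fun t => q (expw s2 t)).
Proof.
move=> s12 cq dq.
have pi0 : 0 <= (pi : R) *+ 2 by rewrite mulrn_wge0 // pi_ge0.
have e2pi s : q (expw s 0) = q (expw s (pi *+ 2)) by rewrite -[pi *+ 2]add0r expw_2pi.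
have [cr ci] := (fun s => (ccontR_expw s cq).1, fun s => (ccontR_expw s cq).2).
have dqp p : s1 <= p.1 <= s2 -> exists d, cdiff q (expw p.1 p.2) d.
  by move=> h; apply: dq; rewrite cabs_expw !ler_expR.
apply: complex_ext => /=.
  have cl : closed_on (fun x => im (q (expw x.1 x.2))) (fun x => re (q (expw x.1 x.2))) s1 s2 0 (pi *+ 2).
    move=> p h1 _; have [d hd] := dqp p h1; have [G1 G2] := has_grad_expw hd.
    by do 3!eexists; split; [exact: G2|exact: G1].
  have := goursat s12 pi0 cl (ccont_expw1 _ cq).2 (ccont_expw1 _ cq).2 (cr s1) (cr s2).
  rewrite /circulation /=.
  have -> : (fun x => im (q (expw x 0))) = (fun x => im (q (expw x (pi *+ 2)))).
    by apply/funext => x; rewrite e2pi.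
  by lra.
have cl : closed_on (fun x => - re (q (expw x.1 x.2))) (fun x => im (q (expw x.1 x.2))) s1 s2 0 (pi *+ 2).
  move=> p h1 _; have [d hd] := dqp p h1; have [G1 G2] := has_grad_expw hd.
  by do 3!eexists; split; [exact: has_gradN G1|rewrite opprK; exact: G2].
have cN t : continuous (fun s => - re (q (expw s t))).
  by move=> x; apply: cvgN; exact: (ccont_expw1 t cq).1.
have := goursat s12 pi0 cl (cN _) (cN _) (ci s1) (ci s2).
rewrite /circulation /=.
have -> : (fun x => - re (q (expw x 0))) = (fun x => - re (q (expw x (pi *+ 2)))).
  by apply/funext => x; rewrite e2pi.
by lra.
Qed.
End CircleMeans.

(** * The mean value property *)

Section MeanValue.
Context {R : realType}.
Local Notation C := (Cplx R).
Implicit Types (z w a d : C) (q f g : C -> C) (e s t r : R).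
Local Notation re := complex.Re.
Local Notation im := complex.Im.

Lemma twopi_gt0 : 0 < (pi : R) *+ 2.
Proof. by rewrite pmulrn_lgt0 // pi_gt0. Qed.

(** Compactness of [[0, 2 pi]] makes the continuity in [s] uniform in [t]. It carries the circle
    mean across a circle on which differentiability may fail at a point. *)
Lemma circle_uniform q s0 e : (forall z, ccont q z) -> 0 < e ->
  \forall s \near s0, forall t, 0 <= t <= pi *+ 2 -> cabs (q (expw s t) - q (expw s0 t)) <= e.
Proof.
move=> cq e0.
have e2 : 0 < e / 2 by rewrite divr_gt0.
have K := (compact_near_coveringP _).1 (@segment_compact R 0 (pi *+ 2)).
have H : forall t, `[0, pi *+ 2]%classic t ->
    \forall t' \near t & s \near s0, cabs (q (expw s t') - q (expw s0 t')) <= e.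
  move=> t _; have [[A B] /= [sA tB] AB] := ccont_expw (p := (s0, t)) (cq _) e2.
  exists (B, A) => //= -[t' s] /= [Bt As].
  have h1 := AB (s, t') (conj As Bt).
  have h2 := AB (s0, t') (conj (nbhs_singleton sA) Bt).
  have -> : q (expw s t') - q (expw s0 t') =
    (q (expw s t') - q (expw s0 t)) - (q (expw s0 t') - q (expw s0 t)) by ring.
  by apply: le_trans (cabsB _ _) _; rewrite [e]splitr lerD.
have := K R (nbhs s0) (fun s t => cabs (q (expw s t) - q (expw s0 t)) <= e) (nbhs_filter s0) H.
by apply: filterS => s Hs t ht; apply: Hs; rewrite /= in_itv.
Qed.

(** Compactness is used for the rectangle of polar coordinates instead of the disc. *)
Lemma bounded_on_disc f r : (forall z, ccont f z) ->
  exists M, forall z, cabs z <= r -> cabs (f z) <= M.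
Proof.
move=> cf.
have K := (compact_near_coveringP _).1 (compact_setX (@segment_compact R 0 r) (@segment_compact R (- pi) pi)).
have H : forall p : R * R, (`[0, r] `*` `[(- pi)%R, pi])%classic p ->
    \forall p' \near p & M \near +oo, cabs (f (ofR p'.1 * expi p'.2)) <= M.
  move=> p _; set z0 := ofR p.1 * expi p.2.
  have [dl dl0 Hd] := cf z0 1 ltr01.
  have d2 : 0 < dl / 2 by rewrite divr_gt0.
  have : \forall x \near p, cabs (ofR x.1 * expi x.2 - z0) <= dl / 2.
    apply: (@cabs_near R _ (nbhs p) _ (fun x : R * R => ofR x.1 * expi x.2)) d2.
      have := has_gradM (has_grad_fst (@is_derive_id R R^o p.1 1)) (has_grad_snd (is_derive_cos p.2)).
      move/has_grad_cvg; rewrite (_ : p.1 * cos p.2 = re z0); last by rewrite reM /=; ring.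
      by apply: cvg_trans; apply: near_eq_cvg; apply: nearW => x; rewrite reM /=; ring.
    have := has_gradM (has_grad_fst (@is_derive_id R R^o p.1 1)) (has_grad_snd (is_derive_sin p.2)).
    move/has_grad_cvg; rewrite (_ : p.1 * sin p.2 = im z0); last by rewrite imM /=; ring.
    by apply: cvg_trans; apply: near_eq_cvg; apply: nearW => x; rewrite imM /=; ring.
  move=> N; exists ([set x | cabs (ofR x.1 * expi x.2 - z0) <= dl / 2], [set M | cabs (f z0) + 1 <= M]).
    by split => //=; apply: nbhs_pinfty_ge; rewrite num_real.
  move=> [x M] /= [hx hM].
  have := Hd (ofR x.1 * expi x.2) ltac:(apply: le_lt_trans hx _; lra) => h.
  have := cabsD (f (ofR x.1 * expi x.2) - f z0) (f z0); rewrite subrK; lra.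
have := K R +oo%R (fun M p => cabs (f (ofR p.1 * expi p.2)) <= M) (@filter_filter R _ proper_pinfty_nbhs) H.
move=> /filter_ex[M HM]; exists M => z zr.
have [t ht zE] := polar z; rewrite zE.
by apply: (HM (cabs z, t)); split; rewrite /= in_itv /= ?cabs_ge0.
Qed.

Lemma CInt_cst c : CInt (fun=> c) = @ofR R (pi *+ 2) * c.
Proof. by apply: complex_ext; rewrite ?reM ?imM /= Int_cst subr0; ring. Qed.

Lemma CInt_dist (g h : R -> C) M : ccontR g -> ccontR h ->
  (forall t, 0 <= t <= pi *+ 2 -> cabs (g t - h t) <= M) ->
  cabs (CInt g - CInt h) <= 4 * pi * M.
Proof.
move=> cg ch H.
have ch' : ccontR (fun t => - 1 * h t) by apply: ccontRM => //; exact: ccontR_cst.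
rewrite -mulN1r -CIntZ // -CIntD //; apply: CInt_le; first exact: ccontRD.
by move=> t /H; rewrite mulN1r.
Qed.

(** The mean is constant in [s] on either side of [log |a|], continuous across it by
    [circle_uniform], and tends to the value at 0. The exceptional point [a] is there for difference
    quotients at [a], of which only continuity at [a] is known beforehand. *)
Theorem mean_value q a s : (forall z, ccont q z) ->
  (forall z, z != 0 -> z != a -> exists d, cdiff q z d) -> cabs a < expR s ->
  CInt (fun t => q (expw s t)) = @ofR R (pi *+ 2) * q 0.
Proof.
move=> cq dq as_; apply/eqP; rewrite -subr_eq0 -cabs_eq0; apply/eqP/le_anti.
rewrite cabs_ge0 andbT; apply/ler_addgt0Pr => e0 e0_gt0; rewrite add0r.
have pi0 := @pi_gt0 R.
(* Each of the three comparisons, near 0 and on the two sides of the circle through [a], costs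
   [4 pi e]. *)
pose e := e0 / (12 * pi); have e_gt0 : 0 < e by rewrite divr_gt0 // mulr_gt0.
have key (p x : R) : 0 < p -> x = 4 * p * (x / (12 * p)) + (4 * p * (x / (12 * p)) + 4 * p * (x / (12 * p))).
  by move=> p0; field; exact: lt0r_neq0.
have -> : e0 = 4 * pi * e + (4 * pi * e + 4 * pi * e) by exact: key.
pose J s := CInt (fun t => q (expw s t)).
have [dl dl0 Hd] := cq 0 e e_gt0.
have J0 s1 : expR s1 < dl -> cabs (J s1 - @ofR R (pi *+ 2) * q 0) <= 4 * pi * e.
  move=> h; rewrite -CInt_cst; apply: CInt_dist.
  - exact: ccontR_expw.
  - exact: ccontR_cst.
  by move=> t _; apply: Hd; rewrite subr0 cabs_expw.
have dl2 : 0 < dl / 2 by rewrite divr_gt0.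
have es : expR (ln (dl / 2)) < dl by rewrite lnK ?posrE //; lra.
have [a0|a0] := eqVneq a 0.
  pose s1 := Num.min s (ln (dl / 2)).
  have s1s : s1 <= s by rewrite ge_min lexx.
  have -> : CInt (fun t => q (expw s t)) = J s1.
    apply/esym/mean_const => // z /andP[z1 _].
    have z0 : z != 0 by rewrite -cabs_gt0; apply: lt_le_trans z1; exact: expR_gt0.
    by apply: dq => //; rewrite a0.
  apply: le_trans (J0 _ _) _; last by rewrite lerDl addr_ge0 // mulr_ge0 // ?ltW // mulr_gt0.
  by apply: le_lt_trans es; rewrite ler_expR ge_min lexx orbT.
have pa : 0 < cabs a by rewrite cabs_gt0.
pose sa := ln (cabs a).
have esa : expR sa = cabs a by rewrite lnK.
have [dr /= dr0 Hr] := (@nbhs_ballP R R^o sa _).1 (circle_uniform sa cq e_gt0).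
pose s1 := Num.min (sa - dr / 2) (ln (dl / 2)).
pose s2 := sa - dr / 2; pose s3 := Num.min s (sa + dr / 2).
have sas : sa < s by rewrite -ltr_expR esa.
have Jn s' : `|sa - s'| < dr -> cabs (J s' - J sa) <= 4 * pi * e.
  move=> h; apply: CInt_dist; [exact: ccontR_expw|exact: ccontR_expw|].
  exact: Hr.
have -> : CInt (fun t => q (expw s t)) = J s3.
  apply/esym/mean_const; rewrite /s3 ?ge_min ?lexx // => z /andP[z1 _].
  have za : cabs a < cabs z.
    by apply: lt_le_trans z1; rewrite -esa ltr_expR lt_min sas /=; lra.
  have z0 : z != 0 by rewrite -cabs_gt0; apply: le_lt_trans za; exact: cabs_ge0.
  by apply: dq => //; apply: contraTneq za => ->; rewrite ltxx.
have E2 : J s1 = J s2.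
  apply: mean_const; rewrite /s1 /s2 ?ge_min ?lexx // => z /andP[z1 z2].
  have z0 : z != 0 by rewrite -cabs_gt0; apply: lt_le_trans z1; exact: expR_gt0.
  apply: dq => //; apply: contraTneq z2 => ->.
  by rewrite -ltNge -esa ltr_expR; lra.
have -> : J s3 - @ofR R (pi *+ 2) * q 0 =
   (J s3 - J sa) + (- (J s2 - J sa) + (J s1 - @ofR R (pi *+ 2) * q 0)) by rewrite E2; ring.
apply: le_trans (cabsD _ _) _; apply: lerD.
  apply: Jn; rewrite /s3; case: (leP s (sa + dr / 2)) => h.
    by rewrite ltr_norml; lra.
  by rewrite ltr_norml; lra.
apply: le_trans (cabsD _ _) _; rewrite cabsN; apply: lerD.
  by apply: Jn; rewrite /s2 ltr_norml; lra.
by apply: J0; apply: le_lt_trans es; rewrite ler_expR /s1 ge_min lexx orbT.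
Qed.
End MeanValue.

Lemma derivable_quotient (K : numFieldType) (f : K -> K) (a z : K) : derivable f z 1 -> z != a ->
  derivable (fun w : K => w * ((f w - f a) * (w - a)^-1)) z 1.
Proof.
move=> df za.
apply: (@derivableM K K id); first exact: derivable_id.
apply: (@derivableM K K (f - cst (f a))); first exact: (@derivableB K K K f (cst (f a))).
apply: (@derivableV K K (id - cst a)); first by rewrite /= subr_eq0.
exact: (@derivableB K K K id (cst a)).
Qed.

(** * Taylor expansion with remainder *)

Section Taylor.
Context {R : realType}.
Local Notation C := (Cplx R).
Implicit Types (z w a d : C) (q f g : C -> C) (e s t r : R).
Local Notation re := complex.Re.
Local Notation im := complex.Im.

Lemma cdiff_local f g z d r : 0 < r -> (forall w, cabs (w - z) < r -> f w = g w) ->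
  cdiff g z d -> cdiff f z d.
Proof.
move=> r0 fg H e e0; have [dl dl0 Hd] := H e e0.
exists (Num.min dl r); first by rewrite lt_min dl0.
move=> h; rewrite lt_min => /andP[h1 h2].
rewrite !fg; [exact: Hd| |by rewrite addrAC subrr add0r].
by rewrite subrr cabs0.
Qed.

Lemma ccontM f g z : ccont f z -> ccont g z -> ccont (fun w => f w * g w) z.
Proof.
move=> cf cg e e0.
have k0 : 0 < cabs (f z) + cabs (g z) + 1 by rewrite ltr_wpDl // addr_ge0 // cabs_ge0.
pose e1 := Num.min 1 (e / (cabs (f z) + cabs (g z) + 1)).
have e10 : 0 < e1 by rewrite lt_min ltr01 divr_gt0.
have [d1 d10 H1] := cf _ e10; have [d2 d20 H2] := cg _ e10.
exists (Num.min d1 d2); first by rewrite lt_min d10.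
move=> w; rewrite lt_min => /andP[/H1 h1 /H2 h2].
have -> : f w * g w - f z * g z = (f w - f z) * (g w - g z) + ((f w - f z) * g z + f z * (g w - g z)) by ring.
have e11 : e1 <= 1 by rewrite ge_min lexx.
have e12 : e1 * (cabs (f z) + cabs (g z) + 1) <= e by rewrite -ler_pdivlMr // ge_min lexx orbT.
apply: le_trans (cabsD _ _) _; apply: le_trans (lerD (lexx _) (cabsD _ _)) _.
rewrite !cabsM; have := cabs_ge0 (f z); have := cabs_ge0 (g z).
have := cabs_ge0 (f w - f z); have := cabs_ge0 (g w - g z); nra.
Qed.

Lemma cdiff_uniq f z d d' : cdiff f z d -> cdiff f z d' -> d = d'.
Proof.
move=> /cdiff_is_derive h1 /cdiff_is_derive h2.
by rewrite -(@derive_val _ _ _ _ _ _ _ h1) (@derive_val _ _ _ _ _ _ _ h2).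
Qed.

(** Cauchy's integral for the [n]-th Taylor coefficient over the circle of radius [e^s], written in
    the angle: [dz / z] becomes [i dt]. *)
Definition coef f s (n : nat) : C :=
  (ofR (pi *+ 2))^-1 * CInt (fun t => f (expw s t) * (expw s t)^-1 ^+ n).

Lemma expwV s t : (expw s t)^-1 = expw (- s) (- t).
Proof.
rewrite /expw invfM expiN expRN; congr (_ * _).
by rewrite /ofR (fmorphV (real_complex R)).
Qed.

Lemma ccontR_expwVX s n : ccontR (fun t => (expw s t)^-1 ^+ n).
Proof.
elim: n => [|n IH]; first by under eq_fun do rewrite expr0; exact: ccontR_cst.
under eq_fun do rewrite exprS.
apply: ccontRM => //; split => x.
  under eq_fun do rewrite expwV re_expw cosN.
  by apply: cvgM; [exact: cvg_cst|exact: continuous_cos].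
under eq_fun do rewrite expwV im_expw sinN.
by apply: cvgM; [exact: cvg_cst|apply: cvgN; exact: continuous_sin].
Qed.

Lemma is_derive_mull (k x : R) : is_derive x 1 (fun t => k * t) k.
Proof. by rewrite -[X in is_derive _ _ _ X]mulr1; exact: is_deriveZ. Qed.

Lemma expwVXE s t n : (expw s t)^-1 ^+ n = expw (- (n%:R * s)) (- (n%:R * t)).
Proof.
rewrite expwV /expw exprMn expiX mulrN; congr (_ * _).
by rewrite /ofR -(rmorphXn (real_complex R)) -expRM_natl mulrN.
Qed.

Lemma CInt_expwVX s n : CInt (fun t => (expw s t)^-1 ^+ n) = if n == 0 then ofR (pi *+ 2) else 0.
Proof.
case: n => [|n] /=.
  under eq_fun do rewrite expr0.
  by rewrite CInt_cst mulr1.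
have n0 : (n.+1%:R : R) != 0 by rewrite pnatr_eq0.
have e2 : expi (n.+1%:R * (pi *+ 2)) = 1 :> C.
  by have := expi_periodic (0 : R) n.+1; rewrite add0r mulrC expi0.
have sn : sin (n.+1%:R * (pi *+ 2)) = 0 :> R by have := congr1 (@im R) e2.
have cn : cos (n.+1%:R * (pi *+ 2)) = 1 :> R by have := congr1 (@re R) e2.
have dl x := is_derive_mull n.+1%:R x.
pose K := expR (- (n.+1%:R * s)) / n.+1%:R.
have dre t : is_derive t 1 (fun t => K * sin (n.+1%:R * t)) (re ((expw s t)^-1 ^+ n.+1)).
  rewrite expwVXE re_expw cosN.
  have := @is_deriveZ R R^o R^o _ K t 1 _ (is_derive1_comp (is_derive_sin (n.+1%:R * t)) (dl t)).
  rewrite /GRing.scale /= (_ : K * _ = expR (- (n.+1%:R * s)) * cos (n.+1%:R * t)) //.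
  by rewrite /K; field.
have dim t : is_derive t 1 (fun t => K * cos (n.+1%:R * t)) (im ((expw s t)^-1 ^+ n.+1)).
  rewrite expwVXE im_expw sinN.
  have := @is_deriveZ R R^o R^o _ K t 1 _ (is_derive1_comp (is_derive_cos (n.+1%:R * t)) (dl t)).
  rewrite /GRing.scale /= (_ : K * _ = expR (- (n.+1%:R * s)) * - sin (n.+1%:R * t)) //.
  by rewrite /K; field.
rewrite /CInt (IntE _ _ dre) (IntE _ _ dim) sn cn !mulr0 sin0 cos0.
by apply: complex_ext => /=; ring.
Qed.

Lemma coef_le f s n M : (forall z, ccont f z) -> (forall z, cabs z <= expR s -> cabs (f z) <= M) ->
  cabs (coef f s n) <= 2 * M / expR s ^+ n.
Proof.
move=> cf fM; rewrite /coef cabsM cabsV cabs_ofR gtr0_norm ?twopi_gt0 //.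
rewrite ler_pdivrMl ?twopi_gt0 //.
have -> : pi *+ 2 * (2 * M / expR s ^+ n) = 4 * pi * (M / expR s ^+ n) by rewrite -mulr_natr; ring.
apply: CInt_le; first by apply: ccontRM; [exact: ccontR_expw|exact: ccontR_expwVX].
move=> t _; rewrite cabsM cabsX cabsV cabs_expw exprVn.
by apply: ler_wpM2r; [rewrite invr_ge0 exprn_ge0 // expR_ge0|apply: fM; rewrite cabs_expw].
Qed.

(** Apply the mean value property to [q z = z (f z - f a) / (z - a)], which vanishes at 0, and
    expand [z / (z - a)] in powers of [a / z] up to order [N]. On the circle [|f z - f a| <= 2 M]
    and [|z / (z - a)| <= 2]; the factor [4 pi] of [CInt_dist] divided by [2 pi] makes the constant
    8. *)
Theorem taylor f s N M : (forall z, exists d, cdiff f z d) -> (0 < N)%N ->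
  (forall z, cabs z <= expR s -> cabs (f z) <= M) ->
  forall a, cabs a <= expR s / 2 ->
  cabs (f a - \sum_(n < N) coef f s n * a ^+ n) <= 8 * M * (cabs a / expR s) ^+ N.
Proof.
move=> df N0 fM a ar; set r := expR s.
have r0 : 0 < r := expR_gt0 s.
have ar' : cabs a < r by apply: le_lt_trans ar _; rewrite -/r; lra.
have cf z : ccont f z by have [d /cdiff_ccont] := df z.
have [da hda] := df a.
pose G z := if z == a then da else (f z - f a) / (z - a).
pose q z := z * G z.
have dG z : z != a -> exists d, cdiff q z d.
  move=> za; have [d hd] := df z; have hd' := cdiff_is_derive hd.
  have h1 := @derivable_quotient C f a z (@ex_derive _ _ _ _ _ _ _ hd') za.
  exists ('D_1 (fun w : C => w * ((f w - f a) * (w - a)^-1)) z).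
  apply: (@cdiff_local _ (fun w : C => w * ((f w - f a) * (w - a)^-1)) _ _ (cabs (z - a))).
  - by rewrite cabs_gt0 subr_eq0.
  - move=> w wz; rewrite /q /G; case: eqVneq => // wa.
    by move: wz; rewrite wa cabsC ltxx.
  - exact/is_derive_cdiff/derivableP.
have cG : ccont G a.
  move=> e e0; have [dl dl0 Hd] := hda e e0; exists dl => // w wd; rewrite /G eqxx.
  case: eqVneq => [_|wa]; first by rewrite subrr cabs0 ltW.
  have w0 : 0 < cabs (w - a) by rewrite cabs_gt0 subr_eq0.
  rewrite -(ler_pM2r w0) -cabsM mulrBl divfK ?subr_eq0 //.
  by have := Hd _ wd; rewrite [a + _]addrC subrK.
have cq z : ccont q z.
  have [->|za] := eqVneq z a; last by have [d /cdiff_ccont] := dG z za.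
  by apply: ccontM => //; move=> e e0; exists e => // w /ltW.
have mv : CInt (fun t => q (expw s t)) = 0.
  rewrite (@mean_value _ q a) //; first by rewrite /q mul0r mulr0.
  by move=> z _; exact: dG.
pose E n t := (expw s t)^-1 ^+ n.
have cE n : ccontR (E n) := ccontR_expwVX s n.
have cfe : ccontR (fun t => f (expw s t)) := ccontR_expw s cf.
have cfE n : ccontR (fun t => f (expw s t) * E n t) by exact: ccontRM.
have cterm n : ccontR (fun t => a ^+ n * (f (expw s t) * E n t) + - f a * a ^+ n * E n t).
  by apply: ccontRD; apply: ccontRM => //; exact: ccontR_cst.
pose S t := \sum_(n < N) (a ^+ n * (f (expw s t) * E n t) + - f a * a ^+ n * E n t).
have [CS cS] := CInt_sum (index_enum 'I_N) (fun n : 'I_N => cterm n).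
(* Of the terms with [f a] only [n = 0] survives integration, by [CInt_expwVX]; this is where
   [0 < N] is used. *)
have SE : CInt S = ofR (pi *+ 2) * (\sum_(n < N) coef f s n * a ^+ n - f a).
  rewrite /S CS; under eq_bigr => n _.
    rewrite CIntD; [|by apply: ccontRM => //; exact: ccontR_cst|by apply: ccontRM => //; exact: ccontR_cst].
    rewrite CIntZ // CIntZ // CInt_expwVX; over.
  rewrite big_split /= mulrBr; congr (_ + _).
    rewrite mulr_sumr; apply: eq_bigr => n _; rewrite /coef -mulrA mulrCA mulrA.
    rewrite mulVf ?mul1r; first by rewrite mulrC.
    by rewrite ofR_eq0 gt_eqF // twopi_gt0.
  case: N N0 {S CS cS} => // N _.
  rewrite big_ord_recl /= expr0 mulr1 big1 ?addr0; last by move=> i _; rewrite mulr0.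
  by rewrite mulNr mulrC.
have key : cabs (CInt (fun t => q (expw s t)) - CInt S) <= 4 * pi * (4 * M * (cabs a / r) ^+ N).
  apply: CInt_dist => //; first exact: ccontR_expw.
  move=> t _; set z := expw s t.
  have zr : cabs z = r by rewrite cabs_expw.
  have za : z != a by apply: contraTneq ar' => <-; rewrite zr ltxx.
  have z0 : z != 0 by exact: expw_neq0.
  have za0 : z - a != 0 by rewrite subr_eq0.
  have -> : S t = (f z - f a) * \sum_(n < N) (a / z) ^+ n.
    rewrite /S mulr_sumr; apply: eq_bigr => n _; rewrite /E -/z exprMn; ring.
  have -> : q z = (f z - f a) * (z / (z - a)).
    by rewrite /q /G (negbTE za); field.
  have -> : z / (z - a) = \sum_(n < N) (a / z) ^+ n + (a / z) ^+ N * (z / (z - a)).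
    have E1 := subrX1 (a / z) N.
    have -> : \sum_(n < N) (a / z) ^+ n = (1 - (a / z) ^+ N) * (z / (z - a)).
      rewrite -[1 - _]opprB E1 -mulNr opprB mulrAC (_ : (1 - a / z) * (z / (z - a)) = 1) ?mul1r //.
      by field; rewrite za0.
    by ring.
  rewrite mulrDr addrAC subrr add0r (cabsM (f z - f a)) (cabsM (_ ^+ _)) cabsX.
  rewrite (cabsM a) (cabsM z) !cabsV zr.
  have h1 : cabs (f z - f a) <= 2 * M.
    have h1 := cabsB (f z) (f a).
    have h2 := fM z ltac:(by rewrite zr).
    have h3 := fM a (ltW ar').
    move: h1 h2 h3; lra.
  have h2 : r / cabs (z - a) <= 2.
    have zap : 0 < cabs (z - a) by rewrite cabs_gt0.
    rewrite ler_pdivrMr //.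
    have h := cabs_lbD z (- a); rewrite cabsN zr in h.
    by move: h ar; rewrite -/r; lra.
  have -> : 4 * M * (cabs a / r) ^+ N = 2 * M * ((cabs a / r) ^+ N * 2) by ring.
  apply: ler_pM; rewrite ?cabs_ge0 //.
    apply: mulr_ge0; last by apply: divr_ge0; [exact: expR_ge0|exact: cabs_ge0].
    by apply: exprn_ge0; apply: divr_ge0; [exact: cabs_ge0|exact: expR_ge0].
  apply: ler_wpM2l => //.
  by apply: exprn_ge0; apply: divr_ge0; [exact: cabs_ge0|exact: expR_ge0].
move: key; rewrite mv SE sub0r -mulrN opprB cabsM cabs_ofR gtr0_norm ?twopi_gt0 //.
have -> : 4 * pi * (4 * M * (cabs a / r) ^+ N) = (pi *+ 2) * (8 * M * (cabs a / r) ^+ N).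
  by rewrite -mulr_natr; ring.
by rewrite ler_pM2l ?twopi_gt0.
Qed.
End Taylor.

Lemma derivable_divl (K : numFieldType) (f : K -> K) (a z : K) : derivable f z 1 -> z != a ->
  derivable (fun w : K => f w * (w - a)^-1) z 1.
Proof.
move=> df za; apply: (@derivableM K K f) => //.
apply: (@derivableV K K (id - cst a)); first by rewrite /= subr_eq0.
exact: (@derivableB K K K id (cst a)).
Qed.

Lemma is_derive_leibniz (K : numFieldType) (g h : K -> K) (a c z dg dh : K) :
  is_derive z 1 g dg -> is_derive z 1 h dh ->
  is_derive z 1 (fun w : K => (w - a) * g w + c * h w) (g z + (z - a) * dg + c * dh).
Proof.
move=> Hg Hh.
have H1 : is_derive z 1 ((id : K -> K) - cst a) (1 - 0) by exact: is_deriveB.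
have H2 := @is_deriveM K K _ _ z 1 _ _ H1 Hg.
have H3 := @is_deriveM K K (cst c) h z 1 _ _ (is_derive_cst c z 1) Hh.
have H4 := @is_deriveD K K K _ _ z 1 _ _ H2 H3.
apply: is_derive_eq H4 _.
have -> : ((id : K -> K) - cst a) z = z - a by [].
by rewrite /GRing.scale /=; ring.
Qed.

(** * Quotients, derivatives, zeros and approximation of entire functions *)

Section Entire.
Context {R : realType}.
Local Notation C := (Cplx R).
Implicit Types (z w a d h : C) (q f g : C -> C) (e s t r : R).

Definition holo f := forall z, exists d, cdiff f z d.

Lemma entire_holo f : entire f -> holo f.
Proof. by move=> df z; exists ('D_1 f z); apply/is_derive_cdiff/derivableP/df. Qed.

Lemma holo_ccont f : holo f -> forall z, ccont f z.
Proof. by move=> hf z; have [d /cdiff_ccont] := hf z. Qed.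

Lemma cdiff_shift f a z d : cdiff f (a + z) d -> cdiff (fun h => f (a + h)) z d.
Proof. by move=> H e /H[dl dl0 Hd]; exists dl => // h /Hd; rewrite addrA. Qed.

Lemma holo_shift f a : holo f -> holo (fun h => f (a + h)).
Proof. by move=> hf z; have [d] := hf (a + z); exists d; exact: cdiff_shift. Qed.

Lemma derive1_cdiff f z d : cdiff f z d -> derive1 f z = d.
Proof. by move=> /cdiff_is_derive H; rewrite derive1E; exact: (@derive_val _ _ _ _ _ _ _ H). Qed.

Lemma holo_cdiff f z : holo f -> cdiff f z (derive1 f z).
Proof. by move=> /(_ z)[d hd]; rewrite (derive1_cdiff hd). Qed.

Lemma taylor_at f a N : holo f -> (0 < N)%N -> exists (c : nat -> C) (K : R), 0 <= K /\
  forall h, cabs h <= 1 / 2 -> cabs (f (a + h) - \sum_(n < N) c n * h ^+ n) <= K * cabs h ^+ N.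
Proof.
move=> hf N0; have hF := holo_shift a hf.
have [M HM] := bounded_on_disc (expR 0) (holo_ccont hF).
exists (coef (fun h => f (a + h)) 0), (8 * M); split.
  rewrite mulr_ge0 //; have := HM 0; rewrite cabs0 expR0 => /(_ ler01).
  by apply: le_trans; exact: cabs_ge0.
move=> h h2; have := @taylor R _ 0 N M hF N0 HM h.
by rewrite expR0 divr1; apply.
Qed.

(** The Taylor remainder of order 2 shows that [coef F s 1] is a derivative at 0, hence equals [d];
    then [coef_le] applies. *)
Lemma cauchy_estimate f z d s M : holo f -> (forall k, cabs k <= expR s -> cabs (f (z + k)) <= M) ->
  cdiff f z d -> cabs d <= 2 * M / expR s.
Proof.
move=> hf HM hd; have hF := holo_shift z hf.
set F := fun h => f (z + h) in hF.
have M0 : 0 <= M.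
  by apply: le_trans (HM 0 _); rewrite ?cabs_ge0 // cabs0 expR_ge0.
have T := @taylor R F s 2 M hF isT HM.
have e0 : 0 < expR s := expR_gt0 s.
have c0 : F 0 = coef F s 0.
  have := T 0; rewrite cabs0 mul0r expr0n mulr0 /= => /(_ _); rewrite divr_ge0 ?expR_ge0 // => /(_ isT).
  rewrite !big_ord_recl big_ord0 /= expr0 mulr1 expr1 mulr0 !addr0 => h.
  apply/eqP; rewrite -subr_eq0 -cabs_eq0; apply/eqP/le_anti.
  by rewrite cabs_ge0 andbT.
have hb : cdiff F 0 (coef F s 1).
  move=> e e_0; exists (Num.min (expR s / 2) (e * expR s ^+ 2 / (8 * M + 1))).
    by rewrite lt_min !divr_gt0 ?mulr_gt0 ?exprn_gt0 // ltr_wpDl ?mulr_ge0.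
  move=> h; rewrite lt_min add0r => /andP[h1 h2].
  have := T h (ltW h1); rewrite !big_ord_recl big_ord0 /= expr0 mulr1 expr1 addr0 -c0 opprD addrA.
  move=> /le_trans; apply; rewrite expr_div_n mulrA ler_pdivrMr ?exprn_gt0 //.
  move: h2; rewrite ltr_pdivlMr; last by rewrite ltr_wpDl ?mulr_ge0.
  have := cabs_ge0 h; set x := cabs h; set y := expR s ^+ 2 => x0 hx.
  have -> : 8 * M * x ^+ 2 = x * (x * (8 * M)) by ring.
  have -> : e * x * y = x * (e * y) by ring.
  apply: ler_wpM2l => //; nra.
have -> : d = coef F s 1.
  by apply: cdiff_uniq hb; apply: cdiff_shift; rewrite addr0.
by have := coef_le 1 (holo_ccont hF) HM; rewrite expr1.
Qed.

(** The singularity of the quotient at [a] is removable: by the expansion of order 3, [g] has the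
    value [c 1] and the derivative [c 2] there. *)
Lemma holo_quotient f a : holo f -> f a = 0 -> exists2 g, holo g & forall z, f z = (z - a) * g z.
Proof.
move=> hf fa0; have [c [K [K0 T]]] := taylor_at a hf (isT : (0 < 3)%N).
have h0 : cabs (0 : C) <= 1 / 2 by rewrite cabs0; lra.
have c0 : c 0%N = 0.
  have := T 0 h0; rewrite cabs0 !big_ord_recl big_ord0 !expr0n /= !mulr0 !addr0 fa0 ?mulr1n mulr1 sub0r cabsN => h.
  by apply/cabs0_eq0/le_anti; rewrite cabs_ge0 andbT.
pose g z := if z == a then c 1%N else f z * (z - a)^-1.
exists g; last first.
  move=> z; rewrite /g; case: eqVneq => [->|za]; first by rewrite fa0 subrr mul0r.
  by rewrite mulrCA divff ?mulr1 // subr_eq0.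
move=> z; have [->|za] := eqVneq z a; last first.
  have [d /cdiff_is_derive hd] := hf z.
  have h1 := @derivable_divl C f a z (@ex_derive _ _ _ _ _ _ _ hd) za.
  exists ('D_1 (fun w : C => f w * (w - a)^-1) z).
  apply: (@cdiff_local _ _ (fun w : C => f w * (w - a)^-1) _ _ (cabs (z - a))).
  - by rewrite cabs_gt0 subr_eq0.
  - move=> w wz; rewrite /g; case: eqVneq => // wa.
    by move: wz; rewrite wa cabsC ltxx.
  - exact/is_derive_cdiff/derivableP.
exists (c 2%N) => e e0; exists (Num.min (1 / 2) (e / (K + 1))).
  by rewrite lt_min !divr_gt0 // ltr_wpDl.
move=> h; rewrite lt_min => /andP[h1 h2]; rewrite /g eqxx.
have [->|hn0] := eqVneq h 0; first by rewrite addr0 eqxx subrr mulr0 subrr cabs0 mulr0.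
have hp : 0 < cabs h by rewrite cabs_gt0.
have -> : (a + h == a) = false by rewrite -subr_eq0 addrAC subrr add0r (negbTE hn0).
have := T h (ltW h1); rewrite !big_ord_recl big_ord0 /= c0 mul0r add0r addr0 expr1 => H.
rewrite -(ler_pM2r hp) -cabsM.
have ah : a + h - a = h by ring.
rewrite ah (_ : _ * h = f (a + h) - (c 1%N * h + c 2%N * h ^+ 2)); last by field.
apply: le_trans H _; move: h2; rewrite ltr_pdivlMr; last by rewrite ltr_wpDl.
set x := cabs h => hx; have -> : K * x ^+ 3 = (x * K) * x * x by ring.
by apply: ler_wpM2r; [exact: ltW|apply: ler_wpM2r; [exact: ltW|]]; nra.
Qed.

(** Without its quadratic Taylor polynomial [f] leaves [Q = O(|h|^3)]. Cauchy's estimate on the disc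
    of radius [|h|] about [h] gives [Q' h = O(|h|^2)], so that [f'] has the derivative [2 c 2] at
    [a]. *)
Lemma holo_derive1 f : holo f -> holo (derive1 f).
Proof.
move=> hf a; have [c [K [K0 T]]] := taylor_at a hf (isT : (0 < 3)%N).
have T3 h : cabs h <= 1 / 2 -> cabs (f (a + h) - (c 0%N + c 1%N * h + c 2%N * h ^+ 2)) <= K * cabs h ^+ 3.
  move=> /T; rewrite !big_ord_recl big_ord0 /= expr0 expr1 mulr1 addr0.
  by rewrite addrA.
pose Q h := f (a + h) - (c 0%N + c 1%N * h + c 2%N * h ^+ 2).
have dQ h : cdiff Q h (derive1 f (a + h) - (c 1%N + 2 * c 2%N * h)).
  move=> e e0; have e20 : 0 < e / 2 by rewrite divr_gt0.
  have [dl dl0 Hd] := holo_cdiff (a + h) hf e20.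
  have k0 : 0 < cabs (c 2%N) + 1 by rewrite ltr_wpDl // cabs_ge0.
  exists (Num.min dl (e / 2 / (cabs (c 2%N) + 1))); first by rewrite lt_min dl0 divr_gt0.
  move=> k; rewrite lt_min => /andP[/Hd k1 k2].
  rewrite (_ : _ - _ = (f (a + h + k) - f (a + h) - derive1 f (a + h) * k) - c 2%N * k ^+ 2); last first.
    by rewrite /Q addrA; ring.
  apply: le_trans (cabsB _ _) _; rewrite cabsM cabsX.
  move: k2; rewrite ltr_pdivlMr //; have := cabs_ge0 k; have := cabs_ge0 (c 2%N).
  set y := cabs (c 2%N); set x := cabs k => y0 x0 xy.
  have : y * x ^+ 2 <= e / 2 * x by rewrite expr2 mulrA; apply: ler_wpM2r => //; nra.
  by rewrite -/x in k1; lra.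
have hQ : holo Q by move=> h; eexists; exact: dQ.
have Q0 : derive1 f a = c 1%N.
  have cd : cdiff Q 0 0.
    move=> e e0; exists (Num.min (1 / 2) (e / (K + 1))).
      by rewrite lt_min !divr_gt0 // ltr_wpDl.
    move=> h; rewrite lt_min add0r mul0r subr0 => /andP[h1 h2].
    have Q00 : Q 0 = 0.
      have h0 : cabs (0 : C) <= 1 / 2 by rewrite cabs0; lra.
      have := T3 0 h0; rewrite -/(Q 0) cabs0 expr0n /= mulr0 => h0'.
      by apply/cabs0_eq0/le_anti; rewrite cabs_ge0 andbT.
    rewrite Q00 subr0; apply: le_trans (T3 _ (ltW h1)) _.
    move: h2; rewrite ltr_pdivlMr; last by rewrite ltr_wpDl.
    have := cabs_ge0 h; set x := cabs h => x0 hx.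
    have -> : K * x ^+ 3 = (x * K) * x * x by ring.
    have : x * K <= e by nra.
    move=> ?; rewrite -mulrA; apply: ler_pM; rewrite ?mulr_ge0 //.
    by rewrite -/x in h1; nra.
  have := cdiff_uniq cd (dQ 0); rewrite addr0 mulr0 addr0 => /esym/eqP.
  by rewrite subr_eq0 => /eqP.
(* [1 / 4] keeps the disc of radius [|h|] about [h] inside the disc of radius [1 / 2] on which [T3]
   holds. *)
exists (2 * c 2%N) => e e0; exists (Num.min (1 / 4) (e / (16 * K + 1))).
  by rewrite lt_min !divr_gt0 // ltr_wpDl // mulr_ge0.
move=> h; rewrite lt_min => /andP[h1 h2].
have [->|hn0] := eqVneq h 0; first by rewrite addr0 mulr0 !subrr cabs0 mulr0.
have hp : 0 < cabs h by rewrite cabs_gt0.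
have lh : expR (ln (cabs h)) = cabs h by rewrite lnK.
have hb : forall k, cabs k <= expR (ln (cabs h)) -> cabs (Q (h + k)) <= 8 * K * cabs h ^+ 3.
  rewrite lh => k kh; have hk := le_trans (cabsD h k) (lerD (lexx _) kh).
  apply: le_trans (T3 _ _) _; first by move: hk; lra.
  rewrite (_ : 8 * K * _ = K * (cabs h + cabs h) ^+ 3); last by ring.
  by apply: ler_wpM2l => //; apply: lerXn2r; rewrite ?nnegrE ?cabs_ge0 ?addr_ge0 ?cabs_ge0.
have := cauchy_estimate hQ hb (dQ h).
rewrite lh Q0 opprD addrA => /le_trans; apply.
rewrite (_ : _ / _ = 16 * K * cabs h * cabs h); last by field; exact: lt0r_neq0.
apply: ler_wpM2r; first exact: ltW.
by move: h2; rewrite ltr_pdivlMr; [nra|rewrite ltr_wpDl // mulr_ge0].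
Qed.

Lemma holo_derive1n f n : holo f -> holo (derive1n n f).
Proof. by move=> hf; elim: n => // n; rewrite derive1nS; exact: holo_derive1. Qed.

(** Leibniz' formula for a linear factor; at [k = 0] the term with [k.-1] is multiplied by 0. *)
Lemma derive1n_factor f g a k : holo f -> holo g -> (forall z, f z = (z - a) * g z) ->
  forall z, derive1n k f z = (z - a) * derive1n k g z + k%:R * derive1n k.-1 g z.
Proof.
move=> hf hg fE; elim: k => [|k IH] z; first by rewrite !derive1n0 mul0r addr0.
have /funext E : forall w, derive1n k f w = (w - a) * derive1n k g w + k%:R * derive1n k.-1 g w := IH.
have d1 := cdiff_is_derive (holo_cdiff z (holo_derive1n k hg)).
have d2 := cdiff_is_derive (holo_cdiff z (holo_derive1n k.-1 hg)).
rewrite derive1nS E derive1E.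
rewrite (@derive_val _ _ _ _ _ _ _ (is_derive_leibniz a k%:R d1 d2)).
rewrite !derive1nS /=; case: k {IH E d1 d2} => [|k] /=; first by rewrite mul0r addr0 mul1r addrC.
by rewrite -derive1nS -[k.+2%:R]natr1; ring.
Qed.

(** Dividing out [z - a] lowers the order of vanishing at [a] by one, since the derivative of order
    [k + 1] of [f] at [a] is [k + 1] times that of order [k] of the quotient. Elsewhere the order is
    kept, by an inner induction on [k]. *)
Lemma holo_factor (l : seq C) f : holo f ->
  (forall z k, (k < count_mem z l)%N -> derive1n k f z = 0) ->
  exists2 g, holo g & forall z, f z = (\prod_(a <- l) (z - a)) * g z.
Proof.
elim: l f => [|a l IH] f hf vf; first by exists f => // z; rewrite big_nil mul1r.
have fa : f a = 0 by have := vf a 0%N; rewrite /= eqxx; apply.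
have [g hg fE] := holo_quotient hf fa.
have [|q hq gE] := IH g hg; last first.
  by exists q => // z; rewrite fE gE big_cons mulrA.
move=> z k kz; have D := derive1n_factor _ hf hg fE.
have [za|za] := eqVneq z a.
  have h : (k.+1 < count_mem z (a :: l))%N by rewrite /= za eqxx ltnS -za.
  have := vf z k.+1 h; rewrite D za subrr mul0r add0r => /eqP.
  by rewrite mulf_eq0 pnatr_eq0 /= => /eqP.
have kz' j : (j < count_mem z l)%N -> (j < count_mem z (a :: l))%N.
  by rewrite /= eq_sym (negbTE za).
elim: k kz => [|k IHk] kz.
  have := vf z 0%N (kz' _ kz) => /eqP.
  by rewrite derive1n0 fE mulf_eq0 subr_eq0 (negbTE za) /= => /eqP.
have := vf z k.+1 (kz' _ kz) => /eqP.
rewrite D [k.+1.-1]/= IHk; last exact: ltn_trans kz.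
by rewrite mulr0 addr0 mulf_eq0 subr_eq0 (negbTE za) /= => /eqP.
Qed.

(** Taylor polynomials for a circle of at least twice the radius: the remainder is at most
    [8 M 2^-N]. *)
Lemma holo_poly_approx g r e : holo g -> 0 < e ->
  exists p : {poly C}, forall z, cabs z <= r -> cabs (g z - p.[z]) <= e.
Proof.
move=> hg e0; pose rr := Num.max r 1.
have rr0 : 0 < rr by rewrite lt_max ltr01 orbT.
pose s := ln (2 * rr).
have es : expR s = 2 * rr by rewrite lnK // posrE mulr_gt0.
have [M HM] := bounded_on_disc (expR s) (holo_ccont hg).
have M0 : 0 <= M by apply: le_trans (HM 0 _); rewrite ?cabs_ge0 // cabs0 expR_ge0.
have [N N0 HN] : exists2 N, (0 < N)%N & 8 * M * 2^-1 ^+ N <= e.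
  have cv : 8 * M * 2^-1 ^+ n @[n --> \oo] --> 8 * M * 0.
    by apply: cvgMr; apply: cvg_expr; rewrite ger0_norm ?invr_ge0 //; lra.
  rewrite mulr0 in cv.
  have [N _ HN] := @cvgr_lt R _ _ _ _ 0 cv e e0.
  by exists N.+1 => //; apply/ltW/HN => /=.
exists (\poly_(n < N) coef g s n) => z zr; rewrite horner_poly.
have zr2 : cabs z <= expR s / 2.
  by rewrite es mulrAC divff // mul1r le_max zr.
apply: le_trans (taylor hg N0 HM zr2) _; apply: le_trans HN.
apply: ler_wpM2l; first by rewrite mulr_ge0.
apply: lerXn2r; rewrite ?nnegrE ?invr_ge0 ?divr_ge0 ?cabs_ge0 ?expR_ge0 //.
by rewrite ler_pdivrMr ?expR_gt0 // mulrC.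
Qed.

(** There is a first nonzero Taylor coefficient [c], and on small circles [c z^n] dominates the
    rest. This covers [f 0 = 0] as well, so that [f] is not normalised at the origin. *)
Lemma holo_lower_bound f b : holo f -> f b != 0 ->
  exists2 r, 0 < r & forall s, expR s <= r -> exists2 k, 0 < k & forall z, cabs z = expR s -> k <= cabs (f z).
Proof.
(* The radius exceeds [2 |b|]: if all coefficients vanished, the Taylor remainders at [b] would
   force [f b = 0]. *)
move=> hf fb; pose s := ln (2 * cabs b + 1).
have b0 := cabs_ge0 b.
have es : expR s = 2 * cabs b + 1 by rewrite lnK // posrE ltr_wpDl // mulr_ge0.
have [M HM] := bounded_on_disc (expR s) (holo_ccont hf).
have M0 : 0 <= M by apply: le_trans (HM 0 _); rewrite ?cabs_ge0 // cabs0 expR_ge0.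
have [n cn] : exists n, coef f s n != 0.
  apply/not_existsP => H; have {}H n : coef f s n = 0 by apply/eqP/negPn/negP/H.
  have br : cabs b <= expR s / 2 by rewrite es; lra.
  have fb0 : 0 < cabs (f b) by rewrite cabs_gt0.
  have cv : 8 * M * 2^-1 ^+ n @[n --> \oo] --> 8 * M * 0.
    by apply: cvgMr; apply: cvg_expr; rewrite ger0_norm ?invr_ge0 //; lra.
  rewrite mulr0 in cv.
  have [N _ /(_ N.+1 (leqnSn N)) HN] := @cvgr_lt R _ _ _ _ 0 cv _ fb0.
  have := taylor hf (isT : (0 < N.+1)%N) HM br.
  rewrite big1 ?subr0 => [h|i _]; last by rewrite H mul0r.
  have : cabs (f b) < cabs (f b); last by rewrite ltxx.
  apply: le_lt_trans h _; apply: le_lt_trans HN; apply: ler_wpM2l; first by rewrite mulr_ge0.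
  apply: lerXn2r; rewrite ?nnegrE ?invr_ge0 ?divr_ge0 ?cabs_ge0 ?expR_ge0 //.
  by rewrite ler_pdivrMr ?expR_gt0 // mulrC.
have exn : exists n, coef f s n != 0 by exists n.
case: (ex_minnP exn) => {cn}{}n cn nmin.
set c := coef f s n in cn; have c0 : 0 < cabs c by rewrite cabs_gt0.
set K := 8 * M / expR s ^+ n.+1.
have K0 : 0 <= K by rewrite divr_ge0 ?exprn_ge0 ?expR_ge0 // mulr_ge0.
have K1 : 0 < 2 * K + 1 by rewrite ltr_wpDl // mulr_ge0.
exists (Num.min (expR s / 2) (cabs c / (2 * K + 1))).
  by rewrite lt_min !divr_gt0 ?expR_gt0.
move=> t; rewrite le_min => /andP[t1 t2].
have et : 0 < expR t := expR_gt0 t.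
exists (cabs c / 2 * expR t ^+ n); first by rewrite mulr_gt0 ?exprn_gt0 // divr_gt0.
move=> z zt.
have h : cabs (f z - c * z ^+ n) <= 8 * M * (expR t / expR s) ^+ n.+1.
  have := taylor hf (isT : (0 < n.+1)%N) HM (a := z); rewrite zt => /(_ t1).
  rewrite big_ord_recr big1 ?Monoid.mul1m; [by apply|move=> i _].
  have [->|/nmin] := eqVneq (coef f s i) 0; first by rewrite mul0r.
  by rewrite leqNgt ltn_ord.
have h2 : 8 * M * (expR t / expR s) ^+ n.+1 = K * expR t * expR t ^+ n.
  by rewrite /K expr_div_n (exprS (expR t)); ring.
have h3 : K * expR t <= cabs c / 2 by move: t2; rewrite ler_pdivlMr //; nra.
have h4 : K * expR t * expR t ^+ n <= cabs c / 2 * expR t ^+ n.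
  by apply: ler_wpM2r => //; rewrite exprn_ge0 // ltW.
have h5 := cabs_lbD (c * z ^+ n) (f z - c * z ^+ n).
rewrite [c * z ^+ n + _]addrC subrK cabsM cabsX zt in h5.
by clearbody c; move: h h4 h5; rewrite h2; lra.
Qed.

End Entire.

Section Sections.
Context {R : realType}.
Implicit Types (F : R * R -> R).

Lemma has_grad_eq F q (a b a' b' : R) : has_grad F q a b -> a = a' -> b = b' -> has_grad F q a' b'.
Proof. by move=> H <- <-. Qed.

Lemma has_grad_derive1 F (x y a b : R) : has_grad F (x, y) a b -> is_derive x 1 (fun s => F (s, y)) a.
Proof.
move=> [phi [psi [c1 _ E]]]; apply/is_derive1_caratheodory.
have C : phi (s, y) @[s --> x] --> a.
  apply: (@cvg_comp _ _ _ (fun s : R => (s, y)) phi _ (nbhs (x, y))) => //.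
  exact: cvg_pair cvg_id (cvg_cst y).
exists (fun s => if s == x then a else phi (s, y)); split.
- by move=> s; rewrite E /= subrr mulr0 addr0; case: eqVneq => // ->; rewrite subrr !mulr0.
- rewrite /prop_for /continuous_at eqxx; apply/cvgrPdist_le => e e0.
  have /cvgrPdist_le/(_ e e0) := C; apply: filterS => s.
  by case: eqVneq => // _ _; rewrite subrr normr0 ltW.
by rewrite eqxx.
Qed.

Lemma has_grad_derive2 F (x y a b : R) : has_grad F (x, y) a b -> is_derive y 1 (fun t => F (x, t)) b.
Proof.
move=> [phi [psi [c1 c2 E]]].
have H : has_grad (fun q => F (q.2, q.1)) (y, x) b a.
  exists (fun q => psi (q.2, q.1)), (fun q => phi (q.2, q.1)).
  have sw : (q.2, q.1) @[q --> (y, x)] --> (x, y).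
    exact: cvg_pair (@cvg_snd _ _ _ _ _) (@cvg_fst _ _ _ _ _).
  split; last by move=> q; rewrite /= E /= addrC.
    exact: (cvg_comp _ _ sw c2).
  exact: (cvg_comp _ _ sw c1).
exact: (has_grad_derive1 H).
Qed.

Lemma is_derive_continuous (f df : R -> R) : (forall x : R, is_derive x 1 f (df x)) -> continuous f.
Proof.
move=> H x; apply/differentiable_continuous/derivable1_diffP; exact: ex_derive.
Qed.

Lemma has_grad_sec1 F y : (forall x, exists a b, has_grad F (x, y) a b) -> continuous (fun s => F (s, y)).
Proof.
move=> H x; have [a [b /has_grad_derive1 h]] := H x.
by apply/differentiable_continuous/derivable1_diffP; exact: ex_derive.
Qed.

Lemma has_grad_sec2 F x : (forall y, exists a b, has_grad F (x, y) a b) -> continuous (fun t => F (x, t)).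
Proof.
move=> H y; have [a [b /has_grad_derive2 h]] := H y.
by apply/differentiable_continuous/derivable1_diffP; exact: ex_derive.
Qed.
End Sections.

(** * Green's identity for a logarithmic pole *)

Section LogKernel.
Context {R : realType}.
Variable sg : R.
Local Notation V := (expR sg).
Implicit Types (s y t u x : R) (q : R * R).

(* With [sg + i al] the logarithm of a zero [a] and [y = th - al], these are
   [|e^(s + i th) - a|^2], [log |e^(s + i th) - a|] and the partial derivatives
   of the latter. *)
Definition dist2 s y := expR s ^+ 2 - 2 * (expR s * V * cos y) + V ^+ 2.
Definition logdist s y := ln (dist2 s y) / 2.
Definition logdist_s s y := (expR s ^+ 2 - expR s * V * cos y) / dist2 s y.
Definition logdist_t s y := expR s * V * sin y / dist2 s y.

Lemma dist2E s y : dist2 s y = (expR s - V) ^+ 2 + 2 * (expR s * V) * (1 - cos y).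
Proof. by rewrite /dist2; ring. Qed.

Definition regular_pt s y := s != sg \/ cos y != 1.

Lemma dist2_gt0 s y : regular_pt s y -> 0 < dist2 s y.
Proof.
move=> h; rewrite dist2E.
have e1 := expR_gt0 s; have e2 := expR_gt0 sg; have c1 := cos_le1 y.
have k0 : 0 <= 2 * (expR s * V) * (1 - cos y).
  by rewrite !mulr_ge0 ?subr_ge0 ?expR_ge0.
case: h => [h|h].
  have : 0 < (expR s - V) ^+ 2; last by lra.
  rewrite exprn_even_gt0 //= subr_eq0; apply: contra_neq h; exact: expR_inj.
have c2 : cos y < 1 by rewrite lt_neqAle h.
have : 0 < 2 * (expR s * V) * (1 - cos y) by rewrite !mulr_gt0 ?subr_gt0.
by have := sqr_ge0 (expR s - V); lra.
Qed.

Lemma has_grad_dist2 q : has_grad (fun q => dist2 q.1 q.2) q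
  (2 * (expR q.1 ^+ 2 - expR q.1 * V * cos q.2)) (2 * (expR q.1 * V * sin q.2)).
Proof.
have he := has_grad_fst (is_derive_expR q.1); have hc := has_grad_snd (is_derive_cos q.2).
have h := has_gradD (has_gradB (has_gradM he he) (has_gradZ 2 (has_gradM (has_gradM he (has_grad_cst V q)) hc))) (has_grad_cst (V ^+ 2) q).
have -> : (fun q => dist2 q.1 q.2) = (fun q => expR q.1 * expR q.1 - 2 * (expR q.1 * V * cos q.2) + V ^+ 2).
  by apply/funext => x; rewrite /dist2 expr2.
by apply: has_grad_eq h _ _ => /=; ring.
Qed.

Lemma is_derive_inv x : x != 0 -> is_derive x 1 (@GRing.inv R) (- x ^- 2).
Proof.
move=> x0; apply: DeriveDef; first exact: (@derivableV R R id).
by rewrite (@deriveV R R id) // derive_id /GRing.scale /= mulr1.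
Qed.

Lemma has_grad_dist2V q : regular_pt q.1 q.2 -> has_grad (fun q => (dist2 q.1 q.2)^-1) q
  (- (dist2 q.1 q.2) ^- 2 * (2 * (expR q.1 ^+ 2 - expR q.1 * V * cos q.2)))
  (- (dist2 q.1 q.2) ^- 2 * (2 * (expR q.1 * V * sin q.2))).
Proof.
move=> /dist2_gt0 h; apply: (has_grad_comp (has_grad_dist2 q)); apply: is_derive_inv.
exact: lt0r_neq0.
Qed.

Lemma has_grad_logdist q : regular_pt q.1 q.2 ->
  has_grad (fun q => logdist q.1 q.2) q (logdist_s q.1 q.2) (logdist_t q.1 q.2).
Proof.
move=> /dist2_gt0 h.
have := has_gradM (has_grad_comp (has_grad_dist2 q) (is_derive1_ln h)) (has_grad_cst 2^-1 q).
by move=> H; apply: has_grad_eq H _ _; rewrite /logdist_s /logdist_t; field; exact: lt0r_neq0.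
Qed.

Definition logdist_ss s y := (2 * expR s ^+ 2 - expR s * V * cos y) / dist2 s y
   - 2 * (expR s ^+ 2 - expR s * V * cos y) ^+ 2 / dist2 s y ^+ 2.
Definition logdist_st s y := expR s * V * sin y / dist2 s y
   - 2 * (expR s ^+ 2 - expR s * V * cos y) * (expR s * V * sin y) / dist2 s y ^+ 2.

Lemma has_grad_logdist_s q : regular_pt q.1 q.2 ->
  has_grad (fun q => logdist_s q.1 q.2) q (logdist_ss q.1 q.2) (logdist_st q.1 q.2).
Proof.
move=> hq; have h := dist2_gt0 hq.
have he := has_grad_fst (is_derive_expR q.1); have hc := has_grad_snd (is_derive_cos q.2).
have H := has_gradM (has_gradB (has_gradM he he) (has_gradM (has_gradM he (has_grad_cst V q)) hc)) (has_grad_dist2V hq).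
by apply: has_grad_eq H _ _; rewrite /logdist_ss /logdist_st; field; exact: lt0r_neq0.
Qed.

(** The second component is minus [logdist_ss]: this is the harmonicity of the logarithm, and it
    comes down to [cos^2 + sin^2 = 1]. *)
Lemma has_grad_logdist_t q : regular_pt q.1 q.2 ->
  has_grad (fun q => logdist_t q.1 q.2) q (logdist_st q.1 q.2) (- logdist_ss q.1 q.2).
Proof.
move=> hq; have h := dist2_gt0 hq.
have he := has_grad_fst (is_derive_expR q.1); have hc := has_grad_snd (is_derive_sin q.2).
have H := has_gradM (has_gradM (has_gradM he (has_grad_cst V q)) hc) (has_grad_dist2V hq).
apply: has_grad_eq H _ _; first by rewrite /logdist_st; field; exact: lt0r_neq0.
have hh := lt0r_neq0 h.
apply/eqP; rewrite -subr_eq0; apply/eqP.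
transitivity (2 * expR q.1 ^+ 2 * (dist2 q.1 q.2 - (expR q.1 ^+ 2 - 2 * (expR q.1 * V * cos q.2) + V ^+ 2 * (cos q.2 ^+ 2 + sin q.2 ^+ 2))) / dist2 q.1 q.2 ^+ 2).
  by rewrite /logdist_ss; field.
by rewrite cos2Dsin2 mulr1 /dist2 subrr mulr0 mul0r.
Qed.
End LogKernel.

(** * Green's identity between two circles *)

Section Piece.
Context {R : realType}.
Variables (p sg A B x1 x2 : R).
Hypotheses (p0 : 0 < p) (x12 : x1 <= x2) (sg1 : x1 != sg) (sg2 : x2 != sg).
Implicit Types (s t u y : R) (q : R * R).

Definition kap s := A * expR (p * s) + B * expR (- (p * s)).
Definition dkap s := p * (A * expR (p * s) - B * expR (- (p * s))).

Lemma is_derive_kap s : is_derive s 1 kap (dkap s).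
Proof.
have d1 := is_derive1_comp (is_derive_expR (p * s)) (is_derive_mull p s).
have d2 : is_derive s 1 (fun s => expR (- (p * s))) (expR (- (p * s)) * - p).
  by apply: is_derive1_comp; apply: is_deriveN; exact: is_derive_mull.
have d := is_deriveD (is_deriveZ A d1) (is_deriveZ B d2).
by apply: is_derive_eq d _; rewrite /dkap /GRing.scale /=; ring.
Qed.

Lemma is_derive_dkap s : is_derive s 1 dkap (p ^+ 2 * kap s).
Proof.
have d1 := is_derive1_comp (is_derive_expR (p * s)) (is_derive_mull p s).
have d2 : is_derive s 1 (fun s => expR (- (p * s))) (expR (- (p * s)) * - p).
  by apply: is_derive1_comp; apply: is_deriveN; exact: is_derive_mull.
have d := is_deriveZ p (is_deriveB (is_deriveZ A d1) (is_deriveZ B d2)).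
by apply: is_derive_eq d _; rewrite /kap /GRing.scale /=; ring.
Qed.

Lemma continuous_kap : continuous kap.
Proof. exact: is_derive_continuous is_derive_kap. Qed.

(* The potential [logpot] satisfies [logpot'' + p^2 logpot = - bdry] off
   [2 pi Z], because [kap'' = p^2 kap] and [logdist] is harmonic. *)
Definition bdry y := (kap x2 * logdist_s sg x2 y - dkap x2 * logdist sg x2 y) -
                   (kap x1 * logdist_s sg x1 y - dkap x1 * logdist sg x1 y).
Definition logpot y := Int x1 x2 (fun s => kap s * logdist sg s y).
Definition logpot_t y := Int x1 x2 (fun s => kap s * logdist_t sg s y).

Lemma cos_neq1 y : 0 < y < pi *+ 2 -> cos y != 1.
Proof.
move=> /andP[y0 y2]; apply/eqP => c1.
have := cosD (y / 2) (y / 2); rewrite -splitr c1 => E.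
have s0 : 0 < sin (y / 2).
  by apply: sin_gt0_pi; rewrite divr_gt0 //= ltr_pdivrMr // mulr_natr.
have := cos2Dsin2 (y / 2); nra.
Qed.

Lemma continuous_kapM (F : R -> R) : continuous F -> continuous (fun s => kap s * F s).
Proof. by move=> cF x; apply: cvgM; [exact: continuous_kap|exact: cF]. Qed.

Lemma continuous_logdist1 y : cos y != 1 -> continuous (fun s => logdist sg s y).
Proof.
move=> cy; apply: (has_grad_sec1 (F := fun q => logdist sg q.1 q.2)) => s; do 2!eexists.
by apply: has_grad_logdist; right.
Qed.

Lemma continuous_logdist_t1 y : cos y != 1 -> continuous (fun s => logdist_t sg s y).
Proof.
move=> cy; apply: (has_grad_sec1 (F := fun q => logdist_t sg q.1 q.2)) => s; do 2!eexists.
by apply: has_grad_logdist_t; right.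
Qed.

Lemma continuous_logdist2 s : s != sg -> continuous (logdist sg s).
Proof.
move=> cy; apply: (has_grad_sec2 (F := fun q => logdist sg q.1 q.2)) => y; do 2!eexists.
by apply: has_grad_logdist; left.
Qed.

Lemma continuous_logdist_s2 s : s != sg -> continuous (logdist_s sg s).
Proof.
move=> cy; apply: (has_grad_sec2 (F := fun q => logdist_s sg q.1 q.2)) => y; do 2!eexists.
by apply: has_grad_logdist_s; left.
Qed.

Lemma continuous_bdry : continuous bdry.
Proof.
have cc (k : R) (F : R -> R) : continuous F -> continuous (fun y : R => k * F y).
  by move=> cF x; apply: cvgM; [exact: cvg_cst|exact: cF].
by move=> x; apply: cvgB; apply: cvgB; apply: cc; do ?[exact: continuous_logdist_s2|exact: continuous_logdist2].
Qed.

(** The form [P ds + Q dt] is closed because [kap'' = p^2 kap], [psi'' = - p^2 psi] and [logdist] is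
    harmonic. Between two lifts of the pole Goursat's theorem applies to it, and the four sides are
    the terms of the identity. *)
Lemma green_identity (psi dpsi : R -> R) y1 y2 : 0 < y1 -> y1 <= y2 -> y2 < pi *+ 2 ->
  (forall y, is_derive y 1 psi (dpsi y)) -> (forall y, is_derive y 1 dpsi (- (p ^+ 2 * psi y))) ->
  logpot_t y2 * psi y2 - logpot y2 * dpsi y2 = logpot_t y1 * psi y1 - logpot y1 * dpsi y1 - Int y1 y2 (fun y => bdry y * psi y).
Proof.
move=> y10 y12 y22 dp ddp.
have c1 y : y1 <= y <= y2 -> cos y != 1.
  by move=> /andP[h1 h2]; apply: cos_neq1; rewrite (lt_le_trans y10 h1) (le_lt_trans h2 y22).
pose P q := kap q.1 * (logdist_t sg q.1 q.2 * psi q.2 - logdist sg q.1 q.2 * dpsi q.2).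
pose Q q := - ((kap q.1 * logdist_s sg q.1 q.2 - dkap q.1 * logdist sg q.1 q.2) * psi q.2).
have gP q : regular_pt sg q.1 q.2 -> has_grad P q
   (dkap q.1 * (logdist_t sg q.1 q.2 * psi q.2 - logdist sg q.1 q.2 * dpsi q.2) +
      kap q.1 * (logdist_st sg q.1 q.2 * psi q.2 - logdist_s sg q.1 q.2 * dpsi q.2))
   (kap q.1 * (- logdist_ss sg q.1 q.2 * psi q.2 + p ^+ 2 * logdist sg q.1 q.2 * psi q.2)).
  move=> hq; have hk := has_grad_fst (is_derive_kap q.1).
  have hp := has_grad_snd (dp q.2); have hd := has_grad_snd (ddp q.2).
  have H := has_gradM hk (has_gradB (has_gradM (has_grad_logdist_t hq) hp) (has_gradM (has_grad_logdist hq) hd)).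
  by apply: has_grad_eq H _ _ => /=; ring.
have gQ q : regular_pt sg q.1 q.2 -> has_grad Q q
   (kap q.1 * (- logdist_ss sg q.1 q.2 * psi q.2 + p ^+ 2 * logdist sg q.1 q.2 * psi q.2))
   (- ((kap q.1 * logdist_st sg q.1 q.2 - dkap q.1 * logdist_t sg q.1 q.2) * psi q.2 + (kap q.1 * logdist_s sg q.1 q.2 - dkap q.1 * logdist sg q.1 q.2) * dpsi q.2)).
  move=> hq; have hk := has_grad_fst (is_derive_kap q.1); have hdk := has_grad_fst (is_derive_dkap q.1).
  have hp := has_grad_snd (dp q.2).
  have H := has_gradN (has_gradM (has_gradB (has_gradM hk (has_grad_logdist_s hq)) (has_gradM hdk (has_grad_logdist hq))) hp).
  by apply: has_grad_eq H _ _ => /=; ring.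
have cl : closed_on P Q x1 x2 y1 y2.
  move=> q _ hy; do 3!eexists; split; first by apply: gP; right; exact: c1.
  by apply: gQ; right; exact: c1.
have cP y : cos y != 1 -> continuous (fun s => P (s, y)).
  by move=> cy; apply: has_grad_sec1 => s; do 2!eexists; apply: gP; right.
have cQ s : s != sg -> continuous (fun y => Q (s, y)).
  by move=> cy; apply: has_grad_sec2 => y; do 2!eexists; apply: gQ; left.
have cy1 : cos y1 != 1 by apply: c1; rewrite lexx.
have cy2 : cos y2 != 1 by apply: c1; rewrite lexx andbT.
have := goursat x12 y12 cl (cP _ cy1) (cP _ cy2) (cQ _ sg1) (cQ _ sg2).
have PE y : cos y != 1 -> Int x1 x2 (fun s => P (s, y)) = logpot_t y * psi y - logpot y * dpsi y.
  move=> cy; rewrite /logpot_t /logpot.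
  have ck (F : R -> R) : continuous F -> continuous (fun s => kap s * F s) := @continuous_kapM F.
  rewrite mulrC [logpot y * _]mulrC -(IntZ _ _ _ (ck _ (continuous_logdist_t1 cy))) -(IntZ _ _ _ (ck _ (continuous_logdist1 cy))).
  rewrite -IntB.
  - by congr Int; apply/funext => s; rewrite /P /=; ring.
  - by move=> s; apply: cvgM; [exact: cvg_cst|exact: ck _ (continuous_logdist_t1 cy) s].
  - by move=> s; apply: cvgM; [exact: cvg_cst|exact: ck _ (continuous_logdist1 cy) s].
have QE : Int y1 y2 (fun y => Q (x2, y)) - Int y1 y2 (fun y => Q (x1, y)) = - Int y1 y2 (fun y => bdry y * psi y).
  rewrite -IntB; [|exact: cQ|exact: cQ].
  rewrite -mulN1r -IntZ; first by congr Int; apply/funext => y; rewrite /Q /bdry /=; ring.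
  by move=> y; apply: cvgM; [exact: continuous_bdry|exact: is_derive_continuous dp y].
rewrite /circulation (PE _ cy1) (PE _ cy2) -addrA QE; lra.
Qed.

Lemma pi_in : 0 < (pi : R) < pi *+ 2.
Proof. by have := @pi_gt0 R; rewrite mulr2n => ?; apply/andP; split; lra. Qed.

Lemma logpot_t_pi : logpot_t pi = 0.
Proof.
rewrite /logpot_t (_ : (fun s => _) = fun=> 0) ?Int_cst ?mul0r //.
by apply/funext => s; rewrite /logdist_t sinpi mulr0 mul0r mulr0.
Qed.

Lemma is_derive_sin_sub x y : is_derive y 1 (fun y => sin (p * (x - y))) (- (p * cos (p * (x - y)))).
Proof.
have d : is_derive y 1 (fun y => p * (x - y)) (- p).
  have := is_deriveZ p (is_deriveB (is_derive_cst x y (1 : R)) (is_derive_id y (1 : R))).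
  by move=> D; apply: is_derive_eq D _; rewrite /GRing.scale /=; ring.
by apply: is_derive_eq (is_derive1_comp (is_derive_sin _) d) _; ring.
Qed.

Lemma is_derive_cos_sub x y : is_derive y 1 (fun y => cos (p * (x - y))) (p * sin (p * (x - y))).
Proof.
have d : is_derive y 1 (fun y => p * (x - y)) (- p).
  have := is_deriveZ p (is_deriveB (is_derive_cst x y (1 : R)) (is_derive_id y (1 : R))).
  by move=> D; apply: is_derive_eq D _; rewrite /GRing.scale /=; ring.
by apply: is_derive_eq (is_derive1_comp (is_derive_cos _) d) _; ring.
Qed.

(** The base point [pi] lies opposite to the pole, where [logpot_t] vanishes. *)
Lemma green_identity_pi (psi dpsi : R -> R) y : 0 < y < pi *+ 2 ->
  (forall y, is_derive y 1 psi (dpsi y)) -> (forall y, is_derive y 1 dpsi (- (p ^+ 2 * psi y))) ->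
  logpot_t y * psi y - logpot y * dpsi y = - logpot pi * dpsi pi - Int pi y (fun y => bdry y * psi y).
Proof.
move=> /andP[y0 y2] dp ddp; have /andP[pi0 pi2] := pi_in.
have [h|/ltW h] := leP pi y.
  by rewrite (green_identity pi0 h y2 dp ddp) logpot_t_pi; ring.
have := green_identity y0 h pi2 dp ddp; rewrite logpot_t_pi (Int_sym y pi).
by move=> E; rewrite mulNr; lra.
Qed.

(** Variation of constants: [psi = sin (p (y - .))] vanishes at the end point [y] with slope [- p],
    which isolates [logpot y]. The cosine does the same for [logpot_t] below. *)
Lemma logpot_period0 y : 0 < y < pi *+ 2 ->
  p * logpot y = p * logpot pi * cos (p * (y - pi)) - Int pi y (fun u => bdry u * sin (p * (y - u))).
Proof.
move=> hy; have dd u : is_derive u 1 (fun u => - (p * cos (p * (y - u)))) (- (p ^+ 2 * sin (p * (y - u)))).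
  have D := is_deriveZ (- p) (is_derive_cos_sub y u).
  have -> : (fun u => - (p * cos (p * (y - u)))) = (- p) \*: (fun u => cos (p * (y - u))).
    by apply/funext => v /=; rewrite /GRing.scale /=; ring.
  by apply: is_derive_eq D _; rewrite /GRing.scale /=; ring.
have := green_identity_pi hy (is_derive_sin_sub y) dd.
by rewrite subrr mulr0 sin0 cos0; lra.
Qed.

Lemma logpot_t_period0 y : 0 < y < pi *+ 2 ->
  logpot_t y = - (p * logpot pi * sin (p * (y - pi))) - Int pi y (fun u => bdry u * cos (p * (y - u))).
Proof.
move=> hy; have dd u : is_derive u 1 (fun u => p * sin (p * (y - u))) (- (p ^+ 2 * cos (p * (y - u)))).
  have D := is_deriveZ p (is_derive_sin_sub y u).
  by apply: is_derive_eq D _; rewrite /GRing.scale /=; ring.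
have := green_identity_pi hy (is_derive_cos_sub y) dd.
by rewrite subrr mulr0 sin0 cos0; lra.
Qed.
End Piece.

(** * The angular derivative of the potential near the pole *)

Section Jump.
Context {R : realType}.
Implicit Types (s t u v y e x eta d : R).

Lemma cvg_right0 (f : R -> R) : {for 0, continuous f} -> f eta @[eta --> 0^'+] --> f 0.
Proof. exact: cvg_at_right_filter. Qed.

Lemma cvg_div_sin (f : R -> R) (l : R) : 0 < l -> f eta @[eta --> 0^'+] --> l ->
  f eta / sin eta @[eta --> 0^'+] --> +oo.
Proof.
move=> l0 fl; apply/cvgryPge => M.
have M1 : 0 < `|M| + 1 by rewrite ltr_wpDl.
have s0 : sin eta @[eta --> 0^'+] --> (0 : R).
  by rewrite -[X in _ --> X]sin0; apply: cvg_right0; exact: continuous_sin.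
have l2 : l / 2 < l by lra.
near=> eta.
have h1 : l / 2 <= f eta by near: eta; exact: cvgr_ge l2.
have h2 : sin eta <= l / 2 / (`|M| + 1).
  by near: eta; apply: (cvgr_le _ s0); rewrite divr_gt0 // divr_gt0.
have e0 : 0 < eta by near: eta; exact: nbhs_right_gt.
have h3 : 0 < sin eta.
  by apply: sin_gt0_pi; rewrite e0 /=; near: eta; apply: nbhs_right_lt; exact: pi_gt0.
rewrite ler_pdivlMr //; apply: le_trans h1; move: h2; rewrite ler_pdivlMr //.
have := ler_norm M; nra.
Unshelve. all: by end_near. Qed.

Lemma segment_bounded (f : R -> R) u v : continuous f -> u <= v ->
  exists2 M, 0 < M & forall s, u <= s <= v -> `|f s| <= M.
Proof.
move=> cf uv.
have cn : {within `[u, v], continuous (fun s => `|f s|)}.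
  by apply: continuous_subspaceT => s; apply: cvg_norm; exact: cf.
have [c _ H] := EVT_max uv cn; exists (`|f c| + 1); first by rewrite ltr_wpDl.
by move=> s hs; have := H s; rewrite in_itv /= => /(_ hs); lra.
Qed.

Section piece.
Variables (p sg A B : R).
Local Notation V := (expR sg).
Local Notation kap := (kap p A B).

Lemma cosN1_near : \forall eta \near (0 : R)^'+, [/\ 0 < eta, eta < pi, 0 < sin eta & cos eta != 1].
Proof.
near=> eta.
have e0 : 0 < eta by near: eta; exact: nbhs_right_gt.
have e1 : eta < pi by near: eta; apply: nbhs_right_lt; exact: pi_gt0.
split => //; first by apply: sin_gt0_pi; rewrite e0.
by apply: cos_neq1; rewrite e0 /= (lt_trans e1) //; have /andP[] := @pi_in R.
Unshelve. all: by end_near. Qed.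

Lemma continuous_kapLt eta : cos eta != 1 -> continuous (fun s => kap s * logdist_t sg s eta).
Proof. by move=> ce; apply: continuous_kapM; exact: (continuous_logdist_t1 ce). Qed.

(** Away from [sg] the denominator of [logdist_t] stays above [m], so that its factor [sin eta]
    makes the integral small. *)
Lemma logdist_t_outer u v : u <= v -> v < sg \/ sg < u ->
  Int u v (fun s => kap s * logdist_t sg s eta) @[eta --> 0^'+] --> (0 : R).
Proof.
move=> uv hsg; apply/cvgr0Pnorm_le => e e0.
have [m m0 Hm] : exists2 m, 0 < m & forall s, u <= s <= v -> m <= (expR s - V) ^+ 2.
  case: hsg => h.
    exists ((V - expR v) ^+ 2); first by rewrite exprn_gt0 // subr_gt0 ltr_expR.
    move=> s /andP[_ sv]; rewrite -[leRHS]sqrrN opprB.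
    apply: lerXn2r; rewrite ?nnegrE ?subr_ge0 ?ler_expR ?(ltW h) ?(le_trans sv) ?(ltW h) //.
    by rewrite lerD2l lerN2 ler_expR.
  exists ((expR u - V) ^+ 2); first by rewrite exprn_gt0 // subr_gt0 ltr_expR.
  move=> s /andP[us _]; apply: lerXn2r; rewrite ?nnegrE ?subr_ge0 ?ler_expR ?(le_trans _ us) ?(ltW h) //.
  by rewrite lerD2r ler_expR.
have cf : continuous (fun s => kap s * (expR s * V)).
  by apply: continuous_kapM => s; apply: cvgM; [exact: continuous_expR|exact: cvg_cst].
have [M M0 HM] := segment_bounded cf uv.
have K0 : 0 < M / m * (v - u) + 1 by rewrite ltr_wpDl // mulr_ge0 ?subr_ge0 // divr_ge0 // ltW.
have s0 : sin eta @[eta --> 0^'+] --> (0 : R).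
  by rewrite -[X in _ --> X]sin0; apply: cvg_right0; exact: continuous_sin.
near=> eta.
have [e1 e2 sp ce] : [/\ 0 < eta, eta < pi, 0 < sin eta & cos eta != 1] by near: eta; exact: cosN1_near.
have se : sin eta <= e / (M / m * (v - u) + 1) by near: eta; apply: (cvgr_le _ s0); exact: divr_gt0.
have ckl := continuous_kapLt ce.
have B1 : `|Int u v (fun s => kap s * logdist_t sg s eta)| <= M / m * sin eta * (v - u).
  apply: Int_norm_le => // s hs.
  have nm : m <= dist2 sg s eta.
    rewrite dist2E; apply: le_trans (Hm s hs) _; rewrite lerDl.
    by rewrite !mulr_ge0 ?subr_ge0 ?expR_ge0 ?cos_le1.
  have n0 : 0 < dist2 sg s eta := lt_le_trans m0 nm.
  have -> : kap s * logdist_t sg s eta = kap s * (expR s * V) * (sin eta / dist2 sg s eta).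
    by rewrite /logdist_t; ring.
  rewrite normrM -(mulrA M); apply: ler_pM => //; first exact: HM.
  rewrite ger0_norm; last by rewrite divr_ge0 ?(ltW sp) ?(ltW n0).
  by rewrite (mulrC (sin eta)); apply: ler_wpM2r; [exact: ltW|rewrite lef_pV2 ?posrE].
apply: le_trans B1 _; move: se; rewrite ler_pdivlMr // mulrDr mulr1.
rewrite (_ : M / m * sin eta * (v - u) = sin eta * (M / m * (v - u))); last by ring.
lra.
Unshelve. all: by end_near. Qed.

(** The angle, measured from the normal to the real axis, under which [e^s] is seen from the pole
    [e^(sg + i eta)]; it is a primitive of [logdist_t] in [s]. *)
Definition atan_arg s eta := atan ((expR s / V - cos eta) / sin eta).

Lemma Int_logdist_t u v eta : 0 < sin eta -> Int u v (fun s => logdist_t sg s eta) = atan_arg v eta - atan_arg u eta.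
Proof.
move=> s0.
have V0 : 0 < V := expR_gt0 sg.
have H s : is_derive s 1 (fun s => atan_arg s eta) (logdist_t sg s eta).
  have d1 : is_derive s 1 (fun s => (expR s / V - cos eta) / sin eta) (expR s / V / sin eta).
    have D := is_deriveZ (sin eta)^-1 (is_deriveB (is_deriveZ V^-1 (is_derive_expR s)) (is_derive_cst (cos eta) s (1 : R))).
    have -> : (fun s => (expR s / V - cos eta) / sin eta) =
      (sin eta)^-1 \*: ((V^-1 \*: (@expR R)) - cst (cos eta)).
      by apply/funext => x; rewrite /GRing.scale /= mulrC (mulrC _ V^-1).
    by apply: is_derive_eq D _; rewrite /GRing.scale /=; ring.
  apply: is_derive_eq (is_derive1_comp (is_derive1_atan _) d1) _.
  have n0 : 0 < dist2 sg s eta.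
    rewrite (_ : dist2 sg s eta = (expR s - V * cos eta) ^+ 2 + V ^+ 2 * sin eta ^+ 2); last first.
      have -> : sin eta ^+ 2 = 1 - cos eta ^+ 2 by rewrite -(cos2Dsin2 eta); ring.
      by rewrite /dist2; ring.
    by rewrite ltr_wpDl ?sqr_ge0 // mulr_gt0 // exprn_gt0.
  have q0 : 1 + ((expR s / V - cos eta) / sin eta) ^+ 2 = dist2 sg s eta / (V ^+ 2 * sin eta ^+ 2).
    rewrite (_ : dist2 sg s eta = (expR s - V * cos eta) ^+ 2 + V ^+ 2 * sin eta ^+ 2); last first.
      have -> : sin eta ^+ 2 = 1 - cos eta ^+ 2 by rewrite -(cos2Dsin2 eta); ring.
      by rewrite /dist2; ring.
    by field; rewrite !lt0r_neq0.
  by rewrite q0 /logdist_t; field; rewrite !lt0r_neq0.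
exact: IntE.
Qed.

Lemma atan_arg_right d : 0 < d -> atan_arg (sg + d) eta @[eta --> 0^'+] --> (pi / 2 : R).
Proof.
move=> d0; have V0 : 0 < V := expR_gt0 sg.
have c : expR d - cos eta @[eta --> 0^'+] --> expR d - 1.
  apply: cvgB; first exact: cvg_cst.
  by rewrite -[X in _ --> X]cos0; apply: cvg_right0; exact: continuous_cos.
have l0 : 0 < expR d - 1 by rewrite subr_gt0 -expR0 ltr_expR.
have H : atan ((expR d - cos eta) / sin eta) @[eta --> 0^'+] --> (pi / 2 : R).
  exact: (cvg_comp _ _ (cvg_div_sin l0 c) (@cvgy_atan R)).
apply: cvg_trans H; apply: near_eq_cvg; apply: nearW => eta /=.
by rewrite /atan_arg expRD [V * _]mulrC mulfK // lt0r_neq0.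
Qed.

Lemma atan_arg_left d : 0 < d -> atan_arg (sg - d) eta @[eta --> 0^'+] --> (- (pi / 2) : R).
Proof.
move=> d0; have V0 : 0 < V := expR_gt0 sg.
have c : cos eta - expR (- d) @[eta --> 0^'+] --> 1 - expR (- d).
  apply: cvgB; last exact: cvg_cst.
  by rewrite -[X in _ --> X]cos0; apply: cvg_right0; exact: continuous_cos.
have l0 : 0 < 1 - expR (- d) by rewrite subr_gt0 -expR0 ltr_expR oppr_lt0.
have H : - atan ((cos eta - expR (- d)) / sin eta) @[eta --> 0^'+] --> (- (pi / 2) : R).
  by apply: cvgN; exact: (cvg_comp _ _ (cvg_div_sin l0 c) (@cvgy_atan R)).
apply: cvg_trans H; apply: near_eq_cvg; apply: nearW => eta /=.
by rewrite /atan_arg expRD [V * _]mulrC mulfK ?lt0r_neq0 // -atanN -mulNr opprB.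
Qed.

(** As [eta] tends to 0, [logdist_t] acts as a point mass [pi] at [sg]: away from [sg] it tends to
    0, and across [sg] the angle [atan_arg] runs from [- pi / 2] to [pi / 2]. *)
Lemma logpot_t_limit x1 x2 : x1 <= x2 -> x1 != sg -> x2 != sg ->
  logpot_t p sg A B x1 x2 eta @[eta --> 0^'+] --> pi * (if x1 < sg < x2 then kap sg else 0).
Proof.
move=> x12 h1 h2; case: ifPn => [/andP[s1 s2]|hs]; last first.
  rewrite mulr0; apply: logdist_t_outer => //.
  move: hs; rewrite negb_and -!leNgt => /orP[h|h]; [right|left].
    by rewrite lt_neqAle eq_sym h1.
  by rewrite lt_neqAle h2.
have pi0 := @pi_gt0 R.
apply/cvgrPdist_le => e e0.
(* The mass of [logdist_t] is at most [pi], so that replacing [kap] by [kap sg] near [sg] costs at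
   most [e / 4]. *)
have e1 : 0 < e / (4 * pi) by rewrite divr_gt0 // mulr_gt0.
have [d [d0 dl dr dk]] : exists d, [/\ 0 < d, x1 <= sg - d, sg + d <= x2 &
    forall s, sg - d <= s <= sg + d -> `|kap s - kap sg| <= e / (4 * pi)].
  have /cvgrPdist_le/(_ _ e1) := @continuous_kap R p A B sg.
  move=> /nbhs_ballP[d /= d0 Hd].
  exists (Num.min (d / 2) (Num.min (sg - x1) (x2 - sg))).
  have m0 : 0 < Num.min (d / 2) (Num.min (sg - x1) (x2 - sg)).
    by rewrite !lt_min !subr_gt0 s1 s2 divr_gt0.
  have m1 : Num.min (d / 2) (Num.min (sg - x1) (x2 - sg)) <= d / 2 by rewrite ge_min lexx.
  have m2 : Num.min (d / 2) (Num.min (sg - x1) (x2 - sg)) <= sg - x1 by rewrite !ge_min lexx orbT.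
  have m3 : Num.min (d / 2) (Num.min (sg - x1) (x2 - sg)) <= x2 - sg by rewrite !ge_min lexx !orbT.
  split; [by []|lra|lra|] => s hs; rewrite distrC; apply: Hd.
  by rewrite /ball /= ltr_norml; lra.
have sgd : sg - d <= sg + d by lra.
have o1 := logdist_t_outer dl (or_introl (ltac:(lra) : sg - d < sg)).
have o2 := logdist_t_outer dr (or_intror (ltac:(lra) : sg < sg + d)).
have e4 : 0 < e / 4 by rewrite divr_gt0.
have a0 : kap sg * (atan_arg (sg + d) eta - atan_arg (sg - d) eta) @[eta --> 0^'+] --> kap sg * pi.
  apply: cvgM; first exact: cvg_cst.
  have -> : (pi : R) = pi / 2 - - (pi / 2) by rewrite opprK -splitr.
  by apply: cvgB; [exact: atan_arg_right|exact: atan_arg_left].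
near=> eta.
have [k1 k2 sp ce] : [/\ 0 < eta, eta < pi, 0 < sin eta & cos eta != 1] by near: eta; exact: cosN1_near.
have ckl := continuous_kapLt ce.
have b1 : `|Int x1 (sg - d) (fun s => kap s * logdist_t sg s eta)| <= e / 4.
  by near: eta; have /cvgr0Pnorm_le/(_ _ e4) := o1.
have b2 : `|Int (sg + d) x2 (fun s => kap s * logdist_t sg s eta)| <= e / 4.
  by near: eta; have /cvgr0Pnorm_le/(_ _ e4) := o2.
have b3 : `|kap sg * pi - kap sg * (atan_arg (sg + d) eta - atan_arg (sg - d) eta)| <= e / 4.
  by near: eta; have /cvgrPdist_le/(_ _ e4) := a0.
have cL := continuous_logdist_t1 (sg := sg) ce.
have b4 : `|Int (sg - d) (sg + d) (fun s => (kap s - kap sg) * logdist_t sg s eta)| <= e / 4.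
  have L0 s : 0 <= logdist_t sg s eta.
    rewrite /logdist_t divr_ge0 ?mulr_ge0 ?expR_ge0 ?(ltW sp) //.
    by apply/ltW/dist2_gt0; right.
  have kb : Int (sg - d) (sg + d) (fun s => e / (4 * pi) * logdist_t sg s eta) <= e / 4.
    rewrite IntZ // Int_logdist_t //.
    have ab : atan_arg (sg + d) eta - atan_arg (sg - d) eta <= pi.
      have := atan_ltpi2 ((expR (sg + d) / V - cos eta) / sin eta).
      have := atan_gtNpi2 ((expR (sg - d) / V - cos eta) / sin eta).
      by rewrite /atan_arg; lra.
    apply: le_trans (ler_wpM2l (ltW e1) ab) _.
    by rewrite invfM mulrA mulfVK ?lt0r_neq0.
  have cg : continuous (fun s => (kap s - kap sg) * logdist_t sg s eta).
    move=> s; apply: cvgM; last exact: cL.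
    by apply: cvgB; [exact: continuous_kap|exact: cvg_cst].
  have ce1 : continuous (fun s => e / (4 * pi) * logdist_t sg s eta).
    by move=> s; apply: cvgM; [exact: cvg_cst|exact: cL].
  have ce2 : continuous (fun s => - (e / (4 * pi)) * logdist_t sg s eta).
    by move=> s; apply: cvgM; [exact: cvg_cst|exact: cL].
  have kb' : - (e / 4) <= Int (sg - d) (sg + d) (fun s => - (e / (4 * pi)) * logdist_t sg s eta).
    by rewrite IntZ // mulNr lerN2 -IntZ.
  rewrite ler_norml; apply/andP; split.
    apply: le_trans kb' _; apply: Int_le => // s hs.
    by apply: ler_wpM2r => //; have := dk s hs; rewrite ler_norml => /andP[].
  apply: le_trans kb; apply: Int_le => // s hs.
  by apply: ler_wpM2r => //; have := dk s hs; rewrite ler_norml => /andP[].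
have E : logpot_t p sg A B x1 x2 eta = Int x1 (sg - d) (fun s => kap s * logdist_t sg s eta) +
   (Int (sg - d) (sg + d) (fun s => (kap s - kap sg) * logdist_t sg s eta) +
    kap sg * (atan_arg (sg + d) eta - atan_arg (sg - d) eta)) +
   Int (sg + d) x2 (fun s => kap s * logdist_t sg s eta).
  rewrite /logpot_t (Int_cat (sg - d)) (Int_cat (sg + d) (sg - d)) -Int_logdist_t // -IntZ // -IntD.
  - rewrite addrA; congr (_ + _ + _); congr Int; apply/funext => s; ring.
  - move=> s; apply: cvgM; last exact: cL.
    by apply: cvgB; [exact: continuous_kap|exact: cvg_cst].
  - by move=> s; apply: cvgM; [exact: cvg_cst|exact: cL].
move: b1 b2 b3 b4; rewrite E !ler_norml => /andP[? ?] /andP[? ?] /andP[? ?] /andP[? ?].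
by apply/andP; split; lra.
Unshelve. all: by end_near. Qed.
End piece.
End Jump.

(** * The potential over several periods *)

Section KernelSum.
Context {R : realType}.
Variables (p sg A B x1 x2 : R).
Hypotheses (p0 : 0 < p) (x12 : x1 <= x2) (sg1 : x1 != sg) (sg2 : x2 != sg).
Implicit Types (s t u y : R) (b f : R -> R).
Local Notation bdryf := (bdry p sg A B x1 x2).
Local Notation logpotf := (logpot p sg A B x1 x2).
Local Notation twopi := ((pi : R) *+ 2).

Lemma continuous_cosM (c : R) : continuous (fun u => cos (c * u)).
Proof.
move=> x; apply: (@continuous_comp _ _ _ (fun u => c * u) cos); last exact: continuous_cos.
by apply: cvgM; [exact: cvg_cst|exact: cvg_id].
Qed.

Lemma continuous_sinM (c : R) : continuous (fun u => sin (c * u)).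
Proof.
move=> x; apply: (@continuous_comp _ _ _ (fun u => c * u) sin); last exact: continuous_sin.
by apply: cvgM; [exact: cvg_cst|exact: cvg_id].
Qed.

Lemma continuousM2 f g : continuous f -> continuous g -> continuous (fun u => f u * g u).
Proof. by move=> cf cg x; apply: cvgM; [exact: cf|exact: cg]. Qed.

Lemma continuous_subr f y : continuous f -> continuous (fun u => f (y - u)).
Proof.
move=> cf x; apply: (@continuous_comp _ _ _ (fun u => y - u) f); last exact: cf.
by apply: cvgB; [exact: cvg_cst|exact: cvg_id].
Qed.

Lemma continuous_oppr f : continuous f -> continuous (fun u => f (- u)).
Proof.
move=> cf x; apply: (@continuous_comp _ _ _ (fun u => - u) f); last exact: cf.
by apply: cvgN; exact: cvg_id.
Qed.

Lemma Int_cos_sub b a y : continuous b ->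
  Int a y (fun u => b u * cos (p * (y - u))) =
  cos (p * y) * Int a y (fun u => b u * cos (p * u)) + sin (p * y) * Int a y (fun u => b u * sin (p * u)).
Proof.
move=> cb; have c1 := continuousM2 cb (@continuous_cosM p); have c2 := continuousM2 cb (@continuous_sinM p).
rewrite -!IntZ // -IntD; first by congr Int; apply/funext => u; rewrite mulrBr cosB; ring.
  by apply: continuousM2 => //; exact: cst_continuous.
by apply: continuousM2 => //; exact: cst_continuous.
Qed.

Lemma continuous_Int a f : continuous f -> continuous (fun y => Int a y f).
Proof.
move=> cf x; apply: cvgB; last exact: cvg_cst.
exact: is_derive_continuous (is_derive_primitive cf) x.
Qed.

(* The jump of [logpot'] at the multiples of [2 pi], the contribution of the
   pole. *)
Definition jump := 2 * (p * logpotf pi * sin (p * pi) + Int 0 pi (fun u => bdryf u * cos (p * u))).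

(** The formula of [logpot_t_period0] extends continuously to [y = 0], where its value [g 0] is half
    of [jump]; [logpot_t_limit] computes the same limit from the arctangent. *)
Lemma jumpE : jump = pi *+ 2 * (if x1 < sg < x2 then kap p A B sg else 0).
Proof.
have cb : continuous bdryf := @continuous_bdry _ p _ A B _ _ sg1 sg2.
have c1 := continuousM2 cb (@continuous_cosM p); have c2 := continuousM2 cb (@continuous_sinM p).
pose g y := - (p * logpotf pi * sin (p * (y - pi))) - (cos (p * y) * Int pi y (fun u => bdryf u * cos (p * u)) +
   sin (p * y) * Int pi y (fun u => bdryf u * sin (p * u))).
have cg : continuous g.
  move=> y; apply: cvgB.
    apply: cvgN; apply: cvgM; first exact: cvg_cst.
    apply: (@continuous_comp _ _ _ (fun y => p * (y - pi)) sin); last exact: continuous_sin.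
    by apply: cvgM; [exact: cvg_cst|apply: cvgB; [exact: cvg_id|exact: cvg_cst]].
  by apply: cvgD; apply: cvgM; [exact: continuous_cosM|exact: continuous_Int|exact: continuous_sinM|exact: continuous_Int].
have H1 : g eta @[eta --> 0^'+] --> pi * (if x1 < sg < x2 then kap p A B sg else 0).
  have L := @logpot_t_limit R p sg A B x1 x2 x12 sg1 sg2.
  apply: cvg_trans L; apply: near_eq_cvg.
  near=> eta; rewrite /g -Int_cos_sub // logpot_t_period0 //.
  apply/andP; split; first by near: eta; exact: nbhs_right_gt.
  by near: eta; apply: nbhs_right_lt; exact: twopi_gt0.
have H2 := cvg_right0 (cg 0).
have E := cvg_unique (@Rhausdorff R) H1 H2.
rewrite -mulr_natl -mulrA E /g.
rewrite mulr0 cos0 sin0 sub0r mulrN sinN (Int_sym 0 pi) /jump.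
by ring.
Unshelve. all: by end_near. Qed.

Lemma dist2_cos s y y' : cos y = cos y' -> dist2 sg s y = dist2 sg s y'.
Proof. by rewrite /dist2 => ->. Qed.

Lemma bdry_cos y y' : cos y = cos y' -> bdryf y = bdryf y'.
Proof. by move=> cy; rewrite /bdry /logdist /logdist_s !(dist2_cos _ cy) cy. Qed.

Lemma logpot_cos y y' : cos y = cos y' -> logpotf y = logpotf y'.
Proof. by move=> cy; congr Int; apply/funext => s; rewrite /logdist (dist2_cos _ cy). Qed.

(** The expression that equals [p logpot] on [(0, 2 pi)], now for all [y]: the solution continued
    through the multiples of [2 pi] as if there were no pole. *)
Definition logpot_reg y := p * logpotf pi * cos (p * (y - pi)) - Int pi y (fun u => bdryf u * sin (p * (y - u))).

(** The base point of the integral moves by one period. As [bdry] is even with period [2 pi], the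
    integral over [[pi, 3 pi]] folds to one over [[0, pi]], in which [sin (p tau)] multiplies the
    cosine integral that occurs in [jump]. *)
Lemma logpot_reg_shift t : logpot_reg (t - twopi) = logpot_reg t + jump * sin (p * (t - twopi)).
Proof.
have cb : continuous bdryf := @continuous_bdry _ p _ A B _ _ sg1 sg2.
set tau := t - twopi.
have tE : t = tau + twopi by rewrite /tau subrK.
have cs y : continuous (fun u => sin (p * (y - u))) := @continuous_subr _ y (@continuous_sinM p).
have h1 : Int pi tau (fun u => bdryf u * sin (p * (tau - u))) =
    Int (pi + twopi) (tau + twopi) (fun u => bdryf u * sin (p * (t - u))).
  rewrite Int_shift; last exact: continuousM2.
  congr Int; apply/funext => u; rewrite (@bdry_cos (u + twopi) u) ?cosD2pi //.
  by congr (_ * sin (_ * _)); rewrite tE; ring.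
have h2 : Int pi (pi + twopi) (fun u => bdryf u * sin (p * (t - u))) =
   2 * sin (p * tau) * Int 0 pi (fun u => bdryf u * cos (p * u)).
  have {1}-> : (pi : R) = - pi + twopi by rewrite mulr2n; lra.
  rewrite Int_shift; last exact: continuousM2.
  have -> : (fun u => bdryf (u + twopi) * sin (p * (t - (u + twopi)))) = (fun u => bdryf u * sin (p * (tau - u))).
    apply/funext => u; rewrite (@bdry_cos (u + twopi) u) ?cosD2pi //.
    by congr (_ * sin (_ * _)); rewrite tE; ring.
  have cf := continuousM2 cb (cs tau).
  rewrite (Int_cat 0) -{1}oppr0 Int_opp // -IntD //; last first.
    exact: (continuous_oppr cf).
  rewrite -IntZ; last by apply: continuousM2 => //; exact: continuous_cosM.
  congr Int; apply/funext => u; rewrite (@bdry_cos (- u) u) ?cosN //.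
  by rewrite opprK mulrBr mulrDr sinB sinD; ring.
rewrite /logpot_reg h1 -tE.
have := Int_cat (pi + twopi) pi t (fun u => bdryf u * sin (p * (t - u))); rewrite h2 => ->.
have e1 : p * (tau - pi) = p * tau - p * pi by ring.
have e2 : p * (t - pi) = p * tau + p * pi by rewrite tE mulr2n; ring.
by rewrite e1 e2 cosB cosD /jump; ring.
Qed.

(** [logpot] has period [2 pi] whereas [logpot_reg] need not have it; by [logpot_reg_shift] every
    period of the argument costs one sine. *)
Lemma logpot_period m y : twopi * m%:R < y < twopi * m.+1%:R ->
  p * logpotf y = logpot_reg y + jump * \sum_(j < m) sin (p * (y - twopi * j.+1%:R)).
Proof.
elim: m y => [|m IH] y.
  by rewrite mulr0 mulr1 big_ord0 mulr0 addr0 => hy; exact: logpot_period0.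
move=> hy; have hy' : twopi * m%:R < y - twopi < twopi * m.+1%:R.
  by move: hy; rewrite -[m.+2%:R]natr1 -[m.+1%:R]natr1 !mulrDr !mulr1; lra.
rewrite (@logpot_cos y (y - twopi)); last by rewrite -[in LHS](subrK twopi y) cosD2pi.
rewrite (IH _ hy') logpot_reg_shift big_ord_recl /= mulr1 -addrA -mulrDr; congr (_ + _ * (_ + _)).
apply: eq_bigr => j _; congr (sin (_ * _)).
by rewrite /bump /= add1n -[j.+2%:R]natr1; ring.
Qed.
End KernelSum.

(** * The test function of balanced weights *)

Section TestFunction.
Context {R : realType}.
Variables (p t0 : R) (n : nat) (w t : 'I_n -> R).
Hypotheses (p0 : 0 < p) (w0 : forall i, 0 <= w i) (w1 : \sum_i w i = 1).
Hypotheses (bc : \sum_i w i * cos (p * t i) = 0) (bs : \sum_i w i * sin (p * t i) = 0).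
Implicit Types (x y z u a T : R) (f : R -> R).
Local Notation twopi := ((pi : R) *+ 2).

Definition sinp y := sin (p * Num.max 0 y).
Definition phi z := \sum_i w i * sinp (t i - z).
(* The angles [t i] lie in an interval of length [2 pi / p < 4 pi], so that a
   zero of argument [x] in [[t0 - 2 pi, t0)] meets the support of [phi] at most at
   [x], [x + 2 pi] and [x + 4 pi]. *)
Definition Phi3 x := phi x + phi (x + twopi) + phi (x + twopi *+ 2).

Lemma sinp_pos y : 0 <= y -> sinp y = sin (p * y).
Proof. by move=> y0; rewrite /sinp (max_idPr y0). Qed.

Lemma sinp_neg y : y <= 0 -> sinp y = 0.
Proof. by move=> y0; rewrite /sinp (max_idPl y0) mulr0 sin0. Qed.

Lemma sin_lipschitz x y : `|sin x - sin y| <= `|x - y|.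
Proof.
wlog yx : x y / y <= x.
  by move=> H; case: (leP y x) => [/H//|/ltW/H]; rewrite distrC (distrC y).
have [|c _ ->] := @MVT_segment R sin cos y x yx (fun z _ => is_derive_sin z).
  by apply: continuous_subspaceT; exact: continuous_sin.
rewrite normrM ler_piMl // ler_norml; have := cos_le1 c; have := cos_geN1 c; lra.
Qed.

Lemma sinp_lipschitz x y : `|sinp x - sinp y| <= p * `|x - y|.
Proof.
apply: le_trans (sin_lipschitz _ _) _; rewrite -mulrBr normrM gtr0_norm //.
apply: ler_wpM2l; first exact: ltW.
wlog xy : x y / x <= y.
  by move=> H; case: (leP x y) => [/H//|/ltW/H]; rewrite distrC (distrC y).
rewrite [leRHS]ler0_norm ?subr_le0 // ler_norml !maxEle.
by case: (leP 0 x) => ? /=; case: (leP 0 y) => ? /=; apply/andP; split; lra.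
Qed.

Lemma phi_lipschitz x y : `|phi x - phi y| <= p * `|x - y|.
Proof.
rewrite /phi -sumrB; apply: le_trans (ler_norm_sum _ _ _) _.
rewrite -[leRHS]mul1r -w1 mulr_suml; apply: ler_sum => i _.
rewrite -mulrBr normrM ger0_norm //; apply: ler_wpM2l => //.
by apply: le_trans (sinp_lipschitz _ _) _; rewrite opprB addrC subrKA distrC.
Qed.

Lemma continuous_sinp : continuous sinp.
Proof. exact: lipschitz_continuous sinp_lipschitz. Qed.

Lemma continuous_phi : continuous phi.
Proof. exact: lipschitz_continuous phi_lipschitz. Qed.

Lemma Phi3_lipschitz x y : `|Phi3 x - Phi3 y| <= 3 * p * `|x - y|.
Proof.
have h1 := phi_lipschitz x y; have h2 := phi_lipschitz (x + twopi) (y + twopi).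
have h3 := phi_lipschitz (x + twopi *+ 2) (y + twopi *+ 2).
have e2 (k : R) : x + k - (y + k) = x - y by ring.
rewrite !e2 in h2 h3.
have -> : Phi3 x - Phi3 y = (phi x - phi y) + (phi (x + twopi) - phi (y + twopi)) + (phi (x + twopi *+ 2) - phi (y + twopi *+ 2)).
  by rewrite /Phi3; ring.
apply: le_trans (ler_normD _ _) _; apply: le_trans (lerD (ler_normD _ _) (lexx _)) _; lra.
Qed.

Lemma balanced_sin z : \sum_i w i * sin (p * (t i - z)) = 0.
Proof.
transitivity (cos (p * z) * (\sum_i w i * sin (p * t i)) - sin (p * z) * (\sum_i w i * cos (p * t i))).
  rewrite !mulr_sumr -sumrB; apply: eq_bigr => i _; rewrite mulrBr sinB; ring.
by rewrite bs bc !mulr0 subrr.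
Qed.

Lemma balanced_cos z : \sum_i w i * cos (p * (t i - z)) = 0.
Proof.
transitivity (cos (p * z) * (\sum_i w i * cos (p * t i)) + sin (p * z) * (\sum_i w i * sin (p * t i))).
  rewrite !mulr_sumr -big_split; apply: eq_bigr => i _; rewrite mulrBr cosB /=; ring.
by rewrite bs bc !mulr0 addr0.
Qed.

(** To the left of all the angles the cut-off sines are full sinusoids, whose weighted sum is 0. *)
Lemma phi_left z : (forall i, z <= t i) -> phi z = 0.
Proof.
move=> h; rewrite -(balanced_sin z); apply: eq_bigr => i _.
by rewrite sinp_pos // subr_ge0.
Qed.

(* As the full sinusoid sum vanishes, [phi] is also the sum of the
   positive parts taken from the other side; on each half of an interval of
   length [2 pi / p] one of the two expressions has nonnegative terms. *)
Lemma phi_ge0 z : (forall i, t0 <= t i <= t0 + twopi / p) -> 0 <= phi z.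
Proof.
move=> h; have sin_ge0 x : 0 <= x <= pi / p -> 0 <= sin (p * x).
  move=> /andP[x0 xp]; apply: sin_ge0_pi; rewrite mulr_ge0 ?(ltW p0) //=.
  by rewrite mulrC -ler_pdivlMr.
have pip : twopi / p = pi / p + pi / p by rewrite mulr2n mulrDl.
have [zt|zt] := leP (t0 + pi / p) z.
  apply: sumr_ge0 => i _; apply: mulr_ge0 => //.
  have [h1|h1] := leP 0 (t i - z); last by rewrite sinp_neg // ltW.
  by rewrite sinp_pos //; apply: sin_ge0; rewrite h1 /=; have := h i; rewrite pip; lra.
have -> : phi z = \sum_i w i * sinp (z - t i).
  transitivity (phi z - \sum_i w i * sin (p * (t i - z))); first by rewrite balanced_sin subr0.
  rewrite /phi -sumrB; apply: eq_bigr => i _.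
  rewrite -mulrBr; congr (_ * _).
  have [h1|h1] := leP 0 (t i - z).
    by rewrite sinp_pos // subrr sinp_neg //; lra.
  rewrite sinp_neg ?sinp_pos; [|lra|lra].
  by rewrite sub0r -sinN; congr sin; ring.
apply: sumr_ge0 => i _; apply: mulr_ge0 => //.
have [h1|h1] := leP 0 (z - t i); last by rewrite sinp_neg // ltW.
by rewrite sinp_pos //; apply: sin_ge0; rewrite h1 /=; have := h i; lra.
Qed.

Lemma sin_p_primitive a y : Int a y (fun z => sin (p * (y - z))) = (1 - cos (p * (y - a))) / p.
Proof.
have H z : is_derive z 1 (fun z => cos (p * (y - z)) / p) (sin (p * (y - z))).
  have D := is_deriveZ p^-1 (is_derive_cos_sub p y z).
  have -> : (fun z => cos (p * (y - z)) / p) = p^-1 \*: (fun z => cos (p * (y - z))).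
    by apply/funext => x /=; rewrite /GRing.scale /= mulrC.
  by apply: is_derive_eq D _; rewrite /GRing.scale /= mulrA mulVf ?mul1r // lt0r_neq0.
by rewrite (IntE _ _ H) subrr mulr0 cos0 mulrBl.
Qed.

Lemma Int_sinp a T y f : continuous f -> a <= y -> y <= T ->
  Int a T (fun z => f z * sinp (y - z)) = Int a y (fun z => f z * sin (p * (y - z))).
Proof.
move=> cf ay yT.
have c1 : continuous (fun z => f z * sinp (y - z)).
  by apply: continuousM2 => //; exact: (@continuous_subr _ _ y continuous_sinp).
have c2 : continuous (fun z => f z * sin (p * (y - z))).
  by apply: continuousM2 => //; exact: (@continuous_subr _ _ y (@continuous_sinM R p)).
rewrite (Int_cat y) (@eq_Int _ y T _ (fun=> 0)) //.
- rewrite Int_cst mul0r addr0; apply: eq_Int => // z /andP[_ zy].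
  by rewrite sinp_pos // subr_ge0.
- exact: cst_continuous.
- by move=> z /andP[yz _]; rewrite sinp_neg ?mulr0 // subr_le0.
Qed.

Lemma Int_phi f a T : continuous f -> (forall i, a <= t i <= T) ->
  Int a T (fun z => f z * phi z) = \sum_i w i * Int a (t i) (fun z => f z * sin (p * (t i - z))).
Proof.
move=> cf h.
have -> : (fun z => f z * phi z) = (fun z => \sum_i w i * (f z * sinp (t i - z))).
  by apply/funext => z; rewrite /phi mulr_sumr; apply: eq_bigr => i _; ring.
have c i : continuous (fun z => f z * sinp (t i - z)).
  by apply: continuousM2 => //; exact: (@continuous_subr _ _ (t i) continuous_sinp).
rewrite Int_sum; last first.
  by move=> i; apply: continuousM2; [exact: cst_continuous|exact: c].
apply: eq_bigr => i _; rewrite IntZ //; congr (_ * _).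
by have /andP[h1 h2] := h i; exact: Int_sinp.
Qed.

(** The term of index [i] contributes [w i / p] minus a cosine, and the cosines are balanced. *)
Lemma Int_phi1 a T : (forall i, a <= t i <= T) -> Int a T phi = p^-1.
Proof.
move=> h; transitivity (Int a T (fun z => 1 * phi z)).
  by congr Int; apply/funext => z; rewrite mul1r.
rewrite (Int_phi (@cst_continuous R R 1) h).
transitivity (\sum_i (w i / p - p^-1 * (w i * cos (p * (t i - a))))).
  apply: eq_bigr => i _; rewrite -(_ : (fun z => sin (p * (t i - z))) = fun z => 1 * sin (p * (t i - z))).
    by rewrite sin_p_primitive; ring.
  by apply/funext => z; rewrite mul1r.
by rewrite sumrB -mulr_sumr balanced_cos mulr0 subr0 -mulr_suml w1 mul1r.
Qed.

Section kernel.
Variables (sg A B x1 x2 al : R).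
Hypotheses (x12 : x1 <= x2) (sg1 : x1 != sg) (sg2 : x2 != sg).
Hypotheses (ht : forall i, t0 <= t i < t0 + twopi *+ 2).
Hypotheses (hal : t0 - twopi *+ 2 <= al < t0 - twopi) (reg : forall i, cos (t i - al) != 1).
Local Notation bdry := (bdry p sg A B x1 x2).
Local Notation logpot := (logpot p sg A B x1 x2).
Local Notation jump := (jump p sg A B x1 x2).

(** Below [y < 8 pi] lie at most the multiples [2 pi], [4 pi], [6 pi]; the cut-off in [sinp]
    discards those not yet passed, so that the number of terms no longer depends on [y]. *)
Lemma logpot_sinp y : 0 <= y < twopi *+ 4 -> cos y != 1 ->
  p * logpot y = logpot_reg p sg A B x1 x2 y + jump * \sum_(j < 3) sinp (y - twopi * j.+1%:R).
Proof.
move=> /andP[y0 y8] cy; have pi2 := @twopi_gt0 R.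
pose m := Num.trunc (y / twopi).
have /andP[m1 m2] := @Num.Theory.trunc_itv R (y / twopi) (divr_ge0 y0 (ltW pi2)).
rewrite -/m ler_pdivlMr // in m1; rewrite -/m ltr_pdivrMr // in m2.
have m3 : twopi * m%:R < y.
  rewrite lt_neqAle mulrC m1 andbT; apply: contra_neq cy => <-.
  by have := congr1 (@complex.Re R) (@expi_periodic R 0 m); rewrite add0r /= cos0 mulrC.
have m4 : (m < 4)%N.
  have : m%:R * twopi < 4%:R * twopi by apply: le_lt_trans m1 _; rewrite mulr_natl.
  by rewrite ltr_pM2r // ltr_nat.
rewrite mulrC in m2.
rewrite (@logpot_period R p sg A B x1 x2 x12 sg1 sg2 m) ?m3 //; congr (_ + _ * _).
rewrite (big_ord_widen 3 (fun j : nat => sin (p * (y - twopi * j.+1%:R)))) //.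
rewrite big_mkcond; apply: eq_bigr => j _; case: ifPn => [jm|]; last rewrite -leqNgt => jm.
  rewrite sinp_pos // subr_ge0; apply: le_trans (ltW m3).
  by rewrite ler_pM2l // ler_nat.
rewrite sinp_neg // subr_le0; apply: le_trans (ltW m2) _.
by rewrite ler_pM2l // ler_nat ltnS.
Qed.

(** The weighted sum has three parts: the free solution in [logpot_reg] is balanced out, its
    integral against [bdry] cancels the second term by [Int_phi], and the sines of [logpot_sinp] add
    up to the values of [phi] at the lifts [al + 2 pi j] of the pole, [j = 1, 2, 3]. *)
Lemma kernel_sum :
  p * (\sum_i w i * logpot (t i - al)) + Int t0 (t0 + twopi *+ 2) (fun z => bdry (z - al) * phi z) =
  jump * Phi3 (al + twopi).
Proof.
have pi2 := @twopi_gt0 R.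
have pi2E : twopi = pi + pi by rewrite mulr2n.
have pi0 := @pi_gt0 R.
have cb : continuous bdry := @continuous_bdry R p sg A B x1 x2 sg1 sg2.
have cba : continuous (fun z => bdry (z - al)).
  by move=> x; apply: (@continuous_comp R R R (fun z => z - al) bdry); [apply: cvgB; [exact: cvg_id|exact: cvg_cst]|exact: cb].
have f2 : twopi *+ 2 = 2 * twopi by rewrite mulr_natl.
have f4 : twopi *+ 4 = 4 * twopi by rewrite mulr_natl.
have hy i : 0 <= t i - al < twopi *+ 4.
  have := ht i; move: hal pi2; rewrite f2 f4; move: twopi => P h1 h2 h3; lra.
have E i := logpot_sinp (hy i) (reg i).
have -> : p * (\sum_i w i * logpot (t i - al)) = \sum_i (w i * logpot_reg p sg A B x1 x2 (t i - al) +
   jump * (w i * \sum_(j < 3) sinp (t i - al - twopi * j.+1%:R))).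
  by rewrite mulr_sumr; apply: eq_bigr => i _; rewrite mulrCA E; ring.
rewrite big_split /= -mulr_sumr.
have -> : \sum_i w i * \sum_(j < 3) sinp (t i - al - twopi * j.+1%:R) = Phi3 (al + twopi).
  rewrite /Phi3 /phi -!big_split; apply: eq_bigr => i _.
  rewrite !big_ord_recl big_ord0 /= addr0 !mulrDr addrA.
  by congr (_ * sinp _ + _ * sinp _ + _ * sinp _); rewrite ?f2 /bump /=; ring.
rewrite addrAC -[RHS]add0r; congr (_ + _).
(* [phi] vanishes to the left of [t0], so that the integral may start at [pi + al], the base point
   of [logpot_reg]. *)
have c1 : pi + al <= t0 by move: hal; rewrite f2 pi2E => h; lra.
have cphi := continuous_phi.
have -> : Int t0 (t0 + twopi *+ 2) (fun z => bdry (z - al) * phi z) =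
   Int (pi + al) (t0 + twopi *+ 2) (fun z => bdry (z - al) * phi z).
  rewrite (Int_cat t0 (pi + al)) (@eq_Int _ (pi + al) t0 _ (fun=> 0)) ?Int_cst ?mul0r ?add0r //.
  - exact: continuousM2.
  - exact: cst_continuous.
  move=> z /andP[_ z0]; rewrite phi_left ?mulr0 // => i.
  by apply: le_trans z0 _; have /andP[] := ht i.
rewrite Int_phi //; last first.
  by move=> i; have /andP[h1 h2] := ht i; rewrite (le_trans c1 h1) ltW.
rewrite -big_split /=.
transitivity (p * logpot pi * \sum_i w i * cos (p * (t i - (al + pi)))).
  rewrite mulr_sumr; apply: eq_bigr => i _; rewrite /logpot_reg.
  have cs : continuous (fun z => sin (p * (t i - z))) := @continuous_subr _ _ (t i) (@continuous_sinM R p).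
  have -> : Int (pi + al) (t i) (fun z => bdry (z - al) * sin (p * (t i - z))) =
     Int pi (t i - al) (fun u => bdry u * sin (p * (t i - al - u))).
    rewrite -{1}(subrK al (t i)) Int_shift; last exact: continuousM2.
    congr Int; apply/funext => u; rewrite addrK; congr (_ * sin _); ring.
  rewrite (_ : t i - (al + pi) = t i - al - pi); last by ring.
  by ring.
by rewrite balanced_cos mulr0.
Qed.
End kernel.
End TestFunction.

(** * A Carleman-type bound for the zeros *)

Section TwoPieces.
Context {R : realType}.
Variables (p t0 : R) (n : nat) (w t : 'I_n -> R).
Hypotheses (p0 : 0 < p) (w0 : forall i, 0 <= w i) (w1 : \sum_i w i = 1).
Hypotheses (bc : \sum_i w i * cos (p * t i) = 0) (bs : \sum_i w i * sin (p * t i) = 0).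
Local Notation twopi := ((pi : R) *+ 2).
Local Notation phi := (phi p w t).
Local Notation Phi3 := (Phi3 p w t).
Hypotheses (ht : forall i, t0 <= t i < t0 + twopi *+ 2).
Variables (s0 s1 S : R).
Hypotheses (s01 : s0 < s1) (s1S : s1 < S).
Implicit Types (U V : R -> R -> R) (s y z : R).

(* [kap1] on [[s0, s1]] and [kap2] on [[s1, S]] are solutions of
   [kap'' = p^2 kap] that vanish at [s0] and [S] and agree at [s1]; the kink at
   [s1] has coefficient [- ccoef1 <= 0], so that only there is a lower bound of
   [log |f|] needed. *)
Definition kap2 s := expR (- (p * s)) - expR (p * s - 2 * p * S).
Definition kcoef := kap2 s1 / (expR (p * s1) - expR (2 * p * s0 - p * s1)).
Definition kap1 s := kcoef * (expR (p * s) - expR (2 * p * s0 - p * s)).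

Definition kA1 := kcoef.
Definition kB1 := - kcoef * expR (2 * p * s0).
Definition kA2 := - expR (- (2 * p * S)).

Lemma kap1E s : kap p kA1 kB1 s = kap1 s.
Proof. by rewrite /kap /kap1 /kA1 /kB1 expRD; ring. Qed.

Lemma kap2E s : kap p kA2 1 s = kap2 s.
Proof. by rewrite /kap /kap2 /kA2 expRD; ring. Qed.

Lemma kden_gt0 : 0 < expR (p * s1) - expR (2 * p * s0 - p * s1).
Proof.
rewrite subr_gt0 ltr_expR; have : 0 < p * (s1 - s0) by rewrite mulr_gt0 ?subr_gt0.
lra.
Qed.

Lemma kap1_s0 : kap1 s0 = 0.
Proof.
rewrite /kap1 (_ : 2 * p * s0 - p * s0 = p * s0); last by ring.
by rewrite subrr mulr0.
Qed.

Lemma kap1_s1 : kap1 s1 = kap2 s1.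
Proof. by rewrite /kap1 /kcoef divfK // lt0r_neq0 // kden_gt0. Qed.

Lemma kap2_S : kap2 S = 0.
Proof.
rewrite /kap2 (_ : p * S - 2 * p * S = - (p * S)); last by ring.
by rewrite subrr.
Qed.

Lemma kap2_ge0 s : s <= S -> 0 <= kap2 s.
Proof.
move=> sS; rewrite /kap2 subr_ge0 ler_expR.
have : 0 <= p * (S - s) by rewrite mulr_ge0 ?subr_ge0 // ltW.
lra.
Qed.

Lemma kap2_le s : kap2 s <= expR (- (p * s)).
Proof. by rewrite /kap2 gerBl expR_ge0. Qed.

Lemma kcoef_ge0 : 0 <= kcoef.
Proof. by apply: divr_ge0; [apply: kap2_ge0; exact: ltW|apply/ltW/kden_gt0]. Qed.

Lemma kap1_bounds s : s0 <= s <= s1 -> 0 <= kap1 s <= expR (- (p * s1)).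
Proof.
move=> /andP[h1 h2]; have k0 := kcoef_ge0; apply/andP; split.
  rewrite /kap1 mulr_ge0 // subr_ge0 ler_expR.
  have : 0 <= p * (s - s0) by rewrite mulr_ge0 ?subr_ge0 // ltW.
  lra.
apply: le_trans (kap2_le s1); rewrite -kap1_s1; apply: ler_wpM2l => //.
have : 0 <= p * (s1 - s) by rewrite mulr_ge0 ?subr_ge0 // ltW.
by move=> h; apply: lerB; rewrite ler_expR; lra.
Qed.

(** The second derivative of the piecewise [kap], extended by 0, has the point masses [ccoef0],
    [- ccoef1], [ccoef2] at [s0], [s1], [S]. The [s]-derivatives of [V] are absent from [green],
    since [kap] vanishes at the ends and is continuous at [s1]. *)
Definition ccoef0 := dkap p kA1 kB1 s0.
Definition ccoef1 := dkap p kA1 kB1 s1 - dkap p kA2 1 s1.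
Definition ccoef2 := - dkap p kA2 1 S.

(* The Laplacian of [V] tested against [kap(s) phi(th)]. *)
Definition green V := p * (\sum_i w i * (Int s0 s1 (fun s => kap1 s * V s (t i)) + Int s1 S (fun s => kap2 s * V s (t i)))) +
  Int t0 (t0 + twopi *+ 2) (fun z => (ccoef0 * V s0 z - ccoef1 * V s1 z + ccoef2 * V S z) * phi z).

Definition regular_sections V := (forall i, continuous (fun s => V s (t i))) /\
  [/\ continuous (V s0), continuous (V s1) & continuous (V S)].

Lemma continuous_kap1 : continuous kap1.
Proof. by rewrite -(funext kap1E); exact: continuous_kap. Qed.

Lemma continuous_kap2 : continuous kap2.
Proof. by rewrite -(funext kap2E); exact: continuous_kap. Qed.

Lemma continuous_ccoefs V : regular_sections V -> continuous (fun z => (ccoef0 * V s0 z - ccoef1 * V s1 z + ccoef2 * V S z) * phi z).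
Proof.
move=> [_ [c1 c2 c3]]; apply: continuousM2; last exact: continuous_phi.
move=> z; apply: cvgD; first apply: cvgB.
- by apply: cvgM; [exact: cvg_cst|exact: c1].
- by apply: cvgM; [exact: cvg_cst|exact: c2].
- by apply: cvgM; [exact: cvg_cst|exact: c3].
Qed.

Lemma green_add U V : regular_sections U -> regular_sections V -> green (fun s z => U s z + V s z) = green U + green V.
Proof.
move=> oU oV; have cU := continuous_ccoefs oU; have cV := continuous_ccoefs oV.
rewrite /green [RHS]addrACA -mulrDr -big_split /= -(IntD _ _ cU cV); congr (_ * _ + _).
  apply: eq_bigr => i _; rewrite -mulrDr [in RHS]addrACA; congr (_ * _).
  have c1 W : regular_sections W -> continuous (fun s => kap1 s * W s (t i)).
    by move=> [h _]; apply: continuousM2; [exact: continuous_kap1|exact: h].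
  have c2 W : regular_sections W -> continuous (fun s => kap2 s * W s (t i)).
    by move=> [h _]; apply: continuousM2; [exact: continuous_kap2|exact: h].
  rewrite -(IntD _ _ (c1 _ oU) (c1 _ oV)) -(IntD _ _ (c2 _ oU) (c2 _ oV)).
  by congr (Int _ _ _ + Int _ _ _); apply/funext => s; rewrite mulrDr.
by congr Int; apply/funext => z; ring.
Qed.

Lemma regular_sections_add U V : regular_sections U -> regular_sections V -> regular_sections (fun s z => U s z + V s z).
Proof.
move=> [h1 [h2 h3 h4]] [k1 [k2 k3 k4]].
have cD (f g : R -> R) : continuous f -> continuous g -> continuous (fun x => f x + g x).
  by move=> cf cg x; apply: cvgD; [exact: cf|exact: cg].
by split; [move=> i; exact: cD (h1 i) (k1 i)|split; exact: cD].
Qed.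

Lemma regular_sections_cst c : regular_sections (fun _ _ => c).
Proof. by split=> [i|]; [exact: cst_continuous|split; exact: cst_continuous]. Qed.

Lemma ht' i : t0 <= t i <= t0 + twopi *+ 2.
Proof. by have /andP[-> /ltW ->] := ht i. Qed.

(** [kap'' = p^2 kap] turns the integral of [kap] into a difference of derivatives, and [phi] has
    integral [1 / p]; the two terms of [green] then cancel. *)
Lemma green_cst c : green (fun _ _ => c) = 0.
Proof.
have I12 : Int s0 s1 kap1 + Int s1 S kap2 = (ccoef1 - ccoef0 - ccoef2) / p ^+ 2.
  have D A B s : is_derive s 1 (fun s => p ^- 2 * dkap p A B s) (kap p A B s).
    have H := is_deriveZ (p ^- 2) (is_derive_dkap p A B s).
    by apply: is_derive_eq H _; rewrite /GRing.scale /= mulrA mulVf ?mul1r // expf_neq0 // lt0r_neq0.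
  rewrite -(funext kap1E) -(funext kap2E) (IntE _ _ (D kA1 kB1)) (IntE _ _ (D kA2 1)).
  by rewrite /ccoef0 /ccoef1 /ccoef2; field; exact: lt0r_neq0.
have -> : green (fun _ _ => c) = p * (\sum_i w i * (c * (Int s0 s1 kap1 + Int s1 S kap2))) +
   c * (ccoef0 - ccoef1 + ccoef2) * Int t0 (t0 + twopi *+ 2) phi.
  rewrite /green -IntZ; last exact: continuous_phi.
  congr (_ * _ + _).
    apply: eq_bigr => i _; congr (_ * _).
    rewrite mulrDr -IntZ; last exact: continuous_kap1.
    rewrite -IntZ; last exact: continuous_kap2.
    by congr (Int _ _ _ + Int _ _ _); apply/funext => s; rewrite mulrC.
  by congr Int; apply/funext => z; ring.
rewrite -mulr_suml w1 I12 (Int_phi1 p0 w1 bc bs ht').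
by field; exact: lt0r_neq0.
Qed.

Definition kap12 sg := if s0 < sg < s1 then kap1 sg else if s1 < sg < S then kap2 sg else 0.

Definition log_root (r : R * R) s z := logdist r.1 s (z - r.2).

Definition good_root (r : R * R) := [/\ s0 != r.1, s1 != r.1, S != r.1,
  t0 - twopi *+ 2 <= r.2 < t0 - twopi & forall i, cos (t i - r.2) != 1].

Lemma regular_sections_root r : good_root r -> regular_sections (log_root r).
Proof.
move=> [h0 h1 h2 _ hc]; split=> [i|]; first exact: (continuous_logdist1 (hc i)).
have cs s : s != r.1 -> continuous (log_root r s).
  move=> hs x; apply: (@continuous_comp R R R (fun z => z - r.2) (logdist r.1 s)).
    by apply: cvgB; [exact: cvg_id|exact: cvg_cst].
  exact: (continuous_logdist2 hs).
by split; exact: cs.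
Qed.

(** [kernel_sum] is used on both pieces. In the sum of the two [bdry] terms the normal derivatives
    have coefficient 0 at [s0] and [S] and cancel at [s1]. *)
Lemma green_root r : good_root r -> green (log_root r) = twopi * (kap12 r.1 * Phi3 (r.2 + twopi)).
Proof.
move=> gr; have [h0 h1 h2 ha hc] := gr.
have K1 := kernel_sum p0 w0 w1 bc bs kA1 kB1 (ltW s01) h0 h1 ht ha hc.
have K2 := kernel_sum p0 w0 w1 bc bs kA2 1 (ltW s1S) h1 h2 ht ha hc.
have cb (A B x1 x2 : R) : x1 != r.1 -> x2 != r.1 -> continuous (fun z => bdry p r.1 A B x1 x2 (z - r.2) * phi z).
  move=> k1 k2; apply: continuousM2; last exact: continuous_phi.
  move=> x; apply: (@continuous_comp R R R (fun z => z - r.2) (bdry p r.1 A B x1 x2)).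
    by apply: cvgB; [exact: cvg_id|exact: cvg_cst].
  exact: continuous_bdry.
have -> : green (log_root r) = p * (\sum_i w i * logpot p r.1 kA1 kB1 s0 s1 (t i - r.2)) +
     Int t0 (t0 + twopi *+ 2) (fun z => bdry p r.1 kA1 kB1 s0 s1 (z - r.2) * phi z) +
    (p * (\sum_i w i * logpot p r.1 kA2 1 s1 S (t i - r.2)) +
     Int t0 (t0 + twopi *+ 2) (fun z => bdry p r.1 kA2 1 s1 S (z - r.2) * phi z)).
  rewrite addrACA -mulrDr -big_split /= -IntD; [|exact: cb|exact: cb].
  congr (_ * _ + _).
    apply: eq_bigr => i _; rewrite -mulrDr /logpot /log_root.
    by congr (_ * (Int _ _ _ + Int _ _ _)); apply/funext => s; rewrite ?kap1E ?kap2E.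
  congr Int; apply/funext => z; rewrite -mulrDl; congr (_ * _).
  rewrite /bdry !kap1E !kap2E kap1_s0 kap1_s1 kap2_S /log_root /ccoef0 /ccoef1 /ccoef2; ring.
rewrite K1 K2 (jumpE _ _ _ (ltW s01) h0 h1) (jumpE _ _ _ (ltW s1S) h1 h2) -mulrDl -mulrDr -mulrA.
congr (_ * (_ * _)); rewrite /kap12 kap1E kap2E.
case: ifPn => [/andP[_ h]|_]; last by rewrite add0r.
by rewrite [s1 < r.1]lt_gtF // addr0.
Qed.

Lemma green_list c (l : seq (R * R)) : (forall r, r \in l -> good_root r) ->
  green (fun s z => c + \sum_(r <- l) log_root r s z) = twopi * \sum_(r <- l) kap12 r.1 * Phi3 (r.2 + twopi) /\
  regular_sections (fun s z => c + \sum_(r <- l) log_root r s z).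
Proof.
elim: l => [|r l IH] gl.
  have -> : (fun s z : R => c + \sum_(r <- [::]) log_root r s z) = (fun _ _ => c).
    by apply/funext => s; apply/funext => z; rewrite big_nil addr0.
  by rewrite green_cst big_nil mulr0; split => //; exact: regular_sections_cst.
have [IH1 IH2] := IH (fun r' h => gl r' (mem_behead (s := r :: l) h)).
have gr : good_root r by apply: gl; rewrite mem_head.
have -> : (fun s z : R => c + \sum_(r <- r :: l) log_root r s z) =
    (fun s z => log_root r s z + (c + \sum_(r <- l) log_root r s z)).
  by apply/funext => s; apply/funext => z; rewrite big_cons; ring.
split; last exact: (regular_sections_add (regular_sections_root gr) IH2).
by rewrite (green_add (regular_sections_root gr) IH2) IH1 (green_root gr) big_cons -mulrDr.
Qed.

(* Independent of [S], so that the bound [green_le] is linear in [S] with slope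
   [p * tau]. *)
Definition green_const Lg tau m1 :=
  p * (expR (- (p * s1)) * (Lg + tau * expR (p * s1)) * (s1 - s0) + (Lg * (expR (- (p * s1)) / p) - tau * s1)) +
  (2 * p * (expR (- (p * s1)) / (expR (p * s1) - expR (2 * p * s0 - p * s1))) * expR (p * s0) * (Lg + tau * expR (p * s0)) +
   (p * (expR (- (p * s1)) / (expR (p * s1) - expR (2 * p * s0 - p * s1))) * (expR (p * s1) + expR (2 * p * s0 - p * s1)) + 2 * p * expR (- (p * s1))) * m1 +
   2 * p * (Lg * expR (- (p * s1)) + tau)) / p.

(** Along the rays [kap2] times the bound of [V] is at most [Lg e^(- p s) + tau], whose integral up
    to [S] carries all the growth in [S]. On the outer circle the coefficient [2 p e^(- p S)]
    absorbs [e^(p S)]. *)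
Lemma green_le V Lg tau m1 : regular_sections V -> 0 <= Lg -> 0 <= tau -> 0 <= m1 -> (forall z, 0 <= phi z) ->
  (forall s z, s0 <= s <= S -> [\/ s = s0, s = S | exists i, z = t i] ->
     V s z <= Lg + tau * expR (p * s)) ->
  (forall z, - m1 <= V s1 z) ->
  green V <= p * tau * S + green_const Lg tau m1.
Proof.
move=> oV L0 T0 m0 phi0 Vu Vl.
have [cr [c1 c2 c3]] := oV.
(* [kcoef] depends on [S] through [kap2 s1]; its bound [K] does not. *)
pose K := expR (- (p * s1)) / (expR (p * s1) - expR (2 * p * s0 - p * s1)).
have kK : kcoef <= K.
  by apply: ler_wpM2r; [rewrite invr_ge0; apply/ltW/kden_gt0|exact: kap2_le].
have k0 := kcoef_ge0.
have E1 : 0 <= ccoef0 <= 2 * p * K * expR (p * s0).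
  rewrite /ccoef0 /dkap /kA1 /kB1.
  have -> : p * (kcoef * expR (p * s0) - - kcoef * expR (2 * p * s0) * expR (- (p * s0))) = 2 * p * kcoef * expR (p * s0).
    rewrite -(mulrA (- kcoef)) -expRD (_ : 2 * p * s0 + - (p * s0) = p * s0); last by ring.
    by ring.
  have p20 : 0 <= 2 * p by rewrite mulr_ge0 // ltW.
  apply/andP; split; first by apply: mulr_ge0; [exact: mulr_ge0|exact: expR_ge0].
  by apply: ler_wpM2r; [exact: expR_ge0|exact: ler_wpM2l].
have E2 : 0 <= ccoef1 <= p * K * (expR (p * s1) + expR (2 * p * s0 - p * s1)) + 2 * p * expR (- (p * s1)).
  rewrite /ccoef1 /dkap /kA1 /kB1 /kA2.
  have -> : p * (kcoef * expR (p * s1) - - kcoef * expR (2 * p * s0) * expR (- (p * s1))) -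
     p * (- expR (- (2 * p * S)) * expR (p * s1) - 1 * expR (- (p * s1))) =
     p * kcoef * (expR (p * s1) + expR (2 * p * s0 - p * s1)) + p * (expR (- (2 * p * S) + p * s1) + expR (- (p * s1))).
    by rewrite !expRD; ring.
  have e1 := expR_ge0 (p * s1); have e2 := expR_ge0 (2 * p * s0 - p * s1).
  have e3 := expR_ge0 (- (p * s1)); have e4 := expR_ge0 (- (2 * p * S) + p * s1).
  have e5 : expR (- (2 * p * S) + p * s1) <= expR (- (p * s1)).
    have : 0 <= p * (S - s1) by rewrite mulr_ge0 ?subr_ge0 ?(ltW s1S) // ltW.
    by rewrite ler_expR; lra.
  have pk : p * kcoef <= p * K by rewrite ler_pM2l.
  have pk0 : 0 <= p * kcoef by rewrite mulr_ge0 // ltW.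
  apply/andP; split.
    apply: addr_ge0; first by apply: mulr_ge0 => //; exact: addr_ge0.
    by apply: mulr_ge0; [exact: ltW|exact: addr_ge0].
  apply: lerD; first by apply: ler_wpM2r => //; exact: addr_ge0.
  have : p * (expR (- (2 * p * S) + p * s1) + expR (- (p * s1))) <= p * (expR (- (p * s1)) + expR (- (p * s1))).
    by apply: ler_wpM2l; [exact: ltW|rewrite lerD2r].
  lra.
have E3 : ccoef2 = 2 * p * expR (- (p * S)).
  rewrite /ccoef2 /dkap /kA2 mulNr -expRD (_ : - (2 * p * S) + p * S = - (p * S)); last by ring.
  by ring.
have aU V' : regular_sections V' -> continuous (fun z => (ccoef0 * V' s0 z - ccoef1 * V' s1 z + ccoef2 * V' S z) * phi z).
  exact: continuous_ccoefs.
set KK := 2 * p * K * expR (p * s0) * (Lg + tau * expR (p * s0)) +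
   (p * K * (expR (p * s1) + expR (2 * p * s0 - p * s1)) + 2 * p * expR (- (p * s1))) * m1 +
   2 * p * (Lg * expR (- (p * s1)) + tau).
have P1 : Int t0 (t0 + twopi *+ 2) (fun z => (ccoef0 * V s0 z - ccoef1 * V s1 z + ccoef2 * V S z) * phi z) <= KK / p.
  rewrite -(Int_phi1 p0 w1 bc bs ht') -IntZ; last exact: continuous_phi.
  apply: Int_le; [|exact: aU| |].
  - by rewrite lerDl mulrn_wge0 // ltW // twopi_gt0.
  - by apply: continuousM2; [exact: cst_continuous|exact: continuous_phi].
  move=> z _; apply: ler_wpM2r => //.
  have s0S : s0 <= S by apply: ltW; exact: lt_trans s1S.
  have v0 : V s0 z <= Lg + tau * expR (p * s0).
    by apply: Vu; [rewrite lexx s0S|constructor 1].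
  have v1 := Vl z.
  have v2 : V S z <= Lg + tau * expR (p * S).
    by apply: Vu; [rewrite lexx s0S|constructor 2].
  move: E1 E2 => /andP[E10 E11] /andP[E20 E21].
  have x0 : ccoef0 * V s0 z <= 2 * p * K * expR (p * s0) * (Lg + tau * expR (p * s0)).
    apply: le_trans (ler_wpM2l E10 v0) _; apply: ler_wpM2r => //.
    by rewrite addr_ge0 // mulr_ge0 // expR_ge0.
  have x1 : - (ccoef1 * V s1 z) <= (p * K * (expR (p * s1) + expR (2 * p * s0 - p * s1)) + 2 * p * expR (- (p * s1))) * m1.
    have v1' : - V s1 z <= m1 by rewrite lerNl.
    rewrite -mulrN; apply: le_trans (ler_wpM2l E20 v1') _.
    by apply: ler_wpM2r.
  have x2 : ccoef2 * V S z <= 2 * p * (Lg * expR (- (p * s1)) + tau).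
    rewrite E3; have a20 : 0 <= 2 * p * expR (- (p * S)) by rewrite !mulr_ge0 ?expR_ge0 // ltW.
    apply: le_trans (ler_wpM2l a20 v2) _.
    have e0 : 0 <= 2 * p by rewrite mulr_ge0 // ltW.
    rewrite -[leLHS]mulrA; apply: (ler_wpM2l e0).
    have e1 : expR (- (p * S)) * (tau * expR (p * S)) = tau.
      by rewrite mulrCA -expRD addNr expR0 mulr1.
    rewrite mulrDr e1 lerD2r mulrC.
    have e2 : expR (- (p * S)) <= expR (- (p * s1)).
      by rewrite ler_expR lerN2 ler_pM2l //; exact: ltW.
    exact: (ler_wpM2l L0 e2).
  rewrite /KK; lra.
have P2 i : Int s0 s1 (fun s => kap1 s * V s (t i)) <= expR (- (p * s1)) * (Lg + tau * expR (p * s1)) * (s1 - s0).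
  rewrite -Int_cst; apply: Int_le; [exact: ltW| | |].
  - by apply: continuousM2; [exact: continuous_kap1|exact: cr].
  - exact: cst_continuous.
  move=> s hs; have /andP[k1 k2] := kap1_bounds hs.
  have v : V s (t i) <= Lg + tau * expR (p * s).
    apply: Vu; last by constructor 3; exists i.
    by have /andP[-> h] := hs; rewrite /= (le_trans h) // ltW.
  apply: le_trans (ler_wpM2l k1 v) _; apply: ler_pM => //.
    by rewrite addr_ge0 // mulr_ge0 // expR_ge0.
  rewrite lerD2l; apply: ler_wpM2l => //; rewrite ler_expR ler_pM2l //.
  by have /andP[] := hs.
have P3 i : Int s1 S (fun s => kap2 s * V s (t i)) <= Lg * (expR (- (p * s1)) / p) + tau * (S - s1).
  have D s : is_derive s 1 (fun s => - (Lg / p) * expR (- (p * s)) + tau * s) (Lg * expR (- (p * s)) + tau).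
    have d2 : is_derive s 1 (fun s => expR (- (p * s))) (expR (- (p * s)) * - p).
      by apply: is_derive1_comp; apply: is_deriveN; exact: is_derive_mull.
    have H := is_deriveD (is_deriveZ (- (Lg / p)) d2) (is_derive_mull tau s).
    by apply: is_derive_eq H _; rewrite /GRing.scale /=; field; exact: lt0r_neq0.
  apply: (@le_trans _ _ (Int s1 S (fun s => Lg * expR (- (p * s)) + tau))).
    apply: Int_le; [exact: ltW| | |].
    - by apply: continuousM2; [exact: continuous_kap2|exact: cr].
    - move=> x; apply: cvgD; last exact: cvg_cst.
      apply: cvgM; first exact: cvg_cst.
      apply: (@continuous_comp R R R (fun s => - (p * s)) expR); last exact: continuous_expR.
      by apply: cvgN; apply: cvgM; [exact: cvg_cst|exact: cvg_id].
    move=> s /andP[hs hs2]; have v : V s (t i) <= Lg + tau * expR (p * s).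
      by apply: Vu; [rewrite hs2 andbT (le_trans _ hs) // ltW|constructor 3; exists i].
    apply: le_trans (ler_wpM2l (kap2_ge0 hs2) v) _.
    have b0 : 0 <= Lg + tau * expR (p * s) by rewrite addr_ge0 // mulr_ge0 // expR_ge0.
    apply: le_trans (ler_wpM2r b0 (kap2_le s)) _.
    by rewrite mulrDr mulrCA -expRD addNr expR0 mulr1 mulrC.
  rewrite (IntE _ _ D).
  have e := expR_ge0 (- (p * S)).
  have : 0 <= Lg / p * expR (- (p * S)) by rewrite mulr_ge0 // divr_ge0 // ltW.
  by rewrite (_ : Lg * (expR (- (p * s1)) / p) = Lg / p * expR (- (p * s1))); [lra|ring].
have P4 : \sum_i w i * (Int s0 s1 (fun s => kap1 s * V s (t i)) + Int s1 S (fun s => kap2 s * V s (t i))) <=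
   expR (- (p * s1)) * (Lg + tau * expR (p * s1)) * (s1 - s0) + (Lg * (expR (- (p * s1)) / p) + tau * (S - s1)).
  rewrite -[leRHS]mul1r -w1 mulr_suml; apply: ler_sum => i _; apply: ler_wpM2l => //.
  exact: lerD.
apply: le_trans (lerD (ler_wpM2l (ltW p0) P4) P1) _.
rewrite /green_const -/K -/KK; lra.
Qed.
End TwoPieces.

(** * Logarithms of polynomials in polar coordinates *)

Section PolyLog.
Context {R : realType}.
Local Notation C := (Cplx R).
Local Notation twopi := ((pi : R) *+ 2).
Implicit Types (s sg x y th al T : R) (z a c : C).

Lemma expw_periodic s x n : expw s (x + twopi * n%:R) = expw s x.
Proof. by rewrite /expw expi_periodic. Qed.

Lemma angle_window T z : z != 0 -> exists2 x, T <= x < T + twopi & z = expw (ln (cabs z)) x.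
Proof.
move=> /polar_expw[x zx]; have p0 := @twopi_gt0 R.
pose n := (Num.trunc (`|x - T| / twopi)).+1.
have hn : 0 <= x - T + twopi * n%:R.
  have /andP[_] := @Num.Theory.trunc_itv R _ (divr_ge0 (normr_ge0 (x - T)) (ltW p0)).
  rewrite -/n ltr_pdivrMr // => h; have := ler_norm (- (x - T)); rewrite normrN => h2.
  by rewrite (mulrC twopi); lra.
pose m := Num.trunc ((x - T + twopi * n%:R) / twopi).
have /andP[h1 h2] := @Num.Theory.trunc_itv R _ (divr_ge0 hn (ltW p0)).
rewrite -/m ler_pdivlMr // in h1; rewrite -/m ltr_pdivrMr // -natr1 in h2.
exists (x + twopi * n%:R - twopi * m%:R).
  rewrite (mulrC twopi m%:R); apply/andP; split; lra.
by rewrite zx -[in RHS](expw_periodic _ _ m) subrK expw_periodic cabs_expw expRK.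
Qed.

Lemma cabs_expw_sub s th sg al : cabs (expw s th - expw sg al) ^+ 2 = dist2 sg s (th - al).
Proof.
rewrite cabsE sqr_sqrtr; last by rewrite addr_ge0 // sqr_ge0.
rewrite !(reD, imD, reN, imN, reM, imM) /= /dist2 cosB.
have := cos2Dsin2 th; have := cos2Dsin2 al.
move: (expR s) (expR sg) (cos th) (sin th) (cos al) (sin al) => a b u v x y h1 h2.
have -> : (a * u - 0 * v - (b * x - 0 * y)) ^+ 2 + (a * v + 0 * u - (b * y + 0 * x)) ^+ 2 =
  a ^+ 2 * (u ^+ 2 + v ^+ 2) - 2 * (a * b * (u * x + v * y)) + b ^+ 2 * (x ^+ 2 + y ^+ 2) by ring.
by rewrite h1 h2 !mulr1.
Qed.

Lemma ln_cabs_expw_sub s th sg al : ln (cabs (expw s th - expw sg al)) = logdist sg s (th - al).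
Proof.
rewrite /logdist -cabs_expw_sub; have [c0|c0] := ltP 0 (cabs (expw s th - expw sg al)).
  by rewrite lnXn // -[X in X / 2]mulr_natr mulfK.
(* At the pole both sides are 0, by the convention [ln 0 = 0]. *)
have -> : cabs (expw s th - expw sg al) = 0 by apply/eqP; rewrite eq_le c0 cabs_ge0.
by rewrite expr0n /= ln0 // mul0r.
Qed.

Lemma ln_prod (r : seq C) z : (forall a, a \in r -> z != a) ->
  ln (cabs (\prod_(a <- r) (z - a))) = \sum_(a <- r) ln (cabs (z - a)).
Proof.
elim: r => [_|a r IH h]; first by rewrite !big_nil cabs1 ln1.
have za : z != a by apply: h; rewrite mem_head.
have zr b : b \in r -> z != b by move=> br; apply: h; rewrite inE br orbT.
rewrite !big_cons cabsM lnM ?IH // posrE cabs_gt0 ?subr_eq0 //.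
rewrite prodf_seq_neq0; apply/allP => b br; rewrite /= subr_eq0; exact: zr.
Qed.

(** Each element of the finite list forbids at most one value of the parameter, and a step of the
    induction cuts the interval at that value. An interval is returned, instead of a point, to keep
    the induction going. *)
Lemma avoid_bad (T : eqType) (l : seq T) (bad : T -> R -> Prop) (u v : R) : u < v ->
  (forall (x : T) (a b : R), u < a < v -> u < b < v -> bad x a -> bad x b -> a = b) ->
  exists u' v', [/\ u <= u', u' < v', v' <= v & forall (x : T) (d : R), x \in l -> u' < d < v' -> ~ bad x d].
Proof.
elim: l => [|x l IH] uv H; first by exists u, v; split.
have [u1 [v1 [h1 h2 h3 h4]]] := IH uv H.
have [[d [/andP[du dv] bd]]|nb] := pselect (exists d, u1 < d < v1 /\ bad x d); last first.
  exists u1, v1; split => // y d; rewrite inE => /predU1P[->|yl] hd; last exact: h4.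
  by move=> b; apply: nb; exists d.
exists d, v1; split => //; first exact: le_trans h1 (ltW du).
move=> y d'; rewrite inE => /predU1P[->|yl] /andP[k1 k2]; last by apply: h4; rewrite ?k2 ?(lt_trans du).
move=> bd'; have E : d = d'.
  by apply: (H x) => //; apply/andP; split; lra.
by rewrite E ltxx in k1.
Qed.

Lemma cos_eq1_unique x (a b : R) : `|a - b| < twopi -> cos (x + a) = 1 -> cos (x + b) = 1 -> a = b.
Proof.
wlog ab : a b / a <= b.
  by move=> H; have [/H//|/ltW/H h] := leP a b; rewrite distrC => /h{}h ca cb; rewrite h.
rewrite distrC ger0_norm ?subr_ge0 // => lt2 ca cb.
apply/eqP/negPn/negP => ne.
have hab : 0 < b - a < twopi by rewrite subr_gt0 lt_neqAle ne ab lt2.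
have := cos_neq1 hab; rewrite (_ : b - a = (x + b) - (x + a)); last by ring.
rewrite cosB ca cb.
have := cos2Dsin2 (x + a); rewrite ca expr1n => /eqP; rewrite -subr_eq0 addrAC subrr add0r sqrf_eq0 => /eqP ->.
by rewrite !mulr1 mulr0 addr0 eqxx.
Qed.
End PolyLog.

(** * Bounds for weighted zeros, from polynomials to entire functions *)

Section UpperCount.
Context {R : realType}.
Local Notation C := (Cplx R).
Local Notation twopi := ((pi : R) *+ 2).
Variables (p t0 : R) (n : nat) (w : 'I_n -> R).
Hypotheses (p0 : 0 < p) (w0 : forall i, 0 <= w i) (w1 : \sum_i w i = 1).
Implicit Types (t : 'I_n -> R) (s th x y : R) (z a c : C).

(** By [ln_prod] the logarithm of the polynomial is a constant plus a sum of [log_root], to which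
    [green_list] and [green_le] apply; the conditions on the roots keep the three circles and the
    rays free of zeros. *)
Lemma poly_count t s0 s1 S (ang : C -> R) c (m : seq C) Lg tau m1 :
  \sum_i w i * cos (p * t i) = 0 -> \sum_i w i * sin (p * t i) = 0 ->
  (forall i, t0 <= t i < t0 + twopi *+ 2) -> (forall y, 0 <= phi p w t y) ->
  s0 < s1 -> s1 < S -> c != 0 ->
  (forall a, a \in m -> a != 0 /\ [/\ a = expw (ln (cabs a)) (ang a), t0 - twopi <= ang a < t0,
     [/\ s0 != ln (cabs a), s1 != ln (cabs a) & S != ln (cabs a)] &
     forall i, cos (t i - ang a) != 1]) ->
  0 <= Lg -> 0 <= tau -> 0 <= m1 ->
  (forall s x, s0 <= s <= S -> cabs (c * \prod_(a <- m) (expw s x - a)) <= expR (Lg + tau * expR (p * s))) ->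
  (forall x, expR (- m1) <= cabs (c * \prod_(a <- m) (expw s1 x - a))) ->
  twopi * \sum_(a <- m) kap12 p s0 s1 S (ln (cabs a)) * Phi3 p w t (ang a) <=
    p * tau * S + green_const p s0 s1 Lg tau m1.
Proof.
move=> bc bs ht ph s01 s1S c0 hm L0 T0 m0 Fu Fl.
have pi2 := @twopi_gt0 R.
(* [good_root] expects the lift of a root one turn below [[t0 - 2 pi, t0)]. *)
pose l := [seq (ln (cabs a), ang a - twopi) | a <- m].
pose V s x := ln (cabs c) + \sum_(r <- l) log_root r s x.
have cos2 x : cos (x + twopi) = cos x.
  by have := congr1 (@complex.Re R) (@expi_periodic R x 1); rewrite /= mulr1.
have gl r : r \in l -> good_root t0 t s0 s1 S r.
  move=> /mapP[a am ->]; have [a0 [_ ha [h0 h1 h2] hc]] := hm a am; split => //=.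
  - have -> : twopi *+ 2 = 2 * twopi by rewrite mulr_natl.
    by move: ha => /andP[? ?]; apply/andP; split; lra.
  - by move=> i; rewrite opprB addrA addrAC cos2.
have VE s x : (forall a, a \in m -> expw s x != a) -> ln (cabs (c * \prod_(a <- m) (expw s x - a))) = V s x.
  move=> ne; rewrite cabsM lnM ?posrE ?cabs_gt0 //; last first.
    rewrite prodf_seq_neq0; apply/allP => b br; rewrite /= subr_eq0; exact: ne.
  rewrite ln_prod // /V big_map; congr (_ + _); apply: eq_big_seq => a am.
  have [a0 [aE _ _ _]] := hm a am.
  rewrite {1}aE ln_cabs_expw_sub /log_root /=.
  rewrite -[in RHS](_ : x - ang a + twopi = x - (ang a - twopi)); last by ring.
  by rewrite /logdist /dist2 cos2.
have ne1 s x : (forall a, a \in m -> s != ln (cabs a)) -> forall a, a \in m -> expw s x != a.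
  by move=> h a am; apply: contra_neq (h a am) => <-; rewrite cabs_expw expRK.
have ne2 s i : forall a, a \in m -> expw s (t i) != a.
  move=> a am; have [a0 [aE _ _ hc]] := hm a am; apply/eqP => E.
  have := dist2_gt0 (or_intror (hc i) : regular_pt (ln (cabs a)) s (t i - ang a)).
  by rewrite -cabs_expw_sub -aE E subrr cabs0 expr0n ltxx.
have ne s x : (forall a, a \in m -> expw s x != a) -> 0 < cabs (c * \prod_(a <- m) (expw s x - a)).
  move=> h; rewrite cabs_gt0 mulf_neq0 // prodf_seq_neq0; apply/allP => b br.
  by rewrite /= subr_eq0 h.
have hs0 a : a \in m -> s0 != ln (cabs a) by move=> /hm[_ [_ _ []]].
have hs1 a : a \in m -> s1 != ln (cabs a) by move=> /hm[_ [_ _ []]].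
have hs2 a : a \in m -> S != ln (cabs a) by move=> /hm[_ [_ _ []]].
have [E oV] := green_list p0 w0 w1 bc bs ht s01 s1S (ln (cabs c)) gl.
rewrite -/V in E oV.
have -> : \sum_(a <- m) kap12 p s0 s1 S (ln (cabs a)) * Phi3 p w t (ang a) =
   \sum_(r <- l) kap12 p s0 s1 S r.1 * Phi3 p w t (r.2 + twopi).
  by rewrite big_map; apply: eq_bigr => a _ /=; rewrite subrK.
rewrite -E; apply: green_le => //.
- move=> s x hs hx.
  have h : forall a, a \in m -> expw s x != a.
    by case: hx => [->|->|[i ->]]; [exact: ne1|exact: ne1|exact: ne2].
  rewrite -VE // -(expRK (Lg + tau * expR (p * s))) ler_ln ?posrE ?expR_gt0 //.
  - exact: Fu.
  - exact: ne.
- move=> x; have h := ne1 s1 x hs1.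
  by rewrite -VE // -(expRK (- m1)) ler_ln ?posrE ?expR_gt0 // ne.
Qed.

Lemma prod_sub_bounded (l : seq C) (r : R) :
  exists2 M, 0 <= M & forall z, cabs z <= r -> cabs (\prod_(a <- l) (z - a)) <= M.
Proof.
elim: l => [|a l [M M0 IH]]; first by exists 1 => // z _; rewrite big_nil cabs1.
exists ((Num.max 0 r + cabs a) * M) => [|z zr].
  by rewrite mulr_ge0 // addr_ge0 ?cabs_ge0 // le_max lexx.
rewrite big_cons cabsM; apply: ler_pM; rewrite ?cabs_ge0 ?IH //.
apply: le_trans (cabsB _ _) _; rewrite lerD2r.
by rewrite le_max zr orbT.
Qed.

(** If the approximating polynomial vanishes at 0, the constant [e / 2] is added: a root at the
    origin would have no position in logarithmic coordinates. *)
Lemma poly_approx_neq0 (g : C -> C) r e : holo g -> 0 < e ->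
  exists2 q : {poly C}, q.[0] != 0 & forall z, cabs z <= r -> cabs (g z - q.[z]) <= e.
Proof.
move=> hg e0; have e20 : 0 < e / 2 by rewrite divr_gt0.
have [q Hq] := holo_poly_approx r hg e20.
have [q0|q0] := eqVneq q.[0] 0; last first.
  by exists q => // z /Hq h; apply: le_trans h _; lra.
exists (q + (ofR (e / 2))%:P) => [|z /Hq h]; rewrite hornerD hornerC.
  by rewrite q0 add0r ofR_eq0 gt_eqF.
rewrite opprD addrA; apply: le_trans (cabsB _ _) _; rewrite cabs_ofR gtr0_norm //; lra.
Qed.

Lemma poly_roots (q : {poly C}) : q.[0] != 0 -> exists (c : C) (rs : seq C),
  [/\ c != 0, 0 \notin rs & forall z, q.[z] = c * \prod_(a <- rs) (z - a)].
Proof.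
move=> q0; have qn0 : q != 0 by apply: contraNneq q0 => ->; rewrite horner0.
have [rs E] := @closed_field_poly_normal R[i] q.
have E2 z : q.[z] = lead_coef q * \prod_(a <- rs) (z - a).
  rewrite {1}E hornerZ horner_prod; congr (_ * _); apply: eq_bigr => a _.
  by rewrite hornerXsubC.
exists (lead_coef q), rs; split => //; first by rewrite lead_coef_eq0.
apply: contraNN q0 => h; rewrite E2 mulf_eq0 prodf_seq_eq0; apply/orP; right.
by apply/hasP; exists 0; rewrite //= subrr.
Qed.

Lemma kap2_leS S S' s : S <= S' -> kap2 p S s <= kap2 p S' s.
Proof.
move=> SS; rewrite /kap2 lerD2l lerN2 ler_expR.
have : 0 <= p * (S' - S) by rewrite mulr_ge0 ?subr_ge0 // ltW.
lra.
Qed.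

Lemma kap12_ge0 s0 s1 S s : s0 < s1 -> s1 < S -> 0 <= kap12 p s0 s1 S s.
Proof.
move=> s01 s1S; rewrite /kap12; case: ifPn => [/andP[h1 h2]|_].
  have h : s0 <= s <= s1 by rewrite !ltW.
  by have /andP[] := kap1_bounds p0 s01 s1S h.
by case: ifPn => // /andP[_ h]; apply: kap2_ge0 => //; exact: ltW.
Qed.

Lemma phi_shift t d y : phi p w (fun i => t i + d) y = phi p w t (y - d).
Proof. by apply: eq_bigr => i _; congr (_ * sinp _ _); ring. Qed.

Lemma Phi3_shift t d y : Phi3 p w (fun i => t i + d) y = Phi3 p w t (y - d).
Proof. by rewrite /Phi3 !phi_shift !(addrAC y _ (- d)). Qed.

(* [f] is replaced by a polynomial with the same zeros [l]; the angles are shifted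
   by a small [d], and [S] is increased slightly, in order to keep the zeros of that
   polynomial off the contours. *)
Lemma upper_count u t (f : C -> C) b K tau :
  \sum_i w i * cos (p * t i) = 0 -> \sum_i w i * sin (p * t i) = 0 ->
  (forall i, u <= t i <= u + twopi / p) -> t0 <= u -> u + twopi / p < t0 + twopi *+ 2 ->
  holo f -> f b != 0 -> 1 <= K -> 0 <= tau ->
  (forall z, cabs (f z) <= K * expR (tau * cabs z `^ p)) ->
  exists s1 Cc, forall S (l : seq C) (ang : C -> R), s1 < S ->
    (forall z k, (k < count_mem z l)%N -> derive1n k f z = 0) ->
    (forall a, a \in l -> [/\ s1 < ln (cabs a) < S, a = expw (ln (cabs a)) (ang a) &
       t0 - twopi <= ang a < t0]) ->
    twopi * \sum_(a <- l) kap2 p S (ln (cabs a)) * Phi3 p w t (ang a) <= p * tau * S + Cc.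
Proof.
move=> bc bs ht t0u ut0 hf fb K1 T0 fK; have pi2 := @twopi_gt0 R.
have [r r0 Hr] := holo_lower_bound hf fb.
(* Both inner circles lie where [holo_lower_bound] applies: on [s1] the bound itself enters the
   estimate, on [s0] it serves to keep roots away. *)
pose s1 := ln r; pose s0 := s1 - 1.
have s01 : s0 < s1 by rewrite /s0; lra.
have es1 : expR s1 <= r by rewrite lnK // posrE.
have es0 : expR s0 <= r by apply: le_trans es1; rewrite ler_expR ltW.
have [k1 k10 Hk1] := Hr _ es1; have [k0 k00 Hk0] := Hr _ es0.
(* [K e^x + 1 <= (K + 1) e^x] for [x >= 0] gives [Lg]; [m1] records the lower bound [k1 / 2] that is
   left after an approximation error of at most [k1 / 2]. *)
pose Lg := ln (K + 1); pose m1 := Num.max 0 (- ln (k1 / 2)).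
have L0 : 0 <= Lg by rewrite ln_ge0 //; lra.
have m10 : 0 <= m1 by rewrite le_max lexx.
pose e1 := Num.min 1 (Num.min (k0 / 2) (k1 / 2)).
have e10 : 0 < e1 by rewrite !lt_min ltr01 !divr_gt0.
have ph : forall y, 0 <= phi p w t y by move=> y; exact: (@phi_ge0 R p u).
have Ph y : 0 <= Phi3 p w t y by rewrite /Phi3 !addr_ge0.
(* The extra [p tau] pays for replacing [S] by [S' < S + 1]. *)
exists s1, (p * tau + green_const p s0 s1 Lg tau m1) => S l ang s1S vl hl.
have [g hg fE] := holo_factor hf vl.
have [M M0 HM] := prod_sub_bounded l (expR (S + 1)).
have ee0 : 0 < e1 / (M + 1) by rewrite divr_gt0 // ltr_wpDl.
have [q q0 Hq] := poly_approx_neq0 (expR (S + 1)) hg ee0.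
have [c [rs [c0 rs0 qE]]] := poly_roots q0.
pose m := l ++ rs.
have FE z : c * \prod_(a <- m) (z - a) = (\prod_(a <- l) (z - a)) * q.[z].
  by rewrite qE big_cat /=; ring.
have Ff z : cabs z <= expR (S + 1) -> cabs (f z - c * \prod_(a <- m) (z - a)) <= e1.
  move=> hz; rewrite FE fE -mulrBr cabsM.
  apply: le_trans (ler_pM (cabs_ge0 _) (cabs_ge0 _) (HM z hz) (Hq z hz)) _.
  rewrite mulrA ler_pdivrMr ?ltr_wpDl // mulrDr mulr1 mulrC lerDl; exact: ltW.
have m0 a : a \in m -> a != 0.
  rewrite mem_cat => /orP[/hl[_ -> _]|h]; first exact: expw_neq0.
  by apply: contraNneq rs0 => <-.
have Fa a : a \in m -> c * \prod_(a' <- m) (a - a') = 0.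
  move=> am; apply/eqP; rewrite mulf_eq0 prodf_seq_eq0; apply/orP; right.
  by apply/hasP; exists a; rewrite //= subrr.
(* At a root of the polynomial on this circle [|f|] would be at most [e1], hence at most [k / 2]. *)
have noroot s k : (forall z, cabs z = expR s -> k <= cabs (f z)) -> s < S -> e1 <= k / 2 -> 0 < k ->
    forall a, a \in m -> s != ln (cabs a).
  move=> Hk sS ek kp a am; apply/eqP => sE.
  have ca : cabs a = expR s by rewrite sE lnK // posrE cabs_gt0 m0.
  have := Ff a; rewrite Fa // subr0 ca => /(_ _).
  have -> : expR s <= expR (S + 1) by rewrite ler_expR; lra.
  by move=> /(_ isT); have := Hk a ca; lra.
have n0 : forall a, a \in m -> s0 != ln (cabs a).
  apply: (noroot _ k0) => //; first exact: lt_trans s1S.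
  by rewrite /e1 ge_min ge_min lexx /= orbT.
have n1 : forall a, a \in m -> s1 != ln (cabs a).
  by apply: (noroot _ k1) => //; rewrite /e1 ge_min ge_min lexx !orbT.
have [S' /andP[SS' S'S] n2] : exists2 S', S < S' < S + 1 & forall a, a \in m -> S' != ln (cabs a).
  have SS1 : S < S + 1 by lra.
  have [//|x [v [h1 h2 h3 h4]]] := @avoid_bad R C m (fun a d => d = ln (cabs a)) S (S + 1) SS1.
    by move=> a x y _ _ -> ->.
  exists ((x + v) / 2); first by apply/andP; split; lra.
  by move=> a am; apply/eqP; apply: h4 => //; apply/andP; split; lra.
have s1S' : s1 < S' by exact: lt_trans SS'.
(* The prescribed zeros keep their given arguments; the added roots get some argument in the same
   window. *)
pose ang' a := if a \in l then ang a else xget 0 [set x | t0 - twopi <= x < t0 /\ a = expw (ln (cabs a)) x].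
have Hang a : a \in m -> t0 - twopi <= ang' a < t0 /\ a = expw (ln (cabs a)) (ang' a).
  move=> am; rewrite /ang'; case: ifPn => [/hl[]//|_].
  have [x hx ax] := angle_window (t0 - twopi) (m0 a am); rewrite subrK in hx.
  exact: (@xgetPex _ 0 [set x | t0 - twopi <= x < t0 /\ a = expw (ln (cabs a)) x] (ex_intro _ x (conj hx ax))).
(* Rotating the angles [t i] by [d] amounts to evaluating [Phi3] at [ang a - d]. The roots in [rs]
   contribute nonnegative terms and are dropped. *)
have key d : 0 < d -> d < t0 + twopi *+ 2 - (u + twopi / p) -> (forall a i, a \in m -> cos (t i + d - ang' a) != 1) ->
    twopi * \sum_(a <- l) kap2 p S' (ln (cabs a)) * Phi3 p w t (ang a - d) <= p * tau * S' + green_const p s0 s1 Lg tau m1.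
  move=> d0 dp hd.
  apply: le_trans (@poly_count (fun i => t i + d) s0 s1 S' ang' c m Lg tau m1 _ _ _ _ s01 s1S' c0 _ L0 T0 m10 _ _).
  - apply: ler_wpM2l; first exact: ltW.
    rewrite big_cat /= -[leLHS]addr0; apply: lerD.
      rewrite le_eqVlt; apply/orP; left; apply/eqP; apply: eq_big_seq => a al.
      have [/andP[h1 h2] _ _] := hl a al.
      rewrite Phi3_shift /ang' al /kap12; rewrite [ln (cabs a) < s1]lt_gtF // andbF h1 (lt_trans h2 SS') //.
    by apply: sumr_ge0 => a _; apply: mulr_ge0; [exact: kap12_ge0|rewrite Phi3_shift].
  - rewrite -[RHS](balanced_cos bc bs (- d)); apply: eq_bigr => i _; congr (_ * cos (_ * _)); ring.
  - rewrite -[RHS](balanced_sin bc bs (- d)); apply: eq_bigr => i _; congr (_ * sin (_ * _)); ring.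
  - move=> i; have /andP[h1 h2] := ht i; apply/andP; split; first by lra.
    by lra.
  - by move=> y; rewrite phi_shift.
  - move=> a am; have [h1 h2] := Hang a am; split; first exact: m0.
    by split=> // [|i]; [split; [exact: n0|exact: n1|exact: n2]|exact: hd].
  - move=> s x /andP[_ hs].
    have hz : cabs (expw s x) <= expR (S + 1) by rewrite cabs_expw ler_expR; lra.
    set F := _ * _; have -> : F = f (expw s x) - (f (expw s x) - F) by ring.
    apply: le_trans (cabsB _ _) _; apply: le_trans (lerD (fK _) (Ff _ hz)) _.
    have e11 : e1 <= 1 by rewrite /e1 ge_min lexx.
    rewrite expRD lnK ?posrE; last by lra.
    have -> : cabs (expw s x) `^ p = expR (p * s) by rewrite cabs_expw /powR gt_eqF ?expR_gt0 // expRK.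
    rewrite mulrDl; apply: lerD => //; apply: le_trans e11 _; rewrite mul1r.
    by rewrite -expR0 ler_expR mulr_ge0 // expR_ge0.
  - move=> x; have hz : cabs (expw s1 x) <= expR (S + 1) by rewrite cabs_expw ler_expR; lra.
    have h1 := Hk1 (expw s1 x) (cabs_expw _ _).
    have h2 := Ff _ hz; set F := _ * _ in h2 *.
    have h3 := cabs_lbD (f (expw s1 x)) (- (f (expw s1 x) - F)).
    rewrite cabsN (_ : _ + - (_ - F) = F) in h3; last by ring.
    have e12 : e1 <= k1 / 2 by rewrite /e1 ge_min ge_min lexx !orbT.
    apply: (@le_trans _ _ (k1 / 2)); last by lra.
    rewrite -[leRHS]lnK ?posrE ?divr_gt0 // ler_expR lerNl /m1 le_max.
    by rewrite lexx orbT.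
pose W := \sum_(a <- l) kap2 p S' (ln (cabs a)).
have kp a : a \in l -> 0 <= kap2 p S' (ln (cabs a)).
  by move=> /hl[/andP[_ h] _ _]; apply: kap2_ge0 => //; apply: ltW; exact: lt_trans SS'.
have W0 : 0 <= W by rewrite /W big_seq; apply: sumr_ge0 => a /kp.
have Wc0 : 0 < twopi * (3 * p) * W + 1 by rewrite ltr_wpDl // !mulr_ge0 // ltW.
apply/ler_addgt0Pr => e e0.
have pp : 0 < t0 + twopi *+ 2 - (u + twopi / p) by rewrite subr_gt0.
(* By the Lipschitz bound of [Phi3] the rotation costs [2 pi] times [3 p d W], at most [e] by the
   first entry; the second makes the bad value of each pair unique, as [avoid_bad] requires, and the
   third keeps the angles in the window. *)
pose dm := Num.min (Num.min (e / (twopi * (3 * p) * W + 1)) twopi) (t0 + twopi *+ 2 - (u + twopi / p)).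
have dm0 : 0 < dm by rewrite !lt_min pp pi2 divr_gt0.
have [d /andP[d0 dd] hd] : exists2 d, 0 < d < dm & forall a i, a \in m -> cos (t i + d - ang' a) != 1.
  have := @avoid_bad R ('I_n * C)%type [seq (i, a) | i <- enum 'I_n, a <- m]
    (fun ia d => cos (t ia.1 + d - ang' ia.2) = 1) 0 dm dm0.
  case.
    move=> [i a] x y /andP[x0 x1] /andP[y0 y1] /=.
    have dmt : dm <= twopi by rewrite /dm !ge_min lexx orbT.
    rewrite (addrAC _ x) (addrAC _ y); apply: cos_eq1_unique.
    by rewrite ltr_norml; apply/andP; split; lra.
  move=> x [v [h1 h2 h3 h4]]; exists ((x + v) / 2); first by apply/andP; split; lra.
  move=> a i am; apply/eqP; apply: (h4 (i, a)); last by apply/andP; split; lra.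
  by apply: allpairs_f => //; rewrite mem_enum.
have dp : d < t0 + twopi *+ 2 - (u + twopi / p) by move: dd; rewrite /dm lt_min => /andP[].
have := key d d0 dp hd.
have h1 : \sum_(a <- l) kap2 p S (ln (cabs a)) * Phi3 p w t (ang a) <=
    \sum_(a <- l) kap2 p S' (ln (cabs a)) * Phi3 p w t (ang a - d) + 3 * p * d * W.
  rewrite /W mulr_sumr -big_split /= big_seq [leRHS]big_seq; apply: ler_sum => a al.
  apply: (@le_trans _ _ (kap2 p S' (ln (cabs a)) * Phi3 p w t (ang a))).
    by apply: ler_wpM2r => //; apply: kap2_leS; exact: ltW.
  rewrite [X in _ + X]mulrC -mulrDr; apply: ler_wpM2l; first exact: kp.
  have := @Phi3_lipschitz R p n w t p0 w0 w1 (ang a) (ang a - d).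
  rewrite subKr (gtr0_norm d0) => h; have := le_trans (ler_norm _) h; lra.
have h2 : twopi * (3 * p) * W * d <= e.
  have := dd; rewrite /dm !lt_min => /andP[/andP[h _] _].
  rewrite ltr_pdivlMr // mulrDr mulr1 in h; rewrite mulrC; apply: ltW.
  by apply: le_lt_trans h; rewrite lerDl ltW.
have h3 := ler_wpM2l (ltW pi2) h1.
have h4 : p * tau * S' <= p * tau * S + p * tau.
  have -> : p * tau * S + p * tau = p * tau * (S + 1) by ring.
  by apply: ler_wpM2l; [rewrite mulr_ge0 // ltW|exact: ltW].
move: h2 h3 h4; rewrite mulrDr.
have -> : twopi * (3 * p * d * W) = twopi * (3 * p) * W * d by ring.
lra.
Qed.
End UpperCount.

(** * The angular density *)

Section CircleMeasure.
Context {R : realType}.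
Local Notation twopi := ((pi : R) *+ 2).
Local Notation mR := (measurableTypeR R).
Variable D : {measure set mR -> \bar R}.
Hypothesis hD : circle_measure D.
Implicit Types (x y u v a b : R) (F G : R -> R).

Lemma measure_shiftX (A : set mR) (n : nat) : measurable A ->
  measurable ([set x + twopi * n%:R | x in A] : set mR) /\ D [set x + twopi * n%:R | x in A] = D A.
Proof.
move=> mA; have [h _] := hD; elim: n => [|n [mB IH]].
  by rewrite (_ : [set _ | _ in _] = A) // mulr0; under eq_fun do rewrite addr0; rewrite image_id.
have E : [set x + twopi * n.+1%:R | x in A] = [set x + twopi | x in [set x + twopi * n%:R | x in A]].
  rewrite image_comp; apply: eq_imagel => x _ /=; rewrite -natr1; ring.
rewrite E; split; last by rewrite h.
have -> : [set x + twopi | x in [set x + twopi * n%:R | x in A]] =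
   (fun x : mR => x - twopi) @^-1` [set x + twopi * n%:R | x in A].
  apply/seteqP; split=> x /=; first by move=> [y hy <-]; rewrite addrK.
  by move=> hx; exists (x - twopi) => //; rewrite subrK.
rewrite -[X in measurable X]setTI.
have : measurable_fun setT (fun x : mR => (x - twopi : R)).
  by apply: measurable_funB => //; exact: measurable_id.
by move/(_ measurableT _ mB).
Qed.

Lemma measure_window_lty (n : nat) : (D `[(- (twopi * n%:R))%R, (twopi * n%:R)%R[%classic < +oo)%E.
Proof.
have p2 := @twopi_gt0 R; have [_ h0] := hD.
elim: n => [|n IH]; first by rewrite mulr0 oppr0 set_itvco0 measure0.
have A1 : (D `[(twopi * n%:R)%R, (twopi * n.+1%:R)%R[%classic < +oo)%E.
  have [_] := @measure_shiftX `[0%R, twopi[%classic n (measurable_itv _).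
  rewrite (_ : [set _ | _ in _] = `[(twopi * n%:R)%R, (twopi * n.+1%:R)%R[%classic).
    by move=> ->.
  rewrite -natr1; apply/seteqP; split=> x /=.
    by move=> [y]; rewrite !in_itv /= => h1 <-; lra.
  by rewrite in_itv /= => h1; exists (x - twopi * n%:R); rewrite ?subrK // in_itv /=; lra.
have A2 : (D `[(- (twopi * n.+1%:R))%R, (- (twopi * n%:R))%R[%classic < +oo)%E.
  have [_] := @measure_shiftX `[(- (twopi * n.+1%:R))%R, (- (twopi * n%:R))%R[%classic n.+1 (measurable_itv _).
  rewrite (_ : [set _ | _ in _] = `[0%R, twopi[%classic) => [<- //|].
  rewrite -natr1; apply/seteqP; split=> x /=.
    by move=> [y]; rewrite !in_itv /= => h1 <-; lra.
  by rewrite in_itv /= => h1; exists (x - twopi * (n%:R + 1)); rewrite ?subrK // in_itv /=; lra.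
have n0 : 0 <= twopi * n%:R by rewrite mulr_ge0 // ltW.
have n1 : twopi * n%:R <= twopi * n.+1%:R by rewrite ler_pM2l // ler_nat.
apply: (@le_lt_trans _ _ (D `[(- (twopi * n.+1%:R))%R, (- (twopi * n%:R))%R[%classic +
   (D `[(- (twopi * n%:R))%R, (twopi * n%:R)%R[%classic + D `[(twopi * n%:R)%R, (twopi * n.+1%:R)%R[%classic))%E); last first.
  by rewrite !lte_add_pinfty.
have -> : `[(- (twopi * n.+1%:R))%R, (twopi * n.+1%:R)%R[%classic =
  `[(- (twopi * n.+1%:R))%R, (- (twopi * n%:R))%R[%classic `|` (`[(- (twopi * n%:R))%R, (twopi * n%:R)%R[%classic `|`
    `[(twopi * n%:R)%R, (twopi * n.+1%:R)%R[%classic).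
  by rewrite -!itv_bndbnd_setU // bnd_simp; lra.
by apply: le_trans (measureU2 _ _ _) _ => //; [exact: measurableU|apply: leeD2l; exact: measureU2].
Qed.

Lemma bounded_in_window u v : exists n : nat,
  `[u, v]%classic `<=` `[(- (twopi * n%:R))%R, (twopi * n%:R)%R[%classic.
Proof.
have p2 := @twopi_gt0 R.
pose M := `|u| + `|v|; exists (Num.trunc (M / twopi)).+1.
have /andP[_] := @Num.Theory.trunc_itv R _ (divr_ge0 (addr_ge0 (normr_ge0 u) (normr_ge0 v)) (ltW p2)).
rewrite -/M ltr_pdivrMr // mulrC => h x /=; rewrite !in_itv /= => /andP[h1 h2].
have := ler_norm v; have := ler_norm (- u); rewrite normrN => h3 h4.
have := normr_ge0 u; have := normr_ge0 v; rewrite /M in h; lra.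
Qed.

Lemma measure_lty u v : (D `[u, v]%classic < +oo)%E.
Proof.
have [n hn] := bounded_in_window u v.
by apply: le_lt_trans (measure_window_lty n); apply: le_measure; rewrite ?inE.
Qed.

Lemma measure_oc_lty u v : (D `]u, v]%classic < +oo)%E.
Proof.
apply: le_lt_trans (measure_lty u v); apply: le_measure; rewrite ?inE //.
exact: subset_itv_oc_cc.
Qed.

Lemma measure_seq_atoms (s : seq R) c : uniq s -> (forall x, x \in s -> c%:E <= D [set x])%E ->
  measurable ([set x | x \in s] : set mR) /\ (((size s)%:R * c)%:E <= D [set x | x \in s])%E.
Proof.
elim: s => [_ _|y s IH /= /andP[ys us] h].
  have -> : [set x : R | x \in [::]] = set0 by apply/seteqP; split.
  by rewrite mul0r measure0; split.
have [ms hs] := IH us (fun x xs => h x (mem_behead (s := y :: s) xs)).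
have E : [set x : R | x \in y :: s] = [set y] `|` [set x | x \in s].
  apply/seteqP; split=> x /=; first by rewrite inE => /predU1P.
  by move=> /predU1P; rewrite inE.
rewrite E; split; first exact: measurableU.
rewrite measureU //; last first.
  by apply/seteqP; split=> x //= [-> xs]; rewrite xs in ys.
rewrite -natr1 mulrDl mul1r EFinD addeC; apply: leeD => //.
by apply: h; rewrite mem_head.
Qed.

(** A bounded window has finite mass and so contains finitely many atoms of mass at least
    [1 / (m + 1)]; windows and [m] range over countable sets. *)
Lemma countable_atoms : countable [set x : R | D [set x] != 0%E].
Proof.
pose A (nm : nat * nat) := [set x : R | x \in `[(- (twopi * nm.1%:R))%R, (twopi * nm.1%:R)%R[%classic /\
   ((nm.2.+1%:R^-1)%:E <= D [set x])%E].
apply: (@sub_countable _ _ _ (\bigcup_(nm in setT) A nm)); last first.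
  apply: bigcup_countable => // -[n m] _; apply: finite_set_countable.
  apply: contrapT => inf; have K0 := measure_window_lty n.
  set K := `[_, _[%classic in K0.
  have Kf : D K \is a fin_num by rewrite ge0_fin_numE.
  pose N := (Num.trunc (fine (D K) * m.+1%:R)).+1.
  have [B BA hB] := infinite_set_fset N inf.
  have [|] := @measure_seq_atoms (finmap.enum_fset B) m.+1%:R^-1 (finmap.fset_uniq B).
    by move=> x xB; have [] := BA x xB.
  move=> mB le1; have le2 : (D [set x | x \in finmap.enum_fset B] <= D K)%E.
    apply: le_measure; [exact: mem_set|apply: mem_set; exact: measurable_itv|].
    by move=> x xB; have [hx _] := BA x xB; exact: set_mem hx.
  have := le_trans le1 le2; rewrite -(fineK Kf) lee_fin ler_pdivrMr // leNgt => /negP; apply.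
  have /andP[_ h] := @Num.Theory.trunc_itv R _ (mulr_ge0 (fine_ge0 (measure_ge0 D K)) (ler0n R m.+1)).
  by apply: lt_le_trans h _; rewrite ler_nat.
apply: subset_card_le => x /= hx.
have [n hn] := bounded_in_window x x.
have xn : x \in `[(- (twopi * n%:R))%R, (twopi * n%:R)%R[%classic.
  by apply/mem_set; apply: hn; rewrite /= in_itv /= lexx.
have Dx : (D [set x] < +oo)%E.
  by rewrite -set_itv1; exact: measure_lty.
have Df : D [set x] \is a fin_num by rewrite ge0_fin_numE.
have d0 : 0 < fine (D [set x]).
  by rewrite lt_neqAle fine_ge0 // andbT eq_sym fine_eq0.
exists (n, Num.trunc (fine (D [set x]))^-1) => //; split => //=.
rewrite -(fineK Df) lee_fin -[leRHS]invrK lef_pV2 ?posrE ?invr_gt0 //.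
have /andP[_ /ltW] := @Num.Theory.trunc_itv R (fine (D [set x]))^-1 ltac:(by rewrite invr_ge0 ltW).
done.
Qed.
End CircleMeasure.

(** * Integrals against a periodic measure *)

Section CircleIntegral.
Context {R : realType}.
Local Notation twopi := ((pi : R) *+ 2).
Local Notation mR := (measurableTypeR R).
Variable D : {measure set mR -> \bar R}.
Hypothesis hD : circle_measure D.
Implicit Types (x y u v a b : R) (F G : R -> R).

Lemma integrable_continuous F u v : continuous F -> D.-integrable `]u, v]%classic (EFin \o F).
Proof.
move=> cF; apply: measurable_bounded_integrable; first exact: measurable_itv.
- exact: measure_oc_lty.
- by apply: measurable_funTS; exact: continuous_measurable_fun.
have [uv|vu] := leP u v; last first.
  exists 0; split; first exact: real0.
  by move=> M M0 x; rewrite /= in_itv /= => /andP[h1 h2]; have := lt_le_trans h1 h2; rewrite ltNge (ltW vu).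
have [M M0 hM] := segment_bounded cF uv.
exists M; split; first exact: num_real.
move=> M' MM' x; rewrite /= in_itv /= => /andP[h1 h2].
by apply: le_trans (ltW MM'); apply: hM; rewrite h2 andbT ltW.
Qed.

Lemma Rint_cat F u v b : continuous F -> u <= v -> v <= b ->
  \int[D]_(x in `]u, b]) F x = \int[D]_(x in `]u, v]) F x + \int[D]_(x in `]v, b]) F x.
Proof.
move=> cF uv vb.
have E : `]u, b]%classic = `]u, v]%classic `|` `]v, b]%classic.
  by rewrite -itv_bndbnd_setU // bnd_simp.
rewrite E Rintegral_setU //.
- by rewrite -E; exact: integrable_continuous.
apply/disj_setPS => x /= [/=]; rewrite !in_itv /= => /andP[_ h1] /andP[h2 _].
by have := lt_le_trans h2 h1; rewrite ltxx.
Qed.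

(** Periodicity of [D] says that its image under translation by [2 pi] is [D] itself. *)
Lemma Rint_shift F u v : continuous F ->
  \int[D]_(x in `]u + twopi, v + twopi]) F x = \int[D]_(x in `]u, v]) F (x + twopi).
Proof.
move=> cF; rewrite /Rintegral; congr fine.
have csh : continuous (fun x : R => x + twopi).
  by move=> x; apply: cvgD; [exact: cvg_id|exact: cvg_cst].
pose sh (x : mR) : mR := x + twopi.
have msh : measurable_fun setT sh by exact: continuous_measurable_fun.
have preE : sh @^-1` `]u + twopi, v + twopi]%classic = `]u, v]%classic.
  by apply/seteqP; split=> x; rewrite /= !in_itv /= /sh ltrD2r lerD2r.
have cFs : continuous (F \o (fun x => x + twopi)).
  by move=> x; apply: continuous_comp; [exact: csh|exact: cF].
pose A : set mR := `]u + twopi, v + twopi]%classic.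
rewrite -/A in preE *.
transitivity (\int[pushforward D sh]_(x in A) (F x)%:E)%E.
  apply: eq_measure_integral => B mB _; rewrite -[RHS]/(D (sh @^-1` B)).
  have [h _] := hD; rewrite -(h (sh @^-1` B)); last first.
    by rewrite -[X in measurable X]setTI; exact: msh.
  congr (D _); apply/seteqP; split=> x /=.
    by move=> Bx; exists (x - twopi); rewrite /= /sh subrK.
  by move=> [y By <-].
rewrite (@integral_pushforward _ _ mR mR R sh msh D A (EFin \o F)) //.
- by rewrite preE.
- by apply/measurable_EFinP; exact: continuous_measurable_fun.
- by rewrite preE; exact: (integrable_continuous u v cFs).
exact: measurable_itv.
Qed.

Lemma Rint_lin (c d : R) F G u v : continuous F -> continuous G ->
  \int[D]_(x in `]u, v]) (c * F x + d * G x) =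
  c * \int[D]_(x in `]u, v]) F x + d * \int[D]_(x in `]u, v]) G x.
Proof.
move=> cF cG.
have cZ (e : R) H : continuous H -> continuous (fun x => e * H x).
  by move=> cH x; apply: cvgM; [exact: cvg_cst|exact: cH].
have iF := integrable_continuous u v cF; have iG := integrable_continuous u v cG.
have iF' := integrable_continuous u v (cZ c _ cF); have iG' := integrable_continuous u v (cZ d _ cG).
by rewrite RintegralD // !RintegralZl.
Qed.

Lemma Rint_sum (n : nat) (w : 'I_n -> R) (F : 'I_n -> R -> R) u v : (forall i, continuous (F i)) ->
  \int[D]_(x in `]u, v]) (\sum_i w i * F i x) = \sum_i w i * \int[D]_(x in `]u, v]) F i x.
Proof.
move=> cF; elim: n w F cF => [|n IH] w F cF.
  rewrite big_ord0; under eq_Rintegral do rewrite big_ord0.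
  by rewrite Rintegral_cst ?mul0r.
rewrite big_ord_recl -IH //.
have cs : continuous (fun x => \sum_(i < n) w (lift ord0 i) * F (lift ord0 i) x).
  apply: continuous_sum => i; apply: continuousM2; [exact: cst_continuous|exact: cF].
rewrite -[in RHS](mul1r (\int[D]_(x in _) (\sum_(i < n) _))) -Rint_lin //.
by apply: eq_Rintegral => x _; rewrite big_ord_recl mul1r.
Qed.

Lemma Rint_le F G u v : continuous F -> continuous G -> (forall x, u < x <= v -> F x <= G x) ->
  \int[D]_(x in `]u, v]) F x <= \int[D]_(x in `]u, v]) G x.
Proof.
move=> cF cG FG.
apply: (@le_Rintegral _ mR R D _ F G); [exact: measurable_itv|exact: integrable_continuous|exact: integrable_continuous|].
by move=> x; rewrite /= in_itv /=; exact: FG.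
Qed.

Definition arc_mass u v := fine (D `]u, v]%classic).

Lemma arc_mass_ge0 u v : 0 <= arc_mass u v.
Proof. exact: fine_ge0. Qed.

Lemma arc_mass_cat u v b : u <= v -> v <= b -> arc_mass u b = arc_mass u v + arc_mass v b.
Proof.
move=> uv vb; have := Rint_cat (@cst_continuous R R 1) uv vb.
by rewrite !Rintegral_cst // !mul1r.
Qed.

Lemma Rint_arc F K u v : (forall x y, `|F x - F y| <= K * `|x - y|) -> u <= v ->
  `|\int[D]_(x in `]u, v]) F x - F u * arc_mass u v| <= K * (v - u) * arc_mass u v.
Proof.
move=> LF uv; have cF := lipschitz_continuous LF.
have K0 : 0 <= K by have := le_trans (normr_ge0 _) (LF 1 0); rewrite subr0 normr1 mulr1.
have H x : u < x <= v -> - (K * (v - u)) <= F x - F u <= K * (v - u).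
  move=> /andP[h1 h2]; rewrite -ler_norml; apply: le_trans (LF x u) _; apply: ler_wpM2l => //.
  by rewrite ger0_norm ?subr_ge0 ?(ltW h1) // lerB.
have h1 : \int[D]_(x in `]u, v]) F x <= \int[D]_(x in `]u, v]) (F u + K * (v - u)).
  by apply: Rint_le => //; [exact: cst_continuous|move=> x /H/andP[]; lra].
have h2 : \int[D]_(x in `]u, v]) (F u - K * (v - u)) <= \int[D]_(x in `]u, v]) F x.
  by apply: Rint_le => //; [exact: cst_continuous|move=> x /H/andP[]; lra].
rewrite Rintegral_cst // -/(arc_mass u v) in h1; rewrite Rintegral_cst // -/(arc_mass u v) in h2.
by rewrite ler_norml; apply/andP; split; lra.
Qed.

Lemma Rint_riemann F K a (d : R) (N : nat) : (forall x y, `|F x - F y| <= K * `|x - y|) -> 0 <= d ->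
  `|\int[D]_(x in `]a, a + d * N%:R]) F x - \sum_(j < N) F (a + d * j%:R) * arc_mass (a + d * j%:R) (a + d * j.+1%:R)| <=
  K * d * arc_mass a (a + d * N%:R).
Proof.
move=> LF d0; have cF := lipschitz_continuous LF.
elim: N => [|N IH].
  rewrite mulr0 addr0 /arc_mass set_itvoc0 Rintegral_set0 big_ord0 measure0 /=.
  by rewrite mulr0 subrr normr0.
have l1 : a <= a + d * N%:R by rewrite lerDl mulr_ge0.
have l2 : a + d * N%:R <= a + d * N.+1%:R by rewrite lerD2l ler_wpM2l // ler_nat.
have := Rint_arc LF l2.
rewrite (_ : a + d * N.+1%:R - (a + d * N%:R) = d); last by rewrite -natr1; ring.
move=> H; rewrite big_ord_recr /= (Rint_cat cF l1 l2) (arc_mass_cat l1 l2) mulrDr.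
apply: le_trans (lerD IH H); apply: le_trans (ler_normD _ _); rewrite le_eqVlt; apply/orP; left; apply/eqP.
by congr (`|_|); ring.
Qed.

End CircleIntegral.

(** * The indicator as an integral over a fixed window *)

Section HFormula.
Context {R : realType}.
Local Notation twopi := ((pi : R) *+ 2).
Local Notation mR := (measurableTypeR R).
Variable D : {measure set mR -> \bar R}.
Hypothesis hD : circle_measure D.
Variables (p : R).
Hypothesis p0 : 0 < p.
Implicit Types (x y u v a b th : R).

(* [h_measure p D th] is the integral of [kerh (th - x)] over [(th - 2 pi, th]];
   both forms satisfy [kerh (y - 2 pi) = kerh y + 2 pi sin (p (y - 2 pi))]. *)
Definition kerh y := if p \is a Num.nat then - (y * sin (p * y))
  else pi / sin (pi * p) * cos (p * (y - pi)).

(** As [sin^2] has period [pi], [p] may be replaced by its fractional part [x], and [sin (pi x) > 0]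
    for [0 < x < 1]. *)
Lemma sin_pi_neq0 : p \isn't a Num.nat -> sin (pi * p) != 0.
Proof.
apply: contraNneq => s0.
have sinn (m : nat) y : sin (y + pi * m%:R) ^+ 2 = sin y ^+ 2.
  elim: m => [|m IH]; first by rewrite mulr0 addr0.
  by rewrite -natr1 mulrDr mulr1 addrA sinDpi sqrrN.
pose n := Num.trunc p; have /andP[h1 h2] := @Num.Theory.trunc_itv R p (ltW p0).
rewrite -/n -natr1 in h1 h2; pose x := p - n%:R.
have x0 : x = 0.
  have xx : 0 <= x < 1 by rewrite /x; apply/andP; split; lra.
  have [//|xn0] := eqVneq x 0.
  have : 0 < sin (pi * x).
    move: xx => /andP[xa xb]; apply: sin_gt0_pi; rewrite -[X in _ < _ < X]mulr1.
    by rewrite ltr_pM2l ?pi_gt0 // xb andbT mulr_gt0 ?pi_gt0 // lt_neqAle eq_sym xn0.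
  have : sin (pi * x) ^+ 2 = 0.
    by rewrite -(sinn n) -mulrDr /x subrK s0 expr0n.
  by move=> /eqP; rewrite sqrf_eq0 => /eqP ->; rewrite ltxx.
by rewrite -(subrK n%:R p) -/x x0 add0r; exact: Num.Theory.natr_nat.
Qed.

Lemma kerh_2pi y : kerh y = kerh (y + twopi) + twopi * sin (p * y).
Proof.
rewrite /kerh; case: ifPn => [/Num.Theory.natrP[n pn]|/sin_pi_neq0 s0].
  have -> : sin (p * (y + twopi)) = sin (p * y).
    have := congr1 (@complex.Im R) (@expi_periodic R (p * y) n); rewrite /= => <-.
    by rewrite {1}pn; congr sin; rewrite pn; ring.
  by ring.
have -> : cos (p * (y + twopi - pi)) = cos (p * y + pi * p).
  by congr cos; rewrite mulr2n; ring.
have -> : cos (p * (y - pi)) = cos (p * y - pi * p) by congr cos; ring.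
rewrite cosB cosD mulr2n; field.
done.
Qed.

Lemma continuous_kerh : continuous kerh.
Proof.
rewrite /kerh; case: (p \is a Num.nat).
  move=> x; apply: cvgN; apply: continuousM2; [by move=> y; exact: cvg_id|exact: continuous_sinM].
apply: continuousM2; first exact: cst_continuous.
move=> x; apply: (@continuous_comp R R R (fun x => x - pi) (fun x => cos (p * x))).
  by apply: cvgB; [exact: cvg_id|exact: cvg_cst].
exact: continuous_cosM.
Qed.

Lemma h_measure_kerh th : h_measure p D th =
  \int[D]_(x in `]th - twopi, th]) kerh (th - x).
Proof.
rewrite /h_measure /kerh; case: ifPn => pn.
  rewrite -mulN1r -RintegralZl //.
    apply: eq_Rintegral => x _; rewrite mulN1r -(opprB x th) mulrN sinN; ring.
  apply: integrable_continuous => //.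
  rewrite (_ : (fun x => _) = fun x => - (kerh (th - x))); last first.
    by apply/funext => x; rewrite /kerh pn -(opprB x th) mulrN sinN; ring.
  by move=> x; apply: cvgN; exact: (@continuous_subr R _ th continuous_kerh).
rewrite -RintegralZl //.
apply: integrable_continuous => //.
apply: (@continuous_subr R (fun y => cos (p * (y - pi))) th).
move=> x; apply: (@continuous_comp R R R (fun x => x - pi) (fun x => cos (p * x))).
  by apply: cvgB; [exact: cvg_id|exact: cvg_cst].
exact: continuous_cosM.
Qed.

Lemma kerhX y (k : nat) :
  kerh y = kerh (y + twopi * k%:R) + twopi * \sum_(i < k) sin (p * (y + twopi * i%:R)).
Proof.
elim: k => [|k IH]; first by rewrite mulr0 addr0 big_ord0 mulr0 addr0.
rewrite IH big_ord_recr /= kerh_2pi -natr1.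
rewrite (_ : y + twopi * k%:R + twopi = y + twopi * (k%:R + 1)); last by ring.
by ring.
Qed.

(* [kerh] corrected so as to integrate over a fixed window for all [th] in an
   interval of length [6 pi]. *)
Definition ker3 y := kerh y - twopi * sin (p * y) + twopi * \sum_(j < 3) sinp p (y - twopi * j%:R).

(** Beyond [sinp p y], the positive parts present at [y + 2 pi k] are the [k] sines that [kerhX]
    produces when [kerh] is moved by [k] periods. *)
Lemma ker3_shift y (k : nat) : (k < 3)%N -> - twopi <= y < twopi ->
  ker3 (y + twopi * k%:R) = kerh y - twopi * sin (p * y) + twopi * sinp p y.
Proof.
move=> k3 /andP[y1 y2]; rewrite /ker3 [in RHS](kerhX y k).
have p2 := @twopi_gt0 R.
have E : \sum_(j < 3) sinp p (y + twopi * k%:R - twopi * j%:R) - sin (p * (y + twopi * k%:R)) =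
   sinp p y + \sum_(i < k) sin (p * (y + twopi * i%:R)) - sin (p * y).
  rewrite !big_ord_recl big_ord0 /= /bump /=.
  case: k k3 => [|[|[|//]]] _; rewrite ?big_ord_recl ?big_ord0 /= /bump /= ?mulr0 ?mulr1 ?subr0 ?addr0 ?addrK.
  - rewrite (@sinp_neg R p (y - twopi)); last by lra.
    by rewrite (@sinp_neg R p (y - twopi * 2)); [ring|lra].
  - rewrite (@sinp_neg R p (y + twopi - twopi * 2)); last by lra.
    rewrite (@sinp_pos R p (y + twopi)); last by lra.
    by ring.
  - rewrite (@sinp_pos R p (y + twopi * 2)); last by lra.
    rewrite (_ : y + twopi * 2 - twopi = y + twopi); last by ring.
    by rewrite (@sinp_pos R p (y + twopi)); [ring|lra].
have := congr1 (fun z => twopi * z) E; rewrite /= !mulrDr !mulrN; lra.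
Qed.

Lemma continuous_ker3 : continuous ker3.
Proof.
have cD (f g : R -> R) : continuous f -> continuous g -> continuous (fun x => f x + g x).
  by move=> cf cg x; apply: cvgD; [exact: cf|exact: cg].
have cZ (c : R) f : continuous f -> continuous (fun x => c * f x).
  by move=> cf; apply: continuousM2; [exact: cst_continuous|].
apply/cD; first apply/cD.
- exact: continuous_kerh.
- by move=> x; apply: cvgN; apply: (cZ twopi _ (@continuous_sinM R p)).
apply/cZ/continuous_sum => j x.
apply: (@continuous_comp R R R (fun x => x - twopi * j%:R) (sinp p)).
  by apply: cvgB; [exact: cvg_id|exact: cvg_cst].
exact: continuous_sinp.
Qed.

Lemma h_measure_2pi th : h_measure p D (th + twopi) = h_measure p D th.
Proof.
rewrite !h_measure_kerh addrK -{1}(subrK twopi th) Rint_shift //; last first.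
  exact: (@continuous_subr R _ (th + twopi) continuous_kerh).
by apply: eq_Rintegral => x _; congr kerh; ring.
Qed.

Lemma h_measure_2piX th (k : nat) : h_measure p D (th + twopi * k%:R) = h_measure p D th.
Proof.
elim: k => [|k IH]; first by rewrite mulr0 addr0.
by rewrite -natr1 mulrDr mulr1 addrA h_measure_2pi.
Qed.

(** Periodicity brings [th] to some [s] in [(a, a + 2 pi]]. The part of [(s - 2 pi, s]] to the left
    of [a] is moved up by one period, at the price of a sine by [kerh_2pi]; the [sinp] term switches
    between the two cases at [x = s]. *)
Lemma h_measure_window a th : a < th <= a + twopi * 3 ->
  h_measure p D th = \int[D]_(x in `]a, a + twopi]) ker3 (th - x).
Proof.
move=> /andP[ath tha]; have p2 := @twopi_gt0 R.
have [k k3 /andP[h1 h2]] : exists2 k : nat, (k < 3)%N & a < th - twopi * k%:R <= a + twopi.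
  have [c1|c1] := leP th (a + twopi); first by exists 0%N => //; rewrite mulr0 subr0 ath.
  have [c2|c2] := leP th (a + twopi * 2); first by exists 1%N => //; apply/andP; split; lra.
  by exists 2%N => //; apply/andP; split; lra.
pose s := th - twopi * k%:R.
have thE : th = s + twopi * k%:R by rewrite /s subrK.
rewrite -/s in h1 h2; rewrite thE h_measure_2piX h_measure_kerh.
have c1 := @continuous_subr R _ s continuous_kerh.
pose G y := kerh y - twopi * sin (p * y) + twopi * sinp p y.
have cG : continuous (fun x => G (s - x)).
  apply: (@continuous_subr R G s) => x; rewrite /G.
  apply: cvgD; last by apply: cvgM; [exact: cvg_cst|exact: continuous_sinp].
  apply: cvgB; first exact: continuous_kerh.
  by apply: cvgM; [exact: cvg_cst|exact: continuous_sinM].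
transitivity (\int[D]_(x in `]a, a + twopi]) G (s - x)); last first.
  apply: eq_Rintegral => x; rewrite inE /= in_itv /= => /andP[x1 x2].
  rewrite (_ : s + twopi * k%:R - x = s - x + twopi * k%:R); last by ring.
  by rewrite ker3_shift //; apply/andP; split; lra.
rewrite (@Rint_cat _ _ hD _ (s - twopi) a s) //; [|lra|exact: ltW].
rewrite (@Rint_cat _ _ hD _ a s (a + twopi)) //; [|exact: ltW].
rewrite addrC; congr (_ + _).
  apply: eq_Rintegral => x; rewrite inE /= in_itv /= => /andP[x1 x2].
  by rewrite /G sinp_pos ?subr_ge0 //; ring.
have := Rint_shift hD (s - twopi) a cG; rewrite subrK => ->.
apply: eq_Rintegral => x; rewrite inE /= in_itv /= => /andP[x1 x2].
rewrite /G sinp_neg; last by lra.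
rewrite (kerh_2pi (s - (x + twopi))) (_ : s - (x + twopi) + twopi = s - x); last by ring.
by ring.
Qed.
End HFormula.

(** * Counting points by argument *)

Section Counting.
Context {R : realType}.
Local Notation C := (Cplx R).
Local Notation twopi := ((pi : R) *+ 2).
Local Notation mR := (measurableTypeR R).
Variable L : C -> nat.
Hypothesis hL : discrete L.
Implicit Types (x y u v a b r : R) (z : C).

(** The origin is left out because it has no argument. Points are listed once each; multiplicities
    enter as weights. *)
Definition pts r : seq C :=
  finmap.enum_fset (fset_set [set z : C | (0 < L z)%N /\ 0 < cabs z < r]).

Lemma pts_finite r : finite_set [set z : C | (0 < L z)%N /\ 0 < cabs z < r].
Proof. by apply: sub_finite_set (hL r) => z /= [-> /andP[_ /ltW ->]]. Qed.

Lemma mem_pts r z : (z \in pts r) = (0 < L z)%N && (0 < cabs z < r).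
Proof.
rewrite /pts (in_fset_set (pts_finite r)); apply/idP/idP.
  by move=> /set_mem/= [-> ->].
by move=> /andP[h1 h2]; apply: mem_set.
Qed.

Lemma uniq_pts r : uniq (pts r).
Proof. exact: finmap.fset_uniq. Qed.

Lemma sum_pts_le (F : C -> R) r s : r <= s ->
  \sum_(z <- pts r) F z = \sum_(z <- pts s | cabs z < r) F z.
Proof.
move=> rs; rewrite -[RHS]big_filter; apply: perm_big; apply: uniq_perm.
- exact: uniq_pts.
- by rewrite filter_uniq // uniq_pts.
move=> z; rewrite mem_filter !mem_pts; case: (0 < L z)%N => //=; last by rewrite andbF.
case: (ltP (cabs z) r) => h; last by rewrite andbF.
by rewrite (lt_le_trans h rs).
Qed.

Lemma count_sectorE r a b :
  count_sector L r a b = \sum_(z <- pts r | `[< sector a b z >]) (L z)%:R.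
Proof.
rewrite /count_sector (@fsbigE _ _ _ _ _ [seq z <- pts r | `[< sector a b z >]]).
- rewrite big_filter_cond [LHS]big_seq_cond [RHS]big_seq_cond; apply: eq_bigl => z.
  rewrite mem_pts; case: (0 < L z)%N => //=; case/boolP: (0 < cabs z < r) => //= /andP[_ zr].
  by case/boolP: (`[< sector a b z >]) => //= /asboolP h; apply/mem_set; split.
- by rewrite filter_uniq // uniq_pts.
- move=> z /=; rewrite mem_filter mem_pts => /andP[/asboolP h /andP[_ /andP[_ ->]]]; split => //.
move=> z [/= zr hz]; rewrite mem_filter mem_pts zr andbT (_ : 0 < cabs z); last by case: hz; rewrite cabs_gt0.
by rewrite andbT; case: (L z) => // n; rewrite ltn0Sn andbT => /asboolPn.
Qed.

Definition angz b z := xget 0 [set x | b <= x < b + twopi /\ z = expw (ln (cabs z)) x].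

Lemma angzP b z : z != 0 -> b <= angz b z < b + twopi /\ z = expw (ln (cabs z)) (angz b z).
Proof.
move=> z0; have [x hx ax] := angle_window b z0.
exact: (@xgetPex _ 0 [set x | b <= x < b + twopi /\ z = expw (ln (cabs z)) x] (ex_intro _ x (conj hx ax))).
Qed.

Lemma expw_inj s x y : `|x - y| < twopi -> expw s x = expw s y -> x = y.
Proof.
move=> h E.
have eI (t t' : R) : expw s t = expw s t' -> expi t = expi t' :> C.
  move=> /(congr1 (fun z => ofR (expR s)^-1 * z)) /=; rewrite !mulrA -ofRM mulVf ?ofR1 ?mul1r //.
  by rewrite gt_eqF // expR_gt0.
have := congr1 (fun z => z * expi (- x)) (eI _ _ E).
rewrite -!expiD subrr expi0 => /(congr1 (@complex.Re R)) /= c1.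
apply: (@cos_eq1_unique R (- x)) => //; first by rewrite addNr cos0.
by rewrite addrC -c1.
Qed.

Lemma sector_angz b x y z : b <= x -> x < y -> y <= b + twopi -> z != 0 ->
  `[< sector x y z >] = (x < angz b z < y).
Proof.
move=> bx xy yb z0; have [h1 h2] := angzP b z0.
have lnz : expR (ln (cabs z)) = cabs z by rewrite lnK // posrE cabs_gt0.
apply/asboolP/idP => [[_ [t [ht zt]]]|h]; last first.
  by split => //; exists (angz b z); split => //; rewrite {1}h2 /expw lnz.
suff -> : angz b z = t by [].
apply: (@expw_inj (ln (cabs z))); last by rewrite -h2 /expw lnz.
by rewrite ltr_norml; apply/andP; split; lra.
Qed.

Lemma angz_eq b x z : b <= x < b + twopi -> z != 0 -> z = expw (ln (cabs z)) x -> angz b z = x.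
Proof.
move=> hx z0 E; have [h1 h2] := angzP b z0.
apply: (@expw_inj (ln (cabs z))); last by rewrite -h2.
by rewrite ltr_norml; apply/andP; split; lra.
Qed.

(* The points on the ray of angle [x] are counted as the sector
   [(x - pi, x + pi)] minus its two halves. *)
Lemma half_open_count b r x y : b <= x -> x < y -> y <= b + twopi ->
  \sum_(z <- pts r | x <= angz b z < y) (L z)%:R =
  count_sector L r x y + (count_sector L r (x - pi) (x + pi) - count_sector L r (x - pi) x -
    count_sector L r x (x + pi)) :> R.
Proof.
move=> bx xy yb; have pi0 := @pi_gt0 R.
have p2 : twopi = pi + pi by rewrite mulr2n.
rewrite !count_sectorE !(big_mkcond _ (fun z => (L z)%:R)) /= -!sumrB -big_split /=.
apply: eq_big_seq => z; rewrite mem_pts => /andP[_ /andP[z0 _]].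
rewrite cabs_gt0 in z0.
rewrite (sector_angz bx xy yb z0) !(@sector_angz (x - pi)) //; try lra.
have [h1 h2] := angzP b z0; have [k1 k2] := angzP (x - pi) z0.
move: (L z)%:R => l.
have [e|ne] := eqVneq (angz b z) x.
  have -> : angz (x - pi) z = x.
    by apply: angz_eq => //; [apply/andP; split; lra|rewrite -e].
  have t1 : x - pi < x by lra.
  have t2 : x < x + pi by lra.
  by rewrite e lexx !ltxx t1 t2 xy /= add0r !subr0.
have ne2 : angz (x - pi) z != x.
  apply: contra_neq ne => e; rewrite e in k2.
  by apply: angz_eq => //; lra.
rewrite le_eqVlt eq_sym (negbTE ne) /=.
have -> : angz (x - pi) z < x + pi by lra.
rewrite !andbT -[LHS]addr0; congr (_ + _); set A := angz (x - pi) z in k1 ne2 *.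
have [h|h|h] := ltgtP A x; last by rewrite h eqxx in ne2.
  by rewrite andbT subr0 subrr.
have -> : x - pi < A by lra.
by rewrite andbF subr0 subrr.
Qed.

Lemma split_window (T : Type) (s : seq T) (P : pred T) (an : T -> R) (F : T -> R) b (d : R) (N : nat) : 0 <= d ->
  \sum_(z <- s | P z && (b <= an z < b + d * N%:R)) F z =
  \sum_(j < N) \sum_(z <- s | P z && (b + d * j%:R <= an z < b + d * j.+1%:R)) F z.
Proof.
move=> d0; elim: N => [|N IH].
  by rewrite big_ord0 big_pred0 // => z; rewrite mulr0 addr0; case: leP => //= h; rewrite ?andbF // ltNge h andbF.
rewrite big_ord_recr /= -IH (bigID (fun c : T => an c < b + d * N%:R)) /=.
have l1 : b <= b + d * N%:R by rewrite lerDl mulr_ge0.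
have l2 : b + d * N%:R <= b + d * N.+1%:R by rewrite lerD2l ler_wpM2l // ler_nat.
congr (_ + _); apply: eq_bigl => z; rewrite -!andbA; congr (_ && _).
  by case: (b <= an z) => //=; case: (ltP (an z) (b + d * N%:R)) => h; rewrite ?andbF ?andbT // (lt_le_trans h l2).
rewrite -leNgt; case: (leP (b + d * N%:R) (an z)) => h; rewrite ?andbF ?andbT //.
by rewrite (le_trans l1 h).
Qed.
End Counting.

(** * Weighted counts and the angular density *)

Section Density.
Context {R : realType}.
Local Notation C := (Cplx R).
Local Notation twopi := ((pi : R) *+ 2).
Local Notation mR := (measurableTypeR R).
Variable L : C -> nat.
Hypothesis hL : discrete L.
Variable D : {measure set mR -> \bar R}.
Hypothesis hD : circle_measure D.
Variables (p : R) (E : set R).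
Hypotheses (cE : countable E) (hE : forall a b : R, a < b <= a + twopi -> ~ E a -> ~ E b ->
  (fun r : R => count_sector L r a b / r `^ p) @ +oo --> fine (D `]a, b[%classic)).
Implicit Types (x y u v a b r : R) (z : C).
Local Notation mass := (@arc_mass R D).

(* All rational translates are required, so that one base point serves the
   partitions of the circle into any number of equal arcs. *)
Definition good b := forall q : rat, ~ E (b + twopi * ratr q) /\ D [set b + twopi * ratr q] = 0%E.

(** The excluded base points form a countable union of translates of countable sets, whereas an
    interval has positive Lebesgue measure. *)
Lemma exists_good u v : u < v -> exists2 b, u < b < v & good b.
Proof.
move=> uv; pose B := E `|` [set x | D [set x] != 0%E].
have cB : countable B.
  rewrite (_ : B = \bigcup_(i in setT) (fun i : bool => if i then E else [set x | D [set x] != 0%E]) i).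
    by apply: bigcup_countable => // -[] _ //; exact: countable_atoms.
  apply/seteqP; split=> x; first by move=> [Ex|Ax]; [exists true|exists false].
  by move=> [[] _ h]; [left|right].
pose B2 := \bigcup_(q in [set: rat]) [set x - twopi * ratr q | x in B].
have cB2 : countable B2.
  apply: bigcup_countable => // q _.
  exact: sub_countable (card_image_le _ _) cB.
have [//|nb] := pselect (exists2 b, u < b < v & good b).
have sub : `]u, v[%classic `<=` B2.
  move=> b; rewrite /= in_itv /= => hb; apply: contrapT => nB2; apply: nb; exists b => // q.
  split=> [h|].
    by apply: nB2; exists q => //; exists (b + twopi * ratr q); [left|rewrite addrK].
  apply/eqP; apply: contrapT => /negP h.
  by apply: nB2; exists q => //; exists (b + twopi * ratr q); [right|rewrite addrK].
have := countable_lebesgue_measure0 (sub_countable (subset_card_le sub) cB2).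
rewrite lebesgue_measure_itv /= lte_fin uv => /eqP; rewrite -EFinB eqe subr_eq0 gt_eqF //.
Qed.

Lemma arc_mass_oo x y : x < y -> D [set y] = 0%E -> fine (D `]x, y[%classic) = mass x y.
Proof.
move=> xy y0; rewrite /arc_mass; congr fine.
have -> : `]x, y]%classic = `]x, y[%classic `|` [set y].
  by rewrite setUitv1 // bnd_simp.
rewrite measureU //; first by rewrite -[LHS]adde0; congr (_ + _)%E; exact: (esym y0).
by apply/seteqP; split=> z //= [h zy]; move: h; rewrite zy in_itv /= ltxx andbF.
Qed.

Lemma arc_cvg x y : x < y <= x + twopi -> ~ E x -> ~ E y -> D [set y] = 0%E ->
  (fun r : R => count_sector L r x y / r `^ p) @ +oo --> mass x y.
Proof. by move=> xy Ex Ey y0; rewrite -arc_mass_oo //; [exact: hE|by case/andP: xy]. Qed.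

(** [half_open_count] also involves the rays [x - pi] and [x + pi]; these are rational translates of
    [b] too, with [q] moved by [1/2], so that all four sectors have a limit. *)
Lemma half_open_cvg b x y (q q' : rat) : good b -> x = b + twopi * ratr q -> y = b + twopi * ratr q' ->
  b <= x -> x < y -> y <= b + twopi ->
  (fun r => (\sum_(z <- pts L r | x <= angz b z < y) (L z)%:R) / r `^ p) @ +oo --> mass x y.
Proof.
move=> gb xE yE bx xy yb; have pi0 := @pi_gt0 R.
have p2 : twopi = pi + pi by rewrite mulr2n.
have half : twopi * ratr (2^-1 : rat) = pi :> R.
  by rewrite fmorphV /= ratr_nat -[pi *+ 2]mulr_natr mulfK.
have [Ex Dx] : ~ E x /\ D [set x] = 0%E by rewrite xE.
have [Ey Dy] : ~ E y /\ D [set y] = 0%E by rewrite yE.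
have [Ex1 Dx1] : ~ E (x - pi) /\ D [set x - pi] = 0%E.
  by have := gb (q - 2^-1); rewrite rmorphB /= mulrBr half addrA -xE.
have [Ex2 Dx2] : ~ E (x + pi) /\ D [set x + pi] = 0%E.
  by have := gb (q + 2^-1); rewrite rmorphD /= mulrDr half addrA -xE.
have -> : mass x y = mass x y + (mass (x - pi) (x + pi) - mass (x - pi) x - mass x (x + pi)).
  by rewrite (@arc_mass_cat _ _ hD (x - pi) x (x + pi)); [ring|lra|lra].
rewrite (_ : (fun r => _) = fun r => count_sector L r x y / r `^ p +
   (count_sector L r (x - pi) (x + pi) / r `^ p - count_sector L r (x - pi) x / r `^ p - count_sector L r x (x + pi) / r `^ p)); last first.
  by apply/funext => r; rewrite half_open_count // -!mulrBl -mulrDl.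
apply: cvgD; first by apply: arc_cvg => //; apply/andP; split; lra.
apply: cvgB; first apply: cvgB.
- by apply: arc_cvg => //; apply/andP; split; lra.
- by apply: arc_cvg => //; apply/andP; split; lra.
- by apply: arc_cvg => //; apply/andP; split; lra.
Qed.

Lemma cvg_sum_ord (N : nat) (f : 'I_N -> R -> R) (l : 'I_N -> R) : (forall j, f j @ +oo --> l j) ->
  (fun r => \sum_j f j r) @ +oo --> \sum_j l j.
Proof.
elim: N f l => [|N IH] f l h.
  by rewrite big_ord0; under eq_fun do rewrite big_ord0; exact: cvg_cst.
rewrite big_ord_recl; under eq_fun do rewrite big_ord_recl.
by apply: cvgD; [exact: h|apply: IH => j; exact: h].
Qed.

Definition wsum b (F : R -> R) r := \sum_(z <- pts L r) (L z)%:R * F (angz b z).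

(** A Riemann sum over [N] equal half-open arcs converges by [half_open_cvg]; it differs from the
    weighted count and from the integral by at most the Lipschitz constant times the mesh times the
    mass. *)
Lemma wsum_cvg b (F : R -> R) K : good b -> (forall x y, `|F x - F y| <= K * `|x - y|) ->
  (fun r => wsum b F r / r `^ p) @ +oo --> \int[D]_(x in `]b, b + twopi]) F x.
Proof.
move=> gb LF; have p2 := @twopi_gt0 R.
have K0 : 0 <= K by have := le_trans (normr_ge0 _) (LF 1 0); rewrite subr0 normr1 mulr1.
set I := \int[D]_(x in _) _; pose M := mass b (b + twopi).
have M0 : 0 <= M by exact: arc_mass_ge0.
apply/cvgrPdist_le => e e0.
(* The mesh error is [K d M] for the integral and at most [K d (M + 1)] for the counts, in total
   [K d (2 M + 1) <= e / 2]. *)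
pose N := (Num.trunc (K * twopi * (2 * M + 1) * 2 / e)).+1.
have N0 : 0 < N%:R :> R by rewrite ltr0n.
pose d := twopi / N%:R.
have d0 : 0 < d by rewrite divr_gt0.
have dN : d * N%:R = twopi by rewrite /d divfK // gt_eqF.
have small : K * d * (2 * M + 1) <= e / 2.
  have X0 : 0 <= K * twopi * (2 * M + 1) * 2 / e.
    by rewrite divr_ge0 ?(ltW e0) // !mulr_ge0 ?(ltW p2) // addr_ge0 // mulr_ge0.
  have /andP[_ /ltW] := @Num.Theory.trunc_itv R _ X0.
  rewrite -/N ler_pdivrMr // => h.
  have -> : K * d * (2 * M + 1) = K * twopi * (2 * M + 1) / N%:R by rewrite /d; ring.
  rewrite ler_pdivrMr //; lra.
pose x (j : nat) := b + d * j%:R.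
have xq (j : nat) : x j = b + twopi * ratr (j%:R / N%:R).
  by rewrite /x fmorph_div /= !ratr_nat /d; ring.
have xlt (j : nat) : x j < x j.+1 by rewrite ltrD2l ltr_pM2l // ltr_nat.
have xb (j : nat) : b <= x j by rewrite lerDl mulr_ge0 // ltW.
have xN (j : 'I_N) : x j.+1 <= b + twopi by rewrite lerD2l -dN ler_pM2l // ler_nat.
pose H (j : 'I_N) r := \sum_(z <- pts L r | x j <= angz b z < x j.+1) (L z)%:R : R.
have cH j : (fun r => H j r / r `^ p) @ +oo --> mass (x j) (x j.+1).
  by apply: (@half_open_cvg b (x j) (x j.+1) _ _ gb (xq j) (xq j.+1)).
have c1 : (fun r => \sum_(j < N) F (x j) * (H j r / r `^ p)) @ +oo --> \sum_(j < N) F (x j) * mass (x j) (x j.+1).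
  apply: (@cvg_sum_ord N (fun j r => F (x j) * (H j r / r `^ p))) => j.
  by apply: cvgM; [exact: cvg_cst|exact: cH].
have c2 : (fun r => \sum_j H j r / r `^ p) @ +oo --> \sum_(j < N) mass (x j) (x j.+1).
  exact: (@cvg_sum_ord N (fun j r => H j r / r `^ p)).
have ME : \sum_(j < N) mass (x j) (x j.+1) = M.
  have X (n : nat) : \sum_(j < n) mass (x j) (x j.+1) = mass b (x n).
    elim: n => [|n IH]; last by rewrite big_ord_recr /= IH -arc_mass_cat // ltW.
    by rewrite big_ord0 /x mulr0 addr0 /arc_mass set_itvoc0 measure0.
  by rewrite X /x dN.
rewrite ME in c2.
have rie : `|I - \sum_(j < N) F (x j) * mass (x j) (x j.+1)| <= K * d * M.
  by have := Rint_riemann hD b N LF (ltW d0); rewrite dN.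
have key r : 0 < r -> `|wsum b F r / r `^ p - \sum_(j < N) F (x j) * (H j r / r `^ p)| <= K * d * \sum_j H j r / r `^ p.
  move=> r0; have rp : 0 < r `^ p by rewrite powR_gt0.
  have -> : wsum b F r / r `^ p - \sum_(j < N) F (x j) * (H j r / r `^ p) =
     (\sum_(j < N) \sum_(z <- pts L r | x j <= angz b z < x j.+1) (L z)%:R * (F (angz b z) - F (x j))) / r `^ p.
    under eq_bigr do rewrite mulrA; rewrite -mulr_suml -mulrBl; congr (_ / _).
    have -> : wsum b F r = \sum_(z <- pts L r | true && (b <= angz b z < b + d * N%:R)) (L z)%:R * F (angz b z).
      rewrite /wsum big_seq [RHS]big_seq_cond; apply: eq_bigl => z; rewrite dN.
      case: (boolP (z \in _)) => //=; rewrite mem_pts // => /andP[_ /andP[z0 _]].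
      by have [-> _] := angzP b (etrans (esym (cabs_gt0 z)) z0).
    rewrite (split_window _ _ _ _ _ _ (ltW d0)) -sumrB; apply: eq_bigr => j _ /=.
    rewrite mulr_sumr -sumrB; apply: eq_bigr => z _; ring.
  rewrite normrM (ger0_norm (x := (r `^ p)^-1)) ?invr_ge0 ?(ltW rp) // -mulr_suml mulrA ler_pM2r ?invr_gt0 //.
  apply: le_trans (ler_norm_sum _ _ _) _; rewrite mulr_sumr; apply: ler_sum => j _.
  apply: le_trans (ler_norm_sum _ _ _) _; rewrite mulr_sumr; apply: ler_sum => z /andP[h1 h2].
  rewrite normrM ger0_norm // mulrC; apply: ler_wpM2r => //.
  apply: le_trans (LF _ _) _; apply: ler_wpM2l => //.
  rewrite ger0_norm ?subr_ge0 // lerBlDl; apply: le_trans (ltW h2) _.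
  by rewrite /x -natr1; lra.
have e4 : 0 < e / 4 by rewrite divr_gt0.
move/cvgrPdist_le: c1 => /(_ _ e4) c1; move/cvgrPdist_le: c2 => /(_ _ ltr01) c2.
near=> r.
have r0 : 0 < r by near: r; exact: nbhs_pinfty_gt.
have h1 : `|\sum_(j < N) F (x j) * mass (x j) (x j.+1) - \sum_(j < N) F (x j) * (H j r / r `^ p)| <= e / 4 by near: r.
have h2 : `|M - \sum_j H j r / r `^ p| <= 1 by near: r.
have h3 := key r r0.
have h4 : \sum_j H j r / r `^ p <= M + 1 by move: h2; rewrite ler_norml => /andP[? ?]; lra.
have h5 := ler_wpM2l (mulr_ge0 K0 (ltW d0)) h4.
have h6 := le_trans h3 h5.
move: rie h1 h6 small; rewrite !ler_norml => /andP[? ?] /andP[? ?] /andP[? ?] small.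
rewrite -/I; rewrite mulrDr mulr1 in small.
by apply/andP; split; lra.
Unshelve. all: by end_near.
Qed.
End Density.

(** * From the bound for zeros to a bound for the type *)

Section TypeBound.
Context {R : realType}.
Local Notation C := (Cplx R).
Local Notation twopi := ((pi : R) *+ 2).
Local Notation mR := (measurableTypeR R).
Implicit Types (x y r h : R) (z : C).

(** Repetition according to multiplicity, the form in which [upper_count] takes the zeros. *)
Definition mlist (L : C -> nat) (s : seq C) : seq C := flatten [seq nseq (L z) z | z <- s].

Lemma sum_mlist L s (F : C -> R) : \sum_(z <- mlist L s) F z = \sum_(z <- s) (L z)%:R * F z.
Proof.
rewrite big_flatten big_map; apply: eq_bigr => z _.
by rewrite big_nseq iter_addr addr0 mulr_natl.
Qed.

Lemma count_mlist L s z : uniq s -> (count_mem z (mlist L s) <= L z)%N.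
Proof.
move=> us; rewrite count_flatten -map_comp.
have -> : [seq (count_mem z \o (fun a : C => nseq (L a) a)) a | a <- s] = [seq ((a == z) * L a)%N | a <- s].
  by apply: eq_map => a; rewrite /= count_nseq.
elim: s us => //= a s IH /andP[ys /IH h]; case: eqP => [E|_]; last by rewrite mul0n.
rewrite E mul1n (_ : sumn _ = 0%N) ?addn0 //; apply/eqP; rewrite sumnE big_map sum_nat_seq_eq0.
apply/allP => c cs /=; apply/eqP; case: eqP => // cz.
by rewrite E -cz cs in ys.
Qed.

Lemma mem_mlist L s z : z \in mlist L s -> z \in s.
Proof. by move=> /flatten_mapP[y ys]; rewrite mem_nseq => /andP[_ /eqP ->]. Qed.

(** The increments telescope from the first [sg j] beyond [x], and [kap] at that point is at most
    [kap x]. *)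
Lemma step_sum_le (kap : R -> R) (sg : nat -> R) x (N : nat) : {homo kap : u v / u <= v >-> v <= u} ->
  (forall j, sg j <= sg j.+1) ->
  \sum_(j < N) (if x < sg j then kap (sg j) - kap (sg j.+1) else 0) <= kap x - kap (Num.max x (sg N)).
Proof.
move=> hk hs; elim: N => [|N IH]; first by rewrite big_ord0 subr_ge0 hk // le_max lexx.
rewrite big_ord_recr /=; apply: le_trans (lerD IH (lexx _)) _.
have [h|h] := ltP x (sg N); last first.
  by rewrite addr0; apply: lerB => //; apply: hk; rewrite le_max lexx.
by rewrite (max_idPr (le_trans (ltW h) (hs N))) addrA subrK.
Qed.

Lemma kap2_homo (p S : R) : 0 < p -> {homo kap2 p S : u v / u <= v >-> v <= u}.
Proof.
move=> p0 u v uv; have h : p * u <= p * v by rewrite ler_pM2l.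
by apply: lerB; rewrite ler_expR; lra.
Qed.

Lemma kap2_step (p S x h : R) : 0 < p -> 0 < h ->
  expR (- (p * x)) * (1 - expR (- (p * h))) <= kap2 p S x - kap2 p S (x + h).
Proof.
move=> p0 h0; rewrite /kap2 mulrBr mulr1 -expRD.
have -> : - (p * x) + - (p * h) = - (p * (x + h)) by ring.
have : expR (p * x - 2 * p * S) <= expR (p * (x + h) - 2 * p * S).
  have ph : 0 <= p * h by rewrite mulr_ge0 // ltW.
  by rewrite ler_expR mulrDr; lra.
lra.
Qed.

Lemma linear_bound (a c A B : R) : (forall N : nat, a * N%:R - A <= c * N%:R + B) -> a <= c.
Proof.
move=> H; rewrite leNgt; apply/negP => ca.
have d0 : 0 < a - c by rewrite subr_gt0.
pose N := (Num.trunc (`|A + B| / (a - c))).+1.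
have /andP[_] := @Num.Theory.trunc_itv R _ (divr_ge0 (normr_ge0 (A + B)) (ltW d0)).
rewrite -/N ltr_pdivrMr // => h; have := H N; have := ler_norm (A + B).
by move: h; rewrite mulrBr; lra.
Qed.

(** Divide by [p h] and let [h] tend to 0; the limit is made explicit by
    [1 - e^(- x) >= x / (1 + x)]. *)
Lemma exp_limit (p I tau : R) : 0 < p -> 0 <= I ->
  (forall h, 0 < h -> I * (1 - expR (- (p * h))) <= p * tau * h) -> I <= tau.
Proof.
move=> p0 I0 H; apply/ler_addgt0Pr => e e0.
have d0 : 0 <= I by [].
pose h := e / (p * (`|tau| + 1)).
have t1 : 0 < `|tau| + 1 by rewrite ltr_wpDl.
have h0 : 0 < h by rewrite divr_gt0 // mulr_gt0.
have ph : p * h = e / (`|tau| + 1).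
  by rewrite /h; field; rewrite !gt_eqF.
have ph0 : 0 < p * h by rewrite mulr_gt0.
have E : p * h / (1 + p * h) <= 1 - expR (- (p * h)).
  have -> : p * h / (1 + p * h) = 1 - (1 + p * h)^-1 by field; rewrite gt_eqF // addr_gt0.
  rewrite lerD2l lerN2 expRN lef_pV2 ?posrE ?expR_gt0 ?addr_gt0 //; exact: expR_ge1Dx.
have := le_trans (ler_wpM2l I0 E) (H h h0).
rewrite mulrA ler_pdivrMr ?addr_gt0 // (_ : p * tau * h * _ = tau * (1 + p * h) * (p * h)); last by ring.
rewrite ler_pM2r // => h1.
apply: le_trans h1 _; rewrite mulrDr mulr1 lerD2l ph mulrA ler_pdivrMr // mulrC.
apply: ler_wpM2l; first exact: ltW.
by apply: le_trans (ler_norm _) _; rewrite lerDl.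
Qed.

Variable L : C -> nat.
Hypothesis hL : discrete L.
Variable D : {measure set mR -> \bar R}.
Hypothesis hD : circle_measure D.
Variables (p : R) (E : set R).
Hypotheses (cE : countable E) (hE : forall a b : R, a < b <= a + twopi -> ~ E a -> ~ E b ->
  (fun r : R => count_sector L r a b / r `^ p) @ +oo --> fine (D `]a, b[%classic)).
Hypothesis p0 : 0 < p.

Lemma wsum_bound b (F : R -> R) K e : good D E b -> (forall x y, `|F x - F y| <= K * `|x - y|) -> 0 < e ->
  exists2 r0, 0 < r0 & forall r, r0 <= r ->
    `|wsum L b F r - (\int[D]_(x in `]b, b + twopi]) F x) * r `^ p| <= e * r `^ p.
Proof.
move=> gb LF e0; have /cvgrPdist_le/(_ _ e0)[M [_ H]] := wsum_cvg hL hD hE gb LF.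
exists (`|M| + 1) => [|r rM]; first by rewrite ltr_wpDl.
have Mr : M < r by apply: lt_le_trans rM; apply: le_lt_trans (ler_norm M) _; rewrite ltrDl.
have r0 : 0 < r by apply: lt_le_trans rM; rewrite ltr_wpDl.
have rp : 0 < r `^ p by rewrite powR_gt0.
have := H r Mr; rewrite distrC -(ler_pM2r rp); congr (_ <= _).
by rewrite -[X in _ * X = _](gtr0_norm rp) -normrM mulrBl divfK // gt_eqF.
Qed.

(* Abel summation over the radii [e^(s2 + h j)]: each step contributes at least
   [J (1 - e^(- p h))] to the left-hand side of [upper_count]. *)
Lemma Phi3_type_bound (n : nat) (w t : 'I_n -> R) u t0 f b K tau :
  (forall i, 0 <= w i) -> \sum_i w i = 1 ->
  \sum_i w i * cos (p * t i) = 0 -> \sum_i w i * sin (p * t i) = 0 ->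
  (forall i, u <= t i <= u + twopi / p) -> t0 <= u -> u + twopi / p < t0 + twopi *+ 2 ->
  good D E (t0 - twopi) ->
  holo f -> f b != 0 -> 1 <= K -> 0 <= tau ->
  (forall z, cabs (f z) <= K * expR (tau * cabs z `^ p)) -> vanishes_on L f ->
  twopi * \int[D]_(x in `](t0 - twopi), t0]) Phi3 p w t x <= tau.
Proof.
move=> w0 w1 bc bs ht t0u ut0 gb hf fb K1 T0 fK vf; have p2 := @twopi_gt0 R.
have [s1 [Cc H]] := upper_count p0 w0 w1 bc bs ht t0u ut0 hf fb K1 T0 fK.
set I := \int[D]_(x in _) _; set a := t0 - twopi.
have ph y : 0 <= phi p w t y by exact: (@phi_ge0 R p u).
have Ph y : 0 <= Phi3 p w t y by rewrite /Phi3 !addr_ge0.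
have [I0|I0] := leP I 0; first by apply: le_trans T0; rewrite pmulr_rle0.
(* Any [J] below the integral is, for large [r], a lower bound of the weighted count divided by
   [r^p]. *)
suff X J : 0 < J -> J < I -> twopi * J <= tau.
  apply/ler_addgt0Pr => e e0; pose d := e / twopi.
  have d0 : 0 < d by rewrite divr_gt0.
  have [c|c] := leP (I - d) 0.
    have : twopi * I <= twopi * d by rewrite ler_pM2l //; lra.
    by rewrite /d (mulrC twopi (e / _)) divfK ?gt_eqF //; lra.
  have := X (I - d) c; rewrite ltrBlDr ltrDl d0 => /(_ isT).
  by rewrite mulrBr /d (mulrC twopi (e / _)) divfK ?gt_eqF //; lra.
move=> J0 JI.
have [r0 r00 Hr] := wsum_bound gb (Phi3_lipschitz t p0 w0 w1) (etrans (subr_gt0 J I) JI).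
rewrite subrK -/I in Hr.
(* Beyond [s2] the weighted count is at least [J e^(p s)]. The margin [+ 1] puts the points with
   [log |z| <= s1], to which [upper_count] does not apply, among those counted in [A]. *)
pose s2 := Num.max (s1 + 1) (ln r0).
have s12 : s1 + 1 <= s2 by rewrite le_max lexx.
have HW s : s2 <= s -> J * expR (p * s) <= wsum L a (Phi3 p w t) (expR s).
  move=> hs; have rs : r0 <= expR s.
    by rewrite -[leLHS]lnK ?posrE // ler_expR; apply: le_trans hs; rewrite le_max lexx orbT.
  have := Hr _ rs; have -> : expR s `^ p = expR (p * s) by rewrite /powR gt_eqF ?expR_gt0 // expRK.
  by rewrite ler_norml mulrBl => /andP[]; rewrite -/a; lra.
pose F z := (L z)%:R * Phi3 p w t (angz a z).
have F0 z : 0 <= F z by rewrite mulr_ge0.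
pose A := wsum L a (Phi3 p w t) (expR s2).
have A0 : 0 <= A by apply: sumr_ge0 => z _; exact: F0.
(* For a fixed step [h] the number [N] of steps grows first, with [S = s2 + h N]; both sides are
   affine in [N] and their slopes are compared. Only then does [h] tend to 0. *)
apply: (@exp_limit p); [exact: p0|by rewrite mulr_ge0 // ltW|] => h h0.
apply: (@linear_bound _ _ (twopi * (expR (- (p * s2)) * A)) (p * tau * s2 + Cc)) => N.
pose sg (j : nat) := s2 + h * j%:R; pose S := sg N.
have sgS j : (j <= N)%N -> sg j <= S by move=> jN; rewrite lerD2l ler_pM2l // ler_nat.
have sg2 j : s2 <= sg j by rewrite lerDl mulr_ge0 // ltW.
have sgI j : sg j.+1 = sg j + h by rewrite /sg -natr1; ring.
have sgl j : sg j <= sg j.+1 by rewrite sgI lerDl ltW.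
have s1S : s1 < S by have := sg2 N; rewrite -/S; lra.
pose q := [seq z <- pts L (expR S) | s1 < ln (cabs z)].
have qz z : z \in q -> [/\ s1 < ln (cabs z), ln (cabs z) < S & z != 0].
  rewrite mem_filter mem_pts // => /andP[h1 /andP[_ /andP[h2 h3]]]; split => //.
    by rewrite -[ltRHS]expRK ltr_ln ?posrE ?expR_gt0.
  by rewrite -cabs_gt0.
have := H S (mlist L q) (angz a) s1S.
have -> : p * tau * S + Cc = p * tau * h * N%:R + (p * tau * s2 + Cc) by rewrite /S /sg; ring.
move=> HS; apply: le_trans (HS _ _); last first.
- move=> z /mem_mlist zq; have [h1 h2 h3] := qz z zq.
  have [h4 h5] := angzP a h3; split => //; first by rewrite h1 h2.
  by move: h4; rewrite /a subrK.
- move=> z k hk; apply: vf; apply: leq_trans hk _; apply: count_mlist.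
  by rewrite filter_uniq // uniq_pts.
rewrite (_ : twopi * J * _ * _ - _ = twopi * (J * (1 - expR (- (p * h))) * N%:R - expR (- (p * s2)) * A)); last by ring.
apply: ler_wpM2l; first exact: ltW.
rewrite sum_mlist.
pose c (j : nat) := kap2 p S (sg j) - kap2 p S (sg j.+1).
have c0 j : 0 <= c j by rewrite subr_ge0; apply: kap2_homo.
apply: (@le_trans _ _ (\sum_(j < N) c j * (wsum L a (Phi3 p w t) (expR (sg j)) - A))).
  (* The terms with [A] stay bounded in [N], since the drops [c j] telescope. *)
  have cS : \sum_(j < N) c j <= expR (- (p * s2)).
    have -> : \sum_(j < N) c j = kap2 p S (sg 0%N) - kap2 p S (sg N).
      elim: (N) => [|m IH]; first by rewrite big_ord0 subrr.
      by rewrite big_ord_recr /= IH /c; ring.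
    rewrite -/S kap2_S subr0 /sg mulr0 addr0; exact: kap2_le.
  have -> : J * (1 - expR (- (p * h))) * N%:R - expR (- (p * s2)) * A =
     \sum_(j < N) (J * (1 - expR (- (p * h)))) - expR (- (p * s2)) * A.
    by rewrite sumr_const card_ord mulr_natr.
  apply: (@le_trans _ _ (\sum_(j < N) (J * (1 - expR (- (p * h)))) - (\sum_(j < N) c j) * A)).
    by rewrite lerD2l lerN2; apply: ler_wpM2r.
  rewrite mulr_suml -sumrB; apply: ler_sum => j _; rewrite [leRHS]mulrBr lerD2r.
  apply: (@le_trans _ _ (c j * (J * expR (p * sg j)))); last first.
    by apply: ler_wpM2l => //; exact: HW.
  have := kap2_step S (sg j) p0 h0; rewrite -sgI -/(c j) => h1.
  have e0 : 0 <= J * expR (p * sg j) by rewrite mulr_ge0 ?expR_ge0 // ltW.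
  apply: le_trans (ler_wpM2r e0 h1).
  have e1 : expR (- (p * sg j)) * expR (p * sg j) = 1 by rewrite -expRD addNr expR0.
  rewrite le_eqVlt; apply/orP; left; apply/eqP.
  have -> : expR (- (p * sg j)) * (1 - expR (- (p * h))) * (J * expR (p * sg j)) =
     J * (1 - expR (- (p * h))) * (expR (- (p * sg j)) * expR (p * sg j)) by ring.
  by rewrite e1 mulr1.
have HA j : (j < N)%N -> wsum L a (Phi3 p w t) (expR (sg j)) - A <= \sum_(z <- q | ln (cabs z) < sg j) F z.
  move=> jN.
  have h1 : expR (sg j) <= expR S by rewrite ler_expR; apply: sgS; exact: ltnW.
  have h2 : expR s2 <= expR S by rewrite ler_expR; exact: sg2.
  rewrite lerBlDr /wsum (sum_pts_le hL _ h1) big_filter_cond /A /wsum (sum_pts_le hL _ h2).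
  rewrite -/F (bigID (fun z => s1 < ln (cabs z))) /=; apply: lerD.
    rewrite big_seq_cond [leRHS]big_seq_cond le_eqVlt; apply/orP; left; apply/eqP; apply: eq_bigl => z.
    case: (boolP (z \in _)) => //=; rewrite mem_pts // => /andP[_ /andP[z0 _]].
    by rewrite andbC -[in RHS](expRK (sg j)) ltr_ln ?posrE ?expR_gt0.
  rewrite big_seq_cond [leRHS]big_seq_cond big_mkcond [leRHS]big_mkcond; apply: ler_sum => z _.
  case: (boolP (z \in _)) => //=; rewrite mem_pts // => /andP[_ /andP[z0 _]].
  case: (boolP (_ && _)) => [/andP[_]|_]; last by case: ifP => // _; exact: F0.
  rewrite -leNgt => zs1.
  have -> : cabs z < expR s2 by rewrite -[ltLHS]lnK ?posrE // ltr_expR; lra.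
  by [].
apply: (@le_trans _ _ (\sum_(j < N) c j * \sum_(z <- q | ln (cabs z) < sg j) F z)).
  by apply: ler_sum => j _; apply: ler_wpM2l => //; exact: HA.
(* After the exchange of sums a point [z] collects the drops of all the steps beyond it, which
   [step_sum_le] bounds by [kap2] at [log |z|]. *)
have -> : \sum_(j < N) c j * \sum_(z <- q | ln (cabs z) < sg j) F z =
   \sum_(z <- q) F z * \sum_(j < N) (if ln (cabs z) < sg j then c j else 0).
  under eq_bigr do rewrite mulr_sumr big_mkcond.
  rewrite exchange_big /=; apply: eq_bigr => z _; rewrite mulr_sumr; apply: eq_bigr => j _.
  by case: ifP => _; rewrite ?mulr0 // mulrC.
rewrite big_seq [leRHS]big_seq; apply: ler_sum => z /qz[h1 h2 h3].
have -> : (L z)%:R * (kap2 p S (ln (cabs z)) * Phi3 p w t (angz a z)) = F z * kap2 p S (ln (cabs z)).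
  by rewrite /F; ring.
apply: ler_wpM2l; first exact: F0.
apply: le_trans (@step_sum_le (kap2 p S) sg (ln (cabs z)) N (kap2_homo S p0) sgl) _.
by rewrite (max_idPr (ltW h2)) -/S kap2_S subr0.
Qed.
End TypeBound.

(** * The Lindelof condition *)

Section Lindelof.
Context {R : realType}.
Local Notation C := (Cplx R).
Local Notation twopi := ((pi : R) *+ 2).
Local Notation mR := (measurableTypeR R).
Implicit Types (x y r : R) (z : C).
Variable L : C -> nat.
Hypothesis hL : discrete L.

Section shell.
Variable D : {measure set mR -> \bar R}.
Hypothesis hD : circle_measure D.
Variables (p : R) (E : set R).
Hypotheses (cE : countable E) (hE : forall a b : R, a < b <= a + twopi -> ~ E a -> ~ E b ->
  (fun r : R => count_sector L r a b / r `^ p) @ +oo --> fine (D `]a, b[%classic)).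
Hypothesis p0 : 0 < p.

Lemma sum_pts_shell (F : C -> R) r s : r <= s ->
  \sum_(z <- pts L s) F z - \sum_(z <- pts L r) F z = \sum_(z <- pts L s | r <= cabs z) F z.
Proof.
move=> rs; rewrite (sum_pts_le hL F rs) (bigID (fun z => cabs z < r)) /= addrAC subrr add0r.
by apply: eq_bigl => z; rewrite -leNgt.
Qed.

(* On the shell [r <= |z| < q r] the weights [|z|^-p] and [r^-p] differ by a
   factor between [q^-p] and [1], so that [|I| (Q - 1) <= (1 - Q^-1) (Q - 1) D(T)]
   for [Q = q^p], and [Q] can be taken close to [1]. *)
Lemma shell_integral_eq0 b (g : R -> R) K : good D E b -> (forall x y, `|g x - g y| <= K * `|x - y|) ->
  (forall x, `|g x| <= 1) ->
  (forall e, 0 < e -> exists M, forall r q, M < r -> 0 < r -> 1 < q ->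
     `|\sum_(z <- pts L (q * r) | r <= cabs z) (L z)%:R * (cabs z `^ p)^-1 * g (angz b z)| <= e) ->
  \int[D]_(x in `]b, b + twopi]) g x = 0.
Proof.
move=> gb Lg g1 hT; set I := \int[D]_(x in _) _.
have L1 x y : `|(fun=> 1 : R) x - (fun=> 1 : R) y| <= 0 * `|x - y| by rewrite subrr normr0 mul0r.
pose M0 := \int[D]_(x in `]b, b + twopi]) (1 : R).
have M00 : 0 <= M0 by apply: Rintegral_ge0 => x _; exact: ler01.
suff main Q : 1 < Q -> `|I| <= (Q - 1) * M0.
  apply/eqP; rewrite -normr_le0; apply/ler_addgt0Pr => e e0; rewrite add0r.
  have d0 : 0 < e / (M0 + 1) by rewrite divr_gt0 // ltr_wpDl.
  have := main (1 + e / (M0 + 1)); rewrite ltrDl d0 => /(_ isT) h; apply: le_trans h _.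
  rewrite addrAC subrr add0r mulrAC ler_pdivrMr ?ltr_wpDl //.
  by apply: ler_wpM2l; [exact: ltW|rewrite lerDl].
move=> Q1; have Q0 : 0 < Q by apply: lt_trans Q1.
have iQ : 0 <= 1 - Q^-1 <= 1.
  have i1 : Q^-1 <= 1 by rewrite invf_le1 // ltW.
  have i0 : 0 < Q^-1 by rewrite invr_gt0.
  by apply/andP; split; lra.
have iQ2 : 1 - Q^-1 <= Q - 1.
  have -> : 1 - Q^-1 = (Q - 1) / Q by rewrite mulrBl divff ?gt_eqF // mul1r.
  by rewrite ler_pdivrMr // ler_peMr // ?subr_ge0 ltW.
suff key : `|I| * (Q - 1) <= (1 - Q^-1) * M0 * (Q - 1).
  rewrite ler_pM2r ?subr_gt0 // in key; apply: le_trans key _.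
  by apply: ler_wpM2r.
(* The errors are [e] from the hypothesis on shells and [e (Q + 1)] from each of the weighted
   counts, of [g] and of the constant 1, at the two radii. *)
apply/ler_addgt0Pr => e' e'0; pose e := e' / (2 * (Q + 1) + 1).
have c0 : 0 < 2 * (Q + 1) + 1 by lra.
have e0 : 0 < e by rewrite divr_gt0.
have e'E : e' = e * (2 * (Q + 1) + 1) by rewrite /e divfK // gt_eqF.
have [M HM] := hT e e0.
have [r1 r10 H1] := wsum_bound hL hD hE gb Lg e0.
have [r2 r20 H2] := wsum_bound hL hD hE gb L1 e0.
rewrite -/I in H1; rewrite -/M0 in H2.
pose q := expR (ln Q / p).
have q1 : 1 < q by rewrite expR_gt1 divr_gt0 // ln_gt0.
have q0 : 0 < q by exact: expR_gt0.
have qp : q `^ p = Q.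
  by rewrite /powR gt_eqF // expRK mulrC divfK ?gt_eqF // lnK.
pose r := Num.max (`|M| + 1) (Num.max r1 r2).
have rM : M < r.
  rewrite lt_max; apply/orP; left; apply: le_lt_trans (ler_norm M) _; by rewrite ltrDl.
have rr1 : r1 <= r by rewrite !le_max lexx orbT.
have rr2 : r2 <= r by rewrite !le_max lexx !orbT.
have r0 : 0 < r by apply: lt_le_trans rr1.
have rq : r <= q * r by rewrite ler_peMl // ltW.
have rp : 0 < r `^ p by rewrite powR_gt0.
have qrp : (q * r) `^ p = Q * r `^ p by rewrite powRM ?qp // ltW.
have A1 := H1 _ rr1; have A2 := H1 _ (le_trans rr1 rq).
have B1 := H2 _ rr2; have B2 := H2 _ (le_trans rr2 rq).
rewrite qrp in A2 B2.
pose Ws := \sum_(z <- pts L (q * r) | r <= cabs z) (L z)%:R * g (angz b z).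
pose Ns := \sum_(z <- pts L (q * r) | r <= cabs z) (L z)%:R : R.
have WsE : Ws = wsum L b g (q * r) - wsum L b g r by rewrite /wsum sum_pts_shell.
have NsE : Ns = wsum L b (fun=> 1) (q * r) - wsum L b (fun=> 1) r.
  by rewrite /wsum sum_pts_shell //; apply: eq_bigr => z _; rewrite mulr1.
have T := HM r q rM r0 q1; set TT := \sum_(z <- _ | _) _ in T.
have diff : `|r `^ p * TT - Ws| <= (1 - Q^-1) * Ns.
  rewrite /TT /Ws /Ns !mulr_sumr -sumrB; apply: le_trans (ler_norm_sum _ _ _) _.
  rewrite big_seq_cond [leRHS]big_seq_cond; apply: ler_sum => z /andP[].
  rewrite mem_pts // => /andP[_ /andP[z0 zq]] rz.
  have zp : 0 < cabs z `^ p by rewrite powR_gt0.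
  have -> : r `^ p * ((L z)%:R * (cabs z `^ p)^-1 * g (angz b z)) - (L z)%:R * g (angz b z) =
     - ((1 - r `^ p / cabs z `^ p) * ((L z)%:R * g (angz b z))) by ring.
  rewrite normrN normrM; apply: ler_pM => //.
    have u1 : r `^ p / cabs z `^ p <= 1.
      by rewrite ler_pdivrMr // mul1r; apply: ge0_ler_powR; rewrite ?nnegrE //; exact: ltW.
    have u2 : Q^-1 <= r `^ p / cabs z `^ p.
      rewrite ler_pdivlMr // mulrC ler_pdivrMr // mulrC -qrp.
      have qr0 : 0 <= q * r by apply: ltW; exact: lt_trans zq.
      by apply: ge0_ler_powR; rewrite ?nnegrE //; exact: ltW.
    by rewrite ger0_norm; lra.
  by rewrite normrM ger0_norm // ler_piMr.
have T2 : `|r `^ p * TT| <= r `^ p * e by rewrite normrM gtr0_norm // ler_pM2l.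
have W1 : `|Ws| <= r `^ p * e + (1 - Q^-1) * Ns.
  rewrite (_ : Ws = r `^ p * TT - (r `^ p * TT - Ws)); last by ring.
  by apply: le_trans (ler_normB _ _) _; exact: lerD.
have W2 : `|I| * ((Q - 1) * r `^ p) <= `|Ws| + e * (Q + 1) * r `^ p.
  have qq : 0 <= (Q - 1) * r `^ p by rewrite mulr_ge0 ?subr_ge0 // ltW.
  rewrite -(ger0_norm qq) -normrM.
  have -> : I * ((Q - 1) * r `^ p) = Ws - ((wsum L b g (q * r) - I * (Q * r `^ p)) - (wsum L b g r - I * r `^ p)).
    by rewrite WsE; ring.
  apply: le_trans (ler_normB _ _) _; rewrite lerD2l; apply: le_trans (ler_normB _ _) _.
  by apply: le_trans (lerD A2 A1) _; lra.
have N2 : Ns <= (M0 * (Q - 1) + e * (Q + 1)) * r `^ p.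
  rewrite NsE; move: B1 B2; rewrite !ler_norml => /andP[? ?] /andP[? ?]; lra.
have N3 : (1 - Q^-1) * Ns <= ((1 - Q^-1) * M0 * (Q - 1) + e * (Q + 1)) * r `^ p.
  move: iQ => /andP[i1 i2]; apply: le_trans (ler_wpM2l i1 N2) _.
  rewrite mulrA; apply: ler_wpM2r; first exact: ltW.
  rewrite mulrDr mulrA lerD2l ler_piMl // mulr_ge0 //; lra.
rewrite -(ler_pM2r rp) e'E.
have := le_trans W2 (lerD (le_trans W1 (lerD (lexx _) N3)) (lexx _)).
by rewrite mulrA => h; apply: le_trans h _; rewrite le_eqVlt; apply/orP; left; apply/eqP; ring.
Qed.
End shell.

Section integer.
Variable n : nat.
Hypothesis hl : lindelof n L.

Definition lsum r : C := \sum_(z <- pts L r) (L z)%:R * z ^- n.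

(** [lindelof] sums over closed discs and [pts] over open ones. As there are finitely many points,
    some radius [s' < r] already captures all of [pts L r]. *)
Lemma lindelof_lsum r s : s < r -> exists2 s', s <= s' < r &
  \sum_(z \in [set z : C | 0 < cabs z <= s']) (L z)%:R * z ^- n = lsum r.
Proof.
move=> sr; have [s' hs h] : exists2 s', s <= s' < r & forall z, z \in pts L r -> cabs z <= s'.
  have : forall z, z \in pts L r -> cabs z < r by move=> z; rewrite mem_pts // => /andP[_ /andP[_ ->]].
  elim: (pts L r) => [_|z l IH h]; first by exists s; rewrite ?lexx.
  have [s' /andP[h1 h2] h3] := IH (fun a al => h a (mem_behead (s := z :: l) al)).
  exists (Num.max s' (cabs z)).
    by rewrite le_max h1 /= gt_max h2 h // mem_head.
  by move=> y; rewrite inE le_max => /predU1P[->|/h3 ->]; rewrite ?lexx ?orbT.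
exists s' => //; rewrite (@fsbigE _ _ _ _ _ (pts L r)).
- rewrite /lsum big_seq_cond [RHS]big_seq; apply: eq_bigl => z.
  case: (boolP (z \in pts L r)) => //= zr; apply/mem_set => /=; rewrite h // andbT.
  by move: zr; rewrite mem_pts // => /andP[_ /andP[->]].
- exact: uniq_pts.
- by move=> z /= zr; rewrite h // andbT; move: zr; rewrite mem_pts // => /andP[_ /andP[->]].
move=> z /= /andP[z0 zs]; rewrite mem_pts // z0.
have -> : cabs z < r by have /andP[_ h2] := hs; exact: le_lt_trans h2.
by rewrite andbT; case: (L z) => // _; rewrite mul0r.
Qed.

Lemma lindelof_cauchy e : 0 < e -> exists M, forall r s, M < r -> M < s -> cabs (lsum s - lsum r) <= e.
Proof.
move=> e0; pose l := lim ((fun r : R => \sum_(z \in [set z : C | 0 < cabs z <= r]) (L z)%:R * z ^- n) @ +oo).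
have e2 : (0 : C) < ofR (e / 2) by rewrite -ofR0 ofR_lt divr_gt0.
have /cvgrPdist_le/(_ _ e2)[M [_ H]] := hl.
have X r : M < r -> cabs (l - lsum r) <= e / 2.
  move=> Mr; have mid : (M + r) / 2 < r by lra.
  have [s /andP[h1 h2] <-] := lindelof_lsum mid.
  have Ms : M < s by lra.
  by have := H s Ms; rewrite -/l cabs_normE ofR_le.
exists M => r s Mr Ms; rewrite (_ : lsum s - lsum r = (l - lsum r) - (l - lsum s)); last by ring.
apply: le_trans (cabsB _ _) _; have := X r Mr; have := X s Ms; lra.
Qed.

Lemma expw_Vn z x : z = expw (ln (cabs z)) x -> z != 0 ->
  complex.Re (z ^- n) = (cabs z ^+ n)^-1 * cos (n%:R * x) /\
  complex.Im (z ^- n) = - ((cabs z ^+ n)^-1 * sin (n%:R * x)).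
Proof.
move=> zE z0; have zp : 0 < cabs z by rewrite cabs_gt0.
have -> : z ^- n = ofR (cabs z ^+ n)^-1 * expi (- (n%:R * x)).
  have -> : ofR (cabs z ^+ n)^-1 = (ofR (cabs z)) ^- n :> C.
    have X m : ofR (cabs z ^+ m) = ofR (cabs z) ^+ m :> C.
      by elim: m => [|m IH]; rewrite ?expr0 // !exprS ofRM IH.
    apply: (@mulfI C (ofR (cabs z ^+ n))); first by rewrite ofR_eq0 expf_neq0 // gt_eqF.
    by rewrite -ofRM divff ?expf_neq0 ?gt_eqF // X divff // -X ofR_eq0 expf_neq0 // gt_eqF.
  by rewrite expiN -expiX -invfM {1}zE /expw lnK ?posrE // -exprMn mulrC.
by rewrite reM imM /= cosN sinN !mul0r subr0 addr0 mulrN.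
Qed.

(** [z^-n] has real part [|z|^-n cos (n x)] and imaginary part [- |z|^-n sin (n x)]; the Cauchy
    criterion for the Lindelof sums makes the sums over shells small, as [shell_integral_eq0]
    asks. *)
Lemma lindelof_balanced (D : {measure set mR -> \bar R}) (E : set R) b (p : R) :
  p = n%:R -> 0 < p -> circle_measure D -> (forall a b : R, a < b <= a + twopi -> ~ E a -> ~ E b ->
  (fun r : R => count_sector L r a b / r `^ p) @ +oo --> fine (D `]a, b[%classic)) -> good D E b ->
  \int[D]_(x in `]b, b + twopi]) cos (p * x) = 0 /\ \int[D]_(x in `]b, b + twopi]) sin (p * x) = 0.
Proof.
move=> pE p0 hD hE gb.
have Lcos x y : `|cos (p * x) - cos (p * y)| <= p * `|x - y|.
  have := @sin_lipschitz R (pi / 2 - p * x) (pi / 2 - p * y).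
  rewrite !sinB !sin_pihalf !cos_pihalf !mul1r !mul0r !subr0.
  rewrite (_ : pi / 2 - p * x - (pi / 2 - p * y) = p * (y - x)); last by ring.
  by rewrite normrM gtr0_norm // (distrC y).
have Lsin x y : `|sin (p * x) - sin (p * y)| <= p * `|x - y|.
  by apply: le_trans (sin_lipschitz _ _) _; rewrite -mulrBr normrM gtr0_norm.
(* [G] stands for the real or the imaginary part, [c] for the sign in front of the corresponding
   trigonometric function. *)
have shE (G : C -> R) (c : R) (g : R -> R) : (forall z, `|G z| <= cabs z) ->
    (forall z w, G (z + w) = G z + G w) -> G 0 = 0 -> (forall (k : nat) z, G (k%:R * z) = k%:R * G z) ->
    `|c| = 1 ->
    (forall z, z != 0 -> G (z ^- n) = c * ((cabs z ^+ n)^-1 * g (angz b z))) ->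
    forall e, 0 < e -> exists M, forall r q, M < r -> 0 < r -> 1 < q ->
     `|\sum_(z <- pts L (q * r) | r <= cabs z) (L z)%:R * (cabs z `^ p)^-1 * g (angz b z)| <= e.
  move=> Gle GD G0 GM c1 GE e e0; have [M HM] := lindelof_cauchy e0.
  exists M => r q Mr r0 q1.
  have rq : r <= q * r by rewrite ler_peMl // ltW.
  have := le_trans (Gle _) (HM r (q * r) Mr (lt_le_trans Mr rq)).
  have Gs (s : seq C) (F : C -> C) : G (\sum_(z <- s) F z) = \sum_(z <- s) G (F z).
    by elim: s => [|z s IH]; rewrite ?big_nil // !big_cons GD IH.
  have GB (a d : C) : G (a - d) = G a - G d.
    by apply: (@addIr _ (G d)); rewrite subrK -GD subrK.
  rewrite GB /lsum !Gs sum_pts_shell //.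
  set S1 := \sum_(_ <- _ | _) _; set S2 := \sum_(_ <- _ | _) _.
  have -> : S1 = c * S2.
    rewrite /S1 /S2 mulr_sumr big_seq_cond [RHS]big_seq_cond; apply: eq_bigr => z /andP[].
    rewrite mem_pts // => /andP[_ /andP[z0 _]] _.
    rewrite GM GE -?cabs_gt0 // pE powR_mulrn ?ltW //; ring.
  by rewrite normrM c1 mul1r.
split.
  apply: (shell_integral_eq0 hD hE p0 (g := fun x => cos (p * x)) gb Lcos).
    by move=> x; rewrite ler_norml cos_geN1 cos_le1.
  apply: (shE (fun z => complex.Re z) 1 (fun x => cos (p * x))) => //; [exact: Re_le_cabs|exact: reD| |exact: normr1|].
    by move=> k z; rewrite reM -(_ : ofR k%:R = k%:R :> C) /= ?mul0r ?subr0 //; exact: (rmorph_nat (real_complex R)).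
  move=> z z0; have [_ zE] := angzP b z0.
  by have [-> _] := expw_Vn zE z0; rewrite mul1r pE.
apply: (shell_integral_eq0 hD hE p0 (g := fun x => sin (p * x)) gb Lsin).
  by move=> x; rewrite ler_norml sin_geN1 sin_le1.
apply: (shE (fun z => complex.Im z) (-1) (fun x => sin (p * x))) => //; [exact: Im_le_cabs|exact: imD| |by rewrite normrN normr1|].
  by move=> k z; rewrite imM -(_ : ofR k%:R = k%:R :> C) /= ?mul0r ?addr0 //; exact: (rmorph_nat (real_complex R)).
move=> z z0; have [_ zE] := angzP b z0.
by have [_ ->] := expw_Vn zE z0; rewrite mulN1r pE.
Qed.
End integer.
End Lindelof.

(** * Weighted values of the indicator *)

Section Main.
Context {R : realType}.
Local Notation C := (Cplx R).
Local Notation twopi := ((pi : R) *+ 2).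
Local Notation mR := (measurableTypeR R).
Implicit Types (x y : R) (z : C).

Section weights.
Variables (p : R) (n : nat) (w t : 'I_n -> R).
Hypotheses (p0 : 0 < p) (w0 : forall i, 0 <= w i) (w1 : \sum_i w i = 1).
Hypotheses (bc : \sum_i w i * cos (p * t i) = 0) (bs : \sum_i w i * sin (p * t i) = 0).

Lemma Phi3E x : Phi3 p w t x = \sum_i w i * \sum_(j < 3) sinp p (t i - x - twopi * j%:R).
Proof.
rewrite /Phi3 /phi -!big_split; apply: eq_bigr => i _ /=.
have S3 (F : nat -> R) : \sum_(j < 3) F j = F 0%N + F 1%N + F 2%N by rewrite !big_ord_recr big_ord0 /= add0r.
rewrite (S3 (fun j => sinp p (t i - x - twopi * j%:R))) mulr0 subr0 mulr1.
rewrite (_ : t i - (x + twopi) = t i - x - twopi); last by ring.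
rewrite (_ : t i - (x + twopi *+ 2) = t i - x - twopi * 2); last by rewrite -[twopi *+ 2]mulr_natr; ring.
by ring.
Qed.

(** For non-integer [p] the kernel is itself a sinusoid of frequency [p] and is balanced out. For
    integer [p] its factor [t i - x] splits: the part with [x] is balanced out, the part with [t i]
    leaves a sinusoid in [x]. *)
Lemma weighted_kerh : exists al be, (p \isn't a Num.nat -> al = 0 /\ be = 0) /\
  forall x, \sum_i w i * kerh p (t i - x) = al * cos (p * x) + be * sin (p * x).
Proof.
case: (boolP (p \is a Num.nat)) => pn; last first.
  exists 0, 0; split => // x; rewrite !mul0r addr0.
  transitivity (pi / sin (pi * p) * \sum_i w i * cos (p * (t i - (x + pi)))); last first.
    by rewrite (balanced_cos bc bs) mulr0.
  rewrite mulr_sumr; apply: eq_bigr => i _; rewrite /kerh (negbTE pn).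
  by rewrite (_ : t i - (x + pi) = t i - x - pi); ring.
pose A := \sum_i w i * (t i * sin (p * t i)); pose B := \sum_i w i * (t i * cos (p * t i)).
exists (- A), B; split => // x.
transitivity (- A * cos (p * x) + B * sin (p * x) + x * \sum_i w i * sin (p * (t i - x))); last first.
  by rewrite (balanced_sin bc bs) mulr0 addr0.
rewrite /A /B mulNr !mulr_suml mulr_sumr -sumrN -!big_split /=.
by apply: eq_bigr => i _; rewrite /kerh pn mulrBr sinB; ring.
Qed.

(** The correction terms of [ker3] produce [Phi3], the full sines being balanced out. The factor [1]
    gives the right-hand side the shape that [Rint_lin] integrates. *)
Lemma weighted_ker3 : exists al be, (p \isn't a Num.nat -> al = 0 /\ be = 0) /\
  forall x, \sum_i w i * ker3 p (t i - x) = 1 * (al * cos (p * x) + be * sin (p * x)) + twopi * Phi3 p w t x.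
Proof.
have [al [be [ab H]]] := weighted_kerh; exists al, be; split => // x.
rewrite mul1r -H Phi3E.
transitivity (\sum_i w i * kerh p (t i - x) - twopi * (\sum_i w i * sin (p * (t i - x))) +
   twopi * \sum_i w i * \sum_(j < 3) sinp p (t i - x - twopi * j%:R)); last first.
  by rewrite (balanced_sin bc bs) mulr0 subr0.
by rewrite !mulr_sumr -sumrB -big_split /=; apply: eq_bigr => i _; rewrite /ker3; ring.
Qed.
End weights.

Variables (rho : R) (L : C -> nat).
Hypotheses (hrho : 2^-1 < rho) (hL : discrete L).

Let rho0 : 0 < rho.
Proof. by apply: lt_trans hrho; rewrite invr_gt0. Qed.

Lemma weighted_h_measure_le (D : {measure set mR -> \bar R}) (n : nat) (w t : 'I_n -> R) u (f : C -> C) b s :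
  is_angular_density rho L D -> (forall m : nat, rho = m%:R -> lindelof m L) ->
  (forall i, 0 <= w i) -> \sum_i w i = 1 ->
  \sum_i w i * cos (rho * t i) = 0 -> \sum_i w i * sin (rho * t i) = 0 ->
  (forall i, u <= t i <= u + twopi / rho) ->
  0 <= s -> exp_class rho s f -> vanishes_on L f -> f b != 0 ->
  \sum_i w i * h_measure rho D (t i) <= s.
Proof.
move=> [hD [E [cE hE]]] hl w0 w1 bc bs ht s0 [ef fg] vf fb.
have p2 := @twopi_gt0 R; have pi0 := @pi_gt0 R.
(* This is where [rho > 1/2] enters; the slack leaves an interval in which a good base point [a] can
   be chosen. *)
have gap : 0 < twopi *+ 2 - twopi / rho.
  have -> : twopi *+ 2 - twopi / rho = twopi * (2 - rho^-1) by rewrite -[twopi *+ 2]mulr_natr; ring.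
  by rewrite mulr_gt0 // subr_gt0 -[ltRHS]invrK ltf_pV2 ?posrE ?invr_gt0.
have lt1 : u - (twopi *+ 2 - twopi / rho) - twopi < u - twopi by lra.
have [a /andP[a1 a2] ga] := @exists_good R D hD E cE _ _ lt1.
pose t0 := a + twopi.
have t0a : t0 - twopi = a by rewrite /t0 addrK.
have t0u : t0 <= u by rewrite /t0; lra.
have ut0 : u + twopi / rho < t0 + twopi *+ 2 by rewrite /t0; lra.
have E1 : \sum_i w i * h_measure rho D (t i) = twopi * \int[D]_(x in `]a, a + twopi]) Phi3 rho w t x.
  have hw i : h_measure rho D (t i) = \int[D]_(x in `]a, a + twopi]) ker3 rho (t i - x).
    apply: (h_measure_window hD rho0); have /andP[h1 h2] := ht i.
    have f2 : twopi *+ 2 = 2 * twopi by rewrite mulr_natl.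
    rewrite f2 /t0 in ut0 a1 *; apply/andP; split; lra.
  under eq_bigr do rewrite hw.
  rewrite -(@Rint_sum R D hD n w (fun i x => ker3 rho (t i - x))); last first.
    by move=> i; apply: (@continuous_subr R _ (t i)); exact: continuous_ker3.
  have [al [be [ab H]]] := weighted_ker3 bc bs.
  under eq_Rintegral do rewrite H.
  have cc : continuous (fun x => cos (rho * x)) by exact: continuous_cosM.
  have cs : continuous (fun x => sin (rho * x)) by exact: continuous_sinM.
  have cl : continuous (fun x => al * cos (rho * x) + be * sin (rho * x)).
    by move=> x; apply: cvgD; apply: cvgM; [exact: cvg_cst|exact: cc|exact: cvg_cst|exact: cs].
  have cP : continuous (Phi3 rho w t) := lipschitz_continuous (Phi3_lipschitz t rho0 w0 w1).
  rewrite (Rint_lin hD 1 twopi a (a + twopi) cl cP) (Rint_lin hD al be a (a + twopi) cc cs) mul1r.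
  rewrite -[RHS]add0r; congr (_ + _).
  case: (boolP (rho \is a Num.nat)) => [/Num.Theory.natrP[m rm]|/ab[-> ->]]; last by rewrite !mul0r addr0.
  by have [-> ->] := lindelof_balanced hL (hl m rm) rm rho0 hD hE ga; rewrite !mulr0 addr0.
rewrite E1; apply/ler_addgt0Pr => e e0.
have [K HK] := fg e e0.
have := @Phi3_type_bound R L hL D hD rho E hE rho0 n w t u t0 f b (Num.max 1 K) (s + e) w0 w1 bc bs ht t0u ut0.
rewrite t0a; apply => //.
- exact: entire_holo.
- by rewrite le_max lexx.
- by rewrite addr_ge0 // ltW.
move=> z; apply: le_trans (HK z) _; apply: ler_wpM2r; first exact: expR_ge0.
by rewrite le_max lexx orbT.
Qed.

(** If no measure represents the density, [xget] returns the zero measure; then [h_set] is 0 and the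
    claim reads [0 <= s]. *)
Lemma weighted_h_set_le (n : nat) (w t : 'I_n -> R) u (f : C -> C) b s :
  regular_set rho L ->
  (forall i, 0 <= w i) -> \sum_i w i = 1 ->
  \sum_i w i * cos (rho * t i) = 0 -> \sum_i w i * sin (rho * t i) = 0 ->
  (forall i, u <= t i <= u + twopi / rho) ->
  0 <= s -> exp_class rho s f -> vanishes_on L f -> f b != 0 ->
  \sum_i w i * h_set rho L (t i) <= s.
Proof.
move=> [_ hl] w0 w1 bc bs ht s0 fs vf fb; rewrite /h_set.
have [ex|nex] := pselect (exists D, is_angular_density rho L D).
  have X := @xgetPex {classic {measure set mR -> \bar R}} mzero [set D | is_angular_density rho L D] ex.
  exact: (weighted_h_measure_le X hl w0 w1 bc bs ht s0 fs vf fb).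
have -> : angular_density rho L = mzero.
  exact: (@xgetPN {classic {measure set mR -> \bar R}} mzero [set D | is_angular_density rho L D]
    (fun D hD => nex (ex_intro _ D hD))).
rewrite big1 // => i _; rewrite /h_measure /Rintegral !integral_measure_zero /= oppr0 mulr0.
by case: ifP; rewrite ?mulr0.
Qed.

(** Every [s] in [[0, c)] is a type of uniqueness, since a nonzero [f] would give [c <= s]. If the
    supremum were below [c], the midpoint between the two would be such a type above it. *)
Lemma le_sigma_U c :
  (forall s f b, 0 <= s -> exp_class rho s f -> vanishes_on L f -> f b != 0 -> c <= s) ->
  (c%:E <= sigma_U rho L)%E.
Proof.
move=> H; rewrite /sigma_U; set X := ereal_sup _.
rewrite le_max lee_fin; have [//|c0] := leP c 0.
have HX s : 0 <= s -> s < c -> (s%:E <= X)%E.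
  move=> s0 sc; apply: ereal_sup_ubound; exists s => //; split => // f fs vf z.
  apply/eqP/negPn/negP => fz; have := H s f z s0 fs vf fz; lra.
rewrite leNgt; apply/negP => Xc.
have X0 := HX 0 (lexx _) c0.
have Xf : X \is a fin_num.
  by rewrite ge0_fin_numE //; apply: lt_trans Xc _; exact: ltry.
rewrite -(fineK Xf) lee_fin in X0; rewrite -(fineK Xf) lte_fin in Xc.
have m0 : 0 <= (fine X + c) / 2 by lra.
have mc : (fine X + c) / 2 < c by lra.
have := HX _ m0 mc; rewrite -[X in (_ <= X)%E](fineK Xf) lee_fin; lra.
Qed.

(** The default value of [xget] is [h] itself, so that [A = B = 0] covers the case without a
    balanced modification. *)
Lemma hatE (h : R -> R) : exists A B, forall t, hat rho h t = h t + A * cos (rho * t) + B * sin (rho * t).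
Proof.
rewrite /hat; case: ifP => _; last by exists 0, 0 => t; rewrite !mul0r !addr0.
rewrite /balanced_modification.
set S := [set g | _].
have [ex|nex] := pselect (exists g, S g).
  by have [_ [A [B AB]]] := xgetPex h ex; exists A, B.
exists 0, 0 => t; rewrite !mul0r !addr0 xgetPN // => g Sg; apply: nex; by exists g.
Qed.

Lemma convex_hull_weights (M : set R) : convex_hullC [set expi (t * rho) | t in M] (0 : C) ->
  exists (n : nat) (w t : 'I_n -> R),
  [/\ forall i, 0 <= w i, \sum_i w i = 1, forall i, M (t i),
     \sum_i w i * cos (rho * t i) = 0 & \sum_i w i * sin (rho * t i) = 0].
Proof.
move=> [n [w [q [w0 w1 hq E0]]]].
have /choice[t ht] : forall i, exists x, M x /\ expi (x * rho) = q i.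
  by move=> i; have [x Mx <-] := hq i; exists x.
exists n, w, t; split => // [i||]; first by have [] := ht i.
  have := congr1 (@complex.Re R) E0; rewrite (raddf_sum (@complex.Re R)) /= => E1.
  rewrite {2}E1; apply: eq_bigr => i _.
  by have [_ <-] := ht i; rewrite reM /= mul0r subr0 mulrC (mulrC rho) mulrC.
have := congr1 (@complex.Im R) E0; rewrite (raddf_sum (@complex.Im R)) /= => E1.
rewrite {2}E1; apply: eq_bigr => i _.
by have [_ <-] := ht i; rewrite imM /= mul0r addr0 mulrC (mulrC rho) mulrC.
Qed.
End Main.

Theorem theorem1p6 (R : realType) (rho : R) (L : Cplx R -> nat)
    (hrho : 2^-1 < rho) (hdisc : discrete L) (hreg : regular_set rho L) :
  ((A_set rho L)%:E <= sigma_U rho L)%E /\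
  forall C : R,
    locally_balanced rho [set t | C <= hat rho (h_set rho L) t] ->
    (C%:E <= sigma_U rho L)%E.
Proof.
have rho0 : 0 < rho by apply: lt_trans hrho; rewrite invr_gt0.
split.
  apply: le_sigma_U => s f b s0 fs vf fb.
  rewrite /A_set ler_pdivrMl // /circle_max; apply: ge_sup.
    exists (h_set rho L 0 + h_set rho L (0 + pi / rho)); exists 0 => //.
    by rewrite /= in_itv /= lexx mulrn_wge0 // pi_ge0.
  move=> _ [x _ <-].
  (* The points [e^(i rho t)] for these two angles are opposite, so that equal weights balance
     them. *)
  pose t (i : 'I_2) := x + pi / rho * i%:R.
  have pr : rho * (pi / rho) = pi by rewrite mulrCA divff ?mulr1 // gt_eqF.
  have sum2 (F : 'I_2 -> R) : \sum_i F i = F ord0 + F ord_max.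
    by rewrite big_ord_recr big_ord1 /=; congr (F _ + _); exact: val_inj.
  have H := @weighted_h_set_le R rho L hrho hdisc 2 (fun=> 2^-1) t x f b s hreg.
  have : \sum_(i < 2) 2^-1 * h_set rho L (t i) <= s.
    apply: H => //.
    - by rewrite (sum2 (fun=> 2^-1)); lra.
    - by rewrite sum2 /t /= mulr0 addr0 mulr1 mulrDr pr cosDpi mulrN subrr.
    - by rewrite sum2 /t /= mulr0 addr0 mulr1 mulrDr pr sinDpi mulrN subrr.
    move=> i; have p1 : 0 <= pi / rho by rewrite divr_ge0 ?pi_ge0 // ltW.
    have i1 : i%:R <= 1 :> R by rewrite (ler_nat R i 1) -ltnS.
    have i0 : 0 <= i%:R :> R by [].
    have -> : pi *+ 2 / rho = pi / rho + pi / rho by rewrite mulr2n mulrDl.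
    have := ler_wpM2l p1 i1; have := mulr_ge0 p1 i0; rewrite /t mulr1; lra.
  by rewrite sum2 /t /= mulr0 addr0 mulr1 -mulrDr ler_pdivrMl.
move=> c [u [_ /convex_hull_weights[n [w [t [w0 w1 ht bc bs]]]]]].
apply: le_sigma_U => s f b s0 fs vf fb.
have [A [B AB]] := @hatE R rho (h_set rho L).
apply: (@le_trans _ _ (\sum_i w i * hat rho (h_set rho L) (t i))).
  rewrite -[leLHS]mul1r -w1 mulr_suml; apply: ler_sum => i _; apply: ler_wpM2l => //.
  by have [] := ht i.
(* The two functions differ by a sinusoid of frequency [rho], which balanced weights annihilate. *)
have -> : \sum_i w i * hat rho (h_set rho L) (t i) = \sum_i w i * h_set rho L (t i).
  transitivity (\sum_i w i * h_set rho L (t i) + A * (\sum_i w i * cos (rho * t i)) +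
    B * (\sum_i w i * sin (rho * t i))); last by rewrite bc bs !mulr0 !addr0.
  by rewrite !mulr_sumr -!big_split /=; apply: eq_bigr => i _; rewrite AB; ring.
apply: (weighted_h_set_le hrho hdisc hreg w0 w1 bc bs (u := u)) fb => // i.
by have [_] := ht i; rewrite /= in_itv.
Qed.
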